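(* Let $A$ be an invertible even linear operator in a $p|q$-dimensional superspace $V$ over $\mathcal A$, and put $c_k=\operatorname{Tr}\Lambda^kA$ (with $c_k=0$ for $k<0$). Assume that the Hankel determinant $\det(c_{p-q+2+i+j})_{0\le i,j\le q-1}$ is invertible in $\mathcal A_0$. Then the Berezinian of $A$ equals the ratio of Hankel determinants of orders $q+1$ and $q$ $$\operatorname{Ber}A=\frac{\begin{vmatrix}\operatorname{Tr}\Lambda^{p-q}A&\dots&\operatorname{Tr}\Lambda^{p}A\\ \dots&\dots&\dots\\ \operatorname{Tr}\Lambda^{p}A&\dots&\operatorname{Tr}\Lambda^{p+q}A\end{vmatrix}}{\begin{vmatrix}\operatorname{Tr}\Lambda^{p-q+2}A&\dots&\operatorname{Tr}\Lambda^{p+1}A\\ \dots&\dots&\dots\\ \operatorname{Tr}\Lambda^{p+1}A&\dots&\operatorname{Tr}\Lambda^{p+q}A\end{vmatrix}}=\frac{\det(c_{p-q+i+j})_{0\le i,j\le q}}{\det(c_{p-q+2+i+j})_{0\le i,j\le q-1}},$$ and this ratio is equal, up to sign, to the ratio of the traces of the representations of $A$ in the invariant subspaces of tensors corresponding to the rectangular Young diagrams $D(p,q+1)$ and $D(p+1,q)$: $$\operatorname{Ber}A=\pm\frac{\operatorname{Tr}A_{D(p,q+1)}}{\operatorname{Tr}A_{D(p+1,q)}}.$$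
   Context: Let $\mathcal A=\mathcal A_0\oplus\mathcal A_1$ be a $\mathbb Z_2$-graded supercommutative algebra over $\mathbb C$. A $p|q$-dimensional superspace $V$ means a free $\mathbb Z_2$-graded $\mathcal A$-module of rank $p|q$. An even operator $A$ is given by a block matrix $\begin{pmatrix} A_{00} & A_{01} \\ A_{10} & A_{11} \end{pmatrix}$ with entries of $A_{00}$ ($p\times p$) and $A_{11}$ ($q\times q$) in $\mathcal A_0$ and entries of $A_{01},A_{10}$ in $\mathcal A_1$. $\operatorname{Tr}$ denotes the supertrace, $\operatorname{Tr}A=\operatorname{Tr}A_{00}-\operatorname{Tr}A_{11}$, and $\operatorname{Ber}A=\det(A_{00}-A_{01}A_{11}^{-1}A_{10})\,(\det A_{11})^{-1}$. $\Lambda^kV$ is the $k$-th exterior power in the super sense: the degree-$k$ part of the quotient of the tensor algebra $T(V)$ by the ideal generated by $v\otimes u+(-1)^{\tilde v\tilde u}u\otimes v$ for homogeneous $u,v$ of parities $\tilde u,\tilde v$, with $\mathbb Z_2$-grading inherited from $V$. $\Lambda^kA$ is the induced operator; $\Lambda^kV=0$ for $k<0$ and $c_0=1$. For a Young diagram $D$ with $N$ cells, $V_D\subset V^{\otimes N}$ denotes the invariant subspace of tensors with symmetry type $D$ (the image of a Young symmetrizer of $D$, where the symmetric group $S_N$ acts on $V^{\otimes N}$ with the super sign rule, normalized so that a single column of length $k$ gives $\Lambda^kV$), and $A_D$ denotes the operator induced by $A$ on $V_D$. $D(r,s)$ is the rectangular Young diagram with $r$ rows and $s$ columns. An empty determinant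 (order $0$) and the trace for the empty diagram are equal to $1$. *)

(* Defs.v *)
(* The complex numbers are [R[i]], for [R : realType]. *)
From HB Require Import structures.
From mathcomp Require Import all_boot all_order all_algebra all_fingroup.
From mathcomp Require Import complex.
From mathcomp Require Import boolp classical_sets reals.

Set Implicit Arguments.
Unset Strict Implicit.
Unset Printing Implicit Defensive.

Import GRing.Theory.
Local Open Scope ring_scope.

(* Parities are booleans: [false] is even, [true] is odd, [(+)] is addition. *)

(* [gr false] and [gr true] are the even and the odd part of [G].  The unit-ring
   structure on [G] is no restriction: it only makes [x^-1] available, and
   [x \is a GRing.unit] means that [x] has a two-sided inverse. *)
Record supercommutative (C : comNzRingType) (G : unitAlgType C)
    (gr : bool -> {pred G}) : Prop := Supercommutative {
  gr0 : forall e, 0 \in gr e;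
  grD : forall e x y, x \in gr e -> y \in gr e -> x + y \in gr e;
  grZ : forall e (a : C) x, x \in gr e -> a *: x \in gr e;
  gr_sum : forall x, exists x0 x1, [/\ x0 \in gr false, x1 \in gr true & x = x0 + x1];
  gr_direct : forall x, x \in gr false -> x \in gr true -> x = 0;
  gr1 : 1 \in gr false;
  grM : forall e f x y, x \in gr e -> y \in gr f -> x * y \in gr (e (+) f);
  gr_comm : forall e f x y, x \in gr e -> y \in gr f ->
    x * y = (-1) ^+ (e && f) * (y * x)
}.

Definition unit_in (G : unitRingType) (P : {pred G}) (x : G) : Prop :=
  [/\ x \in P, x \is a GRing.unit & x^-1 \in P].

(* Free supermodules are right modules: the finite function [t] stands for
   [\sum_x e_x (t x)], where the basis vector [e_x] has parity [par x].  With
   this convention an even operator acts on columns of coordinates by its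
   matrix, and composition is the matrix product. *)
Section FreeModule.
Variables (G : unitRingType) (gr : bool -> {pred G}).
Variables (X : finType) (par : X -> bool).
Implicit Types (W I : set {ffun X -> G}) (F : {ffun X -> G} -> {ffun X -> G}).

Definition rscale (t : {ffun X -> G}) (a : G) : {ffun X -> G} :=
  [ffun x => t x * a].

Definition homog (e : bool) (t : {ffun X -> G}) : Prop :=
  forall x, t x \in gr (par x (+) e).

Definition lincomb m (b : 'I_m -> {ffun X -> G}) (a : 'I_m -> G) : {ffun X -> G} :=
  \sum_(i < m) rscale (b i) (a i).

(* The classes of the [b i] form a basis of the graded module [W / I] (for
   submodules [I] of [W]), the vector [b i] being homogeneous of parity [pi i]. *)
Definition homog_basis W I m (b : 'I_m -> {ffun X -> G}) (pi : 'I_m -> bool) : Prop :=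
  [/\ forall i, W (b i) /\ homog (pi i) (b i),
      forall w, W w -> exists a, I (w - lincomb b a) &
      forall a, I (lincomb b a) -> forall i, a i = 0].

(* The supertrace of the operator induced by [F] on [W / I], computed in some
   homogeneous basis; it does not depend on the basis when [F] is even. *)
Definition is_strace W I F (t : G) : Prop :=
  exists m (b : 'I_m -> {ffun X -> G}) (pi : 'I_m -> bool) (M : 'M[G]_m),
    [/\ homog_basis W I b pi,
        forall j, I (F (b j) - lincomb b (fun i => M i j)) &
        t = \sum_(i < m) (-1) ^+ pi i * M i i].

Definition strace W I F : G := xget 0 [set t | is_strace W I F t].

End FreeModule.

(* The superspace [V] of dimension [p|q] is free on [e_i], [i < p + q]. *)
Definition vpar p q (i : 'I_(p + q)) : bool := (p <= i)%N.

Definition even_mx (G : unitRingType) (gr : bool -> {pred G}) p q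
    (A : 'M[G]_(p + q)) : Prop :=
  forall i j, A i j \in gr (vpar i (+) vpar j).

Definition invertible_mx (G : unitRingType) n (A : 'M[G]_n) : Prop :=
  exists B : 'M[G]_n, A *m B = 1%:M /\ B *m A = 1%:M.

(* The two-sided inverse (junk if there is none): [invmx] requires a commutative
   coefficient ring. *)
Definition inv_mx (G : unitRingType) n (A : 'M[G]_n) : 'M[G]_n :=
  xget A [set B | A *m B = 1%:M /\ B *m A = 1%:M].

(* The determinants are those of matrices whose entries are even, hence commute. *)
Definition Ber (G : unitRingType) p q (A : 'M[G]_(p + q)) : G :=
  \det (ulsubmx A - ursubmx A *m inv_mx (drsubmx A) *m dlsubmx A)
  * (\det (drsubmx A))^-1.

Section Tensors.
Variables (G : unitRingType) (gr : bool -> {pred G}) (p q : nat).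

(* Index set of the basis [e_(I 0) (x) ... (x) e_(I (k-1))] of [V^(x)k]. *)
Definition tidx k : finType := {ffun 'I_k -> 'I_(p + q)}.
Definition tensor k := {ffun tidx k -> G}.

Definition tpar k (I : tidx k) : bool :=
  \big[addb/false]_(r < k) vpar (I r).

(* [v_0 (x) ... (x) v_(k-1)] for homogeneous [v_r] of parity [e r]: the sign comes
   from moving the coordinate [v_r^i], of parity [e r + vpar i], to the right past
   the basis vectors of the factors [s > r]. *)
Definition tens k (e : 'I_k -> bool) (v : 'I_k -> 'cV[G]_(p + q)) : tensor k :=
  [ffun I : tidx k =>
    (-1) ^+ (\sum_(s < k) \sum_(r < k | (r < s)%N)
               ((e r (+) vpar (I r)) && vpar (I s)))%N
    * \prod_(r < k) v r (I r) 0].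

(* [A^(x)k]: the right-linear map with
   [e_(J 0) (x) ... (x) e_(J (k-1)) |-> A e_(J 0) (x) ... (x) A e_(J (k-1))]. *)
Definition tens_op (A : 'M[G]_(p + q)) k (t : tensor k) : tensor k :=
  \sum_(J : tidx k)
    rscale (tens (fun r => vpar (J r)) (fun r => col (J r) A)) (t J).

Definition vhomog (e : bool) (v : 'cV[G]_(p + q)) : Prop :=
  forall i, v i 0 \in gr (vpar i (+) e).

(* The degree-[k] part of the ideal of [T(V)] generated by the elements
   [v (x) u + (-1)^(~v ~u) u (x) v]: it is spanned by these elements multiplied by
   decomposable tensors on both sides, [v] being at place [i] and [u] at [i + 1]. *)
Inductive ext_ideal k : tensor k -> Prop :=
| ExtIdeal0 : ext_ideal 0
| ExtIdealD s t : ext_ideal s -> ext_ideal t -> ext_ideal (s + t)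
| ExtIdealZ t a : ext_ideal t -> ext_ideal (rscale t a)
| ExtIdealGen e v (i j : 'I_k) :
    j = i.+1 :> nat -> (forall r, vhomog (e r) (v r)) ->
    ext_ideal (tens e v
               + rscale (tens (fun r => e (tperm i j r)) (fun r => v (tperm i j r)))
                        ((-1) ^+ (e i && e j))).

(* [Tr (Lambda^k A)], with [Lambda^k V] the degree-[k] part of [T(V)] modulo the
   ideal, and [0] for negative [k]. *)
Definition tr_ext (A : 'M[G]_(p + q)) (k : int) : G :=
  match k with
  | Posz n => strace gr (@tpar n) setT [set t | ext_ideal t] (@tens_op A n)
  | Negz _ => 0
  end.

(* The action of [s] on [V^(x)N] moving the factor at place [r] to place [s r],
   with a sign [-1] for each pair of odd factors whose order is reversed. *)
Definition perm_op N (s : 'S_N) (t : tensor N) : tensor N :=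
  [ffun K : tidx N =>
    let I : tidx N := [ffun r => K (s r)] in
    (-1) ^+ (\sum_(r1 < N) \sum_(r2 < N | (r1 < r2)%N && (s r2 < s r1)%N)
               (vpar (I r1) && vpar (I r2)))%N
    * t I].

(* A Young diagram is given by the list [D] of its row lengths; its cells are
   numbered row by row, cell [i] being in row [reshape_index D i] and in column
   [reshape_offset D i]. *)
Definition row_stab (D : seq nat) : {set 'S_(sumn D)} :=
  [set s : 'S_(sumn D) | [forall i, reshape_index D (s i) == reshape_index D i]].

Definition col_stab (D : seq nat) : {set 'S_(sumn D)} :=
  [set s : 'S_(sumn D) | [forall i, reshape_offset D (s i) == reshape_offset D i]].

Definition young_symmetrizer (D : seq nat) (t : tensor (sumn D)) : tensor (sumn D) :=
  \sum_(a in row_stab D) \sum_(b in col_stab D)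
    rscale (perm_op a (perm_op b t)) ((-1) ^+ odd_perm b).

(* [Tr A_D], with [V_D] the image of the Young symmetrizer; for a single column
   [V_D] consists of the (super) antisymmetric tensors. *)
Definition tr_young (A : 'M[G]_(p + q)) (D : seq nat) : G :=
  strace gr (@tpar (sumn D)) (range (@young_symmetrizer D)) [set 0]
    (@tens_op A (sumn D)).

End Tensors.

Definition rect (r s : nat) : seq nat := nseq r s.

(* [det (c_(a + i + j))], [0 <= i, j < m]. *)
Definition hankel (G : unitRingType) (c : int -> G) (a : int) (m : nat) : G :=
  \det (\matrix_(i < m, j < m) c (a + i%:Z + j%:Z)).

(* Main.v *)
Require Import Defs.
From HB Require Import structures.
From mathcomp Require Import all_boot all_order all_algebra all_fingroup.
From mathcomp Require Import complex reals zify ring spectral mxred.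

Set Implicit Arguments.
Unset Strict Implicit.
Unset Printing Implicit Defensive.

Import GRing.Theory Num.Theory.
Local Open Scope ring_scope.

(* All the traces in the statement are linear combinations of the supertraces of
   [A^(x)N] composed with permutations of the factors, and these are invariant under
   conjugation of [A].

   Write [A = (a b; c d)].  The denominator [H'] is a unit, and up to nilpotents it only
   depends on [a] and [d]; its value at [(a, d)] is [+- det d * det (chi_d (a))].  Hence
   [chi_d (a)] is invertible, the Sylvester equation [a X - X d = Y] is solvable, and so,
   by iteration in the nilpotent filtration by odd elements, is the Riccati equation
   [a X + X c X = b + X d].  The unipotent matrix with upper right block [X] conjugates
   [A] to a block lower triangular matrix with diagonal blocks [a' = a + X c] and
   [d' = d - c X], and [Ber A = det a' / det d'] because
   [det (1 - X Y) det (1 - Y X) = 1] for odd [X], [Y].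

   What remains are identities between polynomials in the entries of [a'] and [d'], which
   lie in a commutative ring; they may be checked on triangular matrices over a field, with
   generic diagonals [x] and [y].  There [sum_k c_k z^k] is the quotient of
   [prod_i (1 + x_i z)] by [prod_j (1 + y_j z)], and Cramer's rule for the resulting linear
   recurrence gives the ratio of Hankel determinants.  The trace attached to a rectangle,
   as a polynomial in [t] after replacing [x] by [t x], vanishes at all [t = y_j / x_i],
   since there a letter [x_i] cancels a letter [y_j], and the trace attached to an [r x s]
   rectangle is zero for fewer than [r] letters [x] and fewer than [s] letters [y]; this
   determines it up to a constant. *)

(** * Signs of permuted odd factors *)

(** Two obstacles shape the argument. The entries of [A] do not commute, so [A] itself has no
    eigenvalues or characteristic polynomial to work with: signs are handled as parities of
    inversion counts, and determinants are computed in [even_part], the even elements packed as a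
    commutative ring. Block triangularity makes the odd entries disappear from the traces, but the
    unit hypothesis concerns [A] before conjugation and is needed to find the conjugating matrix;
    comparing [A] with its diagonal blocks modulo nilpotents breaks this circle.

    The constant left open by the vanishing argument is fixed at the point where all even letters
    are zero. Up to sign it is the integer [kappa] such that the square of the Young symmetrizer is
    [kappa] times the symmetrizer. The same integer normalizes the symmetrizer to an idempotent,
    hence divides the trace on its image, so it cancels and only a sign remains. For this, [kappa]
    has to be the same in all representations of the symmetric group, and for a rectangle and its
    transpose. *)

Definition sinv N (s : 'S_N) (pi : 'I_N -> bool) : nat :=
  (\sum_(r1 < N) \sum_(r2 < N | (r1 < r2)%N && (s r2 < s r1)%N)
     (pi r1 && pi r2))%N.

(** [phi s] sends an increasing pair to the pair of images, put in increasing order; it permutes the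
    unordered pairs, on which the symmetric [g] is well defined. *)
Lemma addb_pairs_perm N (s : 'S_N) (g : 'I_N -> 'I_N -> bool) :
  (forall x y, g x y = g y x) ->
  \big[addb/false]_(u : 'I_N * 'I_N | (u.1 < u.2)%N) g (s u.1) (s u.2) =
  \big[addb/false]_(u : 'I_N * 'I_N | (u.1 < u.2)%N) g u.1 u.2.
Proof.
move=> gC; pose phi (s : 'S_N) (u : 'I_N * 'I_N) :=
  if (u.1 < u.2)%N == (s u.1 < s u.2)%N then (s u.1, s u.2) else (s u.2, s u.1).
have phiK (t t' : 'S_N) : cancel t t' -> cancel (phi t) (phi t').
  move=> tK [x y]; rewrite /phi /=.
  case h: ((x < y)%N == (t x < t y)%N); rewrite /= !tK.
    by rewrite eq_sym h.
  case: (eqVneq x y) h => [->|nxy]; first by rewrite ltnn; case: ifP.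
  have nt : t x != t y by rewrite (can_eq tK).
  by case: (ltngtP x y) nxy => [||/val_inj->] //; rewrite ?eqxx //;
    case: (ltngtP (t x) (t y)) nt => [||/val_inj->] //; rewrite ?eqxx.
rewrite [RHS](reindex (phi s)) /=; last first.
  exists (phi s^-1%g) => u _; first exact: (phiK s s^-1%g (permK s)).
  exact: (phiK s^-1%g s (permKV s)).
apply: eq_big => [[x y]|[x y] /= lt_xy]; rewrite /phi /=.
  case: (eqVneq x y) => [->|nxy]; first by rewrite ltnn; case: ifP; rewrite /= ltnn.
  have ns : s x != s y by rewrite (inj_eq perm_inj).
  by case: (ltngtP x y) nxy => [||/val_inj->] //; rewrite ?eqxx //;
    case: (ltngtP (s x) (s y)) ns => [||/val_inj->] //=; rewrite ?eqxx //=;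
    case: (ltngtP (s x) (s y)).
by rewrite lt_xy; case: ifP.
Qed.

Lemma odd_sinv N (s : 'S_N) (pi : 'I_N -> bool) :
  odd (sinv s pi) = \big[addb/false]_(u : 'I_N * 'I_N | (u.1 < u.2)%N)
    [&& pi u.1, pi u.2 & (u.1 < u.2)%N (+) (s u.1 < s u.2)%N].
Proof.
rewrite /sinv pair_big_dep /= (big_morph odd oddD (erefl _)) big_mkcondr /=.
apply: eq_bigr => -[x y] /= lt_xy; rewrite lt_xy addTb.
have : s x != s y by rewrite (inj_eq perm_inj); apply/eqP => e; rewrite e ltnn in lt_xy.
by case: (ltngtP (s x) (s y)) => [||/val_inj->]; rewrite ?eqxx //=;
  case: (pi x); case: (pi y).
Qed.

(** The cocycle identity that makes signed permutation operators a representation: a pair is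
    reversed by the product exactly when it is reversed by one factor only. *)
Lemma odd_sinvM N (s' s : 'S_N) (pi : 'I_N -> bool) :
  odd (sinv (s' * s)%g (pi \o s')) = odd (sinv s' (pi \o s')) (+) odd (sinv s pi).
Proof.
rewrite !odd_sinv; pose g x y := [&& pi x, pi y & (x < y)%N (+) (s x < s y)%N].
rewrite -[X in _ (+) X](@addb_pairs_perm _ s' g); last first.
  move=> x y; rewrite /g andbCA; congr [&& _, _ & _].
  case: (eqVneq x y) => [->|nxy] //.
  have ns : s x != s y by rewrite (inj_eq perm_inj).
  case: (ltngtP x y) nxy => [||/val_inj->] //; rewrite ?eqxx //;
    by case: (ltngtP (s x) (s y)) ns => [||/val_inj->] //; rewrite ?eqxx.
rewrite -big_split /=; apply: eq_bigr => -[x y] /= _; rewrite !permM /g.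
by case: (pi (s' x)); case: (pi (s' y)) => //=; rewrite -addbA addKb.
Qed.

Lemma eq_sinv N (s : 'S_N) (pi pi' : 'I_N -> bool) : pi =1 pi' -> sinv s pi = sinv s pi'.
Proof. by move=> e; apply: eq_bigr => i _; apply: eq_bigr => j _; rewrite !e. Qed.

Lemma sinv1 N (pi : 'I_N -> bool) : sinv 1 pi = 0%N.
Proof.
rewrite /sinv big1 // => x _; rewrite big_pred0 // => y; rewrite !perm1.
by apply/negP => /andP[h]; rewrite ltnNge ltnW.
Qed.

(** A position strictly between [u] and [v] is passed by both of them, which have the same parity,
    so its two contributions cancel modulo 2; only the pair of [u] and [v] is left. *)
Lemma odd_sinv_tperm N (u v : 'I_N) (pi : 'I_N -> bool) : pi u = pi v -> u != v ->
  odd (sinv (tperm u v) pi) = pi u.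
Proof.
wlog lt_uv : u v / (u < v)%N.
  move=> IH; case: (ltngtP u v) => [||/val_inj->]; [exact: IH| |by rewrite eqxx].
  by move=> lt e ne; rewrite tpermC (IH v u) // eq_sym.
move=> e ne; rewrite odd_sinv.
rewrite (bigID (fun w : 'I_N * 'I_N => (w.1 == u) && (w.2 == v))) /=.
rewrite (big_pred1 (u, v)) /=; last first.
  by move=> [x y] /=; rewrite xpair_eqE; apply: andb_idl => /andP[/eqP-> /eqP->].
rewrite tpermL tpermR lt_uv (ltnNge v u) (ltnW lt_uv) -e /= andbT andbb.
rewrite (bigID (fun w : 'I_N * 'I_N => (w.1 == u) )) /=.
rewrite [X in _ (+) (_ (+) X)](bigID (fun w : 'I_N * 'I_N => (w.2 == v) )) /=.
pose S (w : 'I_N * 'I_N) := [&& pi w.1, pi w.2 &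
  (w.1 < w.2)%N (+) (tperm u v w.1 < tperm u v w.2)%N].
rewrite -/S.
rewrite [X in _ (+) (_ (+) (_ (+) X))]big1 ?addbF; last first.
  move=> [x y] /= /andP[/andP[/andP[lt_xy _] nx] ny].
  suff : (tperm u v x < tperm u v y)%N by rewrite lt_xy => ->; rewrite !andbF.
  have [exv|nxv] := eqVneq x v.
    rewrite exv in lt_xy *; have nyu : y != u.
      by apply/eqP => yu; have := ltn_trans lt_uv lt_xy; rewrite yu ltnn.
    by rewrite tpermR tpermD 1?eq_sym // (ltn_trans lt_uv).
  rewrite (tpermD (z := x)) 1?eq_sym //.
  have [eyu|nyu] := eqVneq y u.
    by rewrite eyu in lt_xy *; rewrite tpermL (ltn_trans lt_xy).
  by rewrite tpermD 1?eq_sym.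
pose T := \big[addb/false]_(w < N | (u < w < v)%N) (pi u && pi w).
have S1E : \big[addb/false]_(w : 'I_N * 'I_N | (w.1 < w.2)%N &&
   ~~ ((w.1 == u) && (w.2 == v)) && (w.1 == u)) S w = T.
  rewrite (eq_bigl (fun w : 'I_N * 'I_N => (xpred1 u w.1) && ((u < w.2)%N && (w.2 != v)))).
    rewrite -(pair_big_dep (xpred1 u) (fun _ (y : 'I_N) => (u < y)%N && (y != v))
       (fun x y => S (x, y))) big_pred1_eq /T /S /=.
    rewrite big_mkcond [RHS]big_mkcond /=; apply: eq_bigr => y _.
    rewrite tpermL; case: (ltngtP u y) => //= lt_uy.
    case: eqP => [->|/eqP nyv]; first by rewrite ltnn.
    rewrite tpermD //=; last by rewrite eq_sym.
      case: (ltngtP y v) => [||/val_inj yv] //; rewrite ?andbT ?andbF //.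
      by rewrite yv eqxx in nyv.
    by apply/eqP => uy; rewrite uy ltnn in lt_uy.
  by move=> [x y] /=; case: (x =P u) => [->|]; rewrite /= ?andbT ?andbF.
rewrite S1E.
have -> : \big[addb/false]_(w : 'I_N * 'I_N | (w.1 < w.2)%N &&
   ~~ ((w.1 == u) && (w.2 == v)) && (w.1 != u) && (w.2 == v)) S w = T.
  rewrite (reindex (fun w : 'I_N * 'I_N => (w.2, w.1))) /=; last first.
    by exists (fun w => (w.2, w.1)) => -[].
  rewrite (eq_bigl (fun w : 'I_N * 'I_N => (xpred1 v w.1) && ((w.2 < v)%N && (w.2 != u)))).
    rewrite -(pair_big_dep (xpred1 v) (fun _ (y : 'I_N) => (y < v)%N && (y != u))
       (fun x y => S (y, x))) big_pred1_eq /T /S /=.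
    rewrite big_mkcond [RHS]big_mkcond /=; apply: eq_bigr => y _.
    rewrite tpermR; case: (ltngtP y v) => //= lt_yv; rewrite ?andbF //.
    case: eqP => [->|/eqP nyu]; first by rewrite ltnn.
    rewrite tpermD //=; last by rewrite eq_sym; apply/eqP => yv; rewrite yv ltnn in lt_yv.
      case: (ltngtP y u) => [||/val_inj yv] //; rewrite ?andbT ?andbF //= -?e 1?andbC //.
      by rewrite yv eqxx in nyu.
    by rewrite eq_sym.
  move=> [x y] /=; case: (x =P v) => [->|]; rewrite /= ?andbT ?andbF //.
  by rewrite -andbA andbb.
by rewrite addbb addbF.
Qed.

(** * Young symmetrizers of a rectangle *)

Section Stabilizer.
Variables (N r : nat) (f : 'I_N -> 'I_r).

(** With the row or column map of a rectangle for [f] this is [row_stab] or [col_stab]; a constant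
    [f] gives the whole symmetric group, and so the antisymmetrizer. *)
Definition fstab : {set 'S_N} := [set a : 'S_N | [forall k, f (a k) == f k]].

Lemma fstabP (a : 'S_N) : reflect (forall k, f (a k) = f k) (a \in fstab).
Proof. by rewrite inE; apply: (iffP forallP) => h k; apply/eqP. Qed.

Lemma fstabM a b : a \in fstab -> (a * b \in fstab)%g = (b \in fstab).
Proof.
move=> /fstabP ha; apply/fstabP/fstabP => hb k; last by rewrite permM hb ha.
by rewrite -{1}(permKV a k) -permM hb -ha permKV.
Qed.

Lemma fstabMr a b : a \in fstab -> (b * a \in fstab)%g = (b \in fstab).
Proof.
by move=> /fstabP ha; apply/fstabP/fstabP => hb k;
  [rewrite -(hb k) permM ha | rewrite permM ha hb].
Qed.

Lemma fstabV a : (a^-1 \in fstab)%g = (a \in fstab).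
Proof.
by apply/fstabP/fstabP => h k; [rewrite -{2}(permK a k) h|rewrite -{2}(permKV a k) h].
Qed.

Lemma tperm_fstab u v : f u = f v -> tperm u v \in fstab.
Proof. by move=> e; apply/fstabP => k; case: tpermP => // ->. Qed.
End Stabilizer.

Lemma mulmx2_eq0 (F : numFieldType) (n : nat) (m : 'M[F]_n) : m *+ 2 = 0 -> m = 0.
Proof.
move=> h; apply/matrixP => i j; have /matrixP/(_ i j) := h.
by rewrite mulmxnE !mxE => /eqP; rewrite mulrn_eq0 /= => /eqP.
Qed.

Section RectSymmetrizer.
Variables (N r s : nat) (row : 'I_N -> 'I_r) (col : 'I_N -> 'I_s).
Local Notation rstab := (fstab row).
Local Notation cstab := (fstab col).

Definition rect_cells : Prop :=
  (forall k l, row k = row l -> col k = col l -> k = l) /\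
  (forall i j, exists k, (row k == i) && (col k == j)).

(** The order is reversed because permutations compose from left to right and operators from right
    to left. *)
Definition perm_rep (M : pzRingType) (rho : 'S_N -> M) : Prop :=
  rho 1%g = 1 /\ forall a b, rho (a * b)%g = rho b * rho a.

Section Ring.
Variables (M : pzRingType) (rho : 'S_N -> M).

Definition rsym : M := \sum_(a in rstab) rho a.
Definition calt : M := \sum_(b in cstab) (-1) ^+ odd_perm b * rho b.

Hypothesis rhoP : perm_rep rho.
Let rhoM a b : rho (a * b)%g = rho b * rho a. Proof. by case: rhoP. Qed.

Lemma rsym_mulr a : a \in rstab -> rsym * rho a = rsym.
Proof.
move=> ha; rewrite /rsym [RHS](reindex_inj (mulgI a)) mulr_suml.
by apply: eq_big => [b|b _]; rewrite ?fstabM // rhoM.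
Qed.

Lemma rsym_mull a : a \in rstab -> rho a * rsym = rsym.
Proof.
move=> ha; rewrite /rsym [RHS](reindex_inj (mulIg a)) mulr_sumr.
by apply: eq_big => [b|b _]; rewrite ?fstabMr // rhoM.
Qed.

Lemma calt_mull b : b \in cstab -> rho b * calt = (-1) ^+ odd_perm b * calt.
Proof.
move=> hb; rewrite /calt [in RHS](reindex_inj (mulIg b)) !mulr_sumr.
apply: eq_big => [c|c _]; rewrite ?fstabMr // rhoM odd_permM.
by rewrite [RHS]mulrA -signr_addb addbC -addbA addbb addbF mulrA commr_sign mulrA.
Qed.

Lemma calt_mulr b : b \in cstab -> calt * rho b = (-1) ^+ odd_perm b * calt.
Proof.
move=> hb; rewrite /calt [in RHS](reindex_inj (mulgI b)) mulr_sumr mulr_suml.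
apply: eq_big => [c|c _]; rewrite ?fstabM // rhoM odd_permM.
by rewrite [RHS]mulrA -signr_addb addbA addbb addFb mulrA.
Qed.
End Ring.

Hypothesis rc : rect_cells.

Definition cell (i : 'I_r) (j : 'I_s) : 'I_N := xchoose (rc.2 i j).
Lemma row_cell i j : row (cell i j) = i. Proof. by case/andP: (xchooseP (rc.2 i j)) => /eqP. Qed.
Lemma col_cell i j : col (cell i j) = j. Proof. by case/andP: (xchooseP (rc.2 i j)) => _ /eqP. Qed.

Lemma row_col_stab1 a : a \in rstab -> a \in cstab -> a = 1%g.
Proof.
move=> /fstabP hr /fstabP hc; apply/permP => k; rewrite perm1.
exact: rc.1 (hr k) (hc k).
Qed.

(** Candidate for the column part of [x]: if [x] is a column permutation followed by a row
    permutation, the former must send [k] to the cell in the column of [k] and the row of [x k]. *)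
Definition straighten (x : 'S_N) (k : 'I_N) : 'I_N := cell (row (x k)) (col k).

Definition lam (x : 'S_N) : int :=
  if injectiveP (straighten x) is ReflectT h then (-1) ^+ odd_perm (perm h) else 0.

(** Von Neumann's lemma. If [straighten x] is injective, [x] splits into a column and a row
    permutation, absorbed by [calt] and [rsym]. Otherwise two cells of one column go to one row;
    their transposition is absorbed with sign [-1] on one side and [1] on the other, so the product
    equals its opposite. *)
Lemma rsym_calt_mid (M : pzRingType) (rho : 'S_N -> M) x : perm_rep rho ->
  (forall m : M, m *+ 2 = 0 -> m = 0) ->
  rsym rho * rho x * calt rho = (rsym rho * calt rho) *~ lam x.
Proof.
move=> rhoP tor; have rhoM := rhoP.2; rewrite /lam.
case: injectiveP => h.
  set c := perm h.
  have hc : c \in cstab by apply/fstabP => k; rewrite permE col_cell.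
  have ha : (c^-1 * x)%g \in rstab.
    apply/fstabP => k; rewrite -{2}(permKV c k) permM.
    by rewrite [in RHS]permE row_cell.
  rewrite -{1}(mulKVg c x) rhoM mulrA rsym_mulr // -mulrA calt_mull //.
  by case: (odd_perm c); rewrite ?expr0 ?expr1 ?mul1r ?mulN1r ?mulrN ?mulrNz ?mulr1z.
rewrite mulr0z; apply: tor.
have [w [w' [nw er ec]]] : exists w w', [/\ w != w', row (x w) = row (x w') & col w = col w'].
  have /injectivePn[w [w' nw e]] : ~~ injectiveb (straighten x) by apply/injectiveP.
  exists w, w'; split=> //; first by rewrite -(row_cell (row (x w)) (col w)) -/(straighten x w) e row_cell.
  by rewrite -(col_cell (row (x w)) (col w)) -/(straighten x w) e col_cell.
have tx : (tperm w w' * x = x * tperm (x w) (x w'))%g.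
  by rewrite -tpermJ conjgE !mulgA mulgV mul1g.
have h1 : rsym rho * rho x * calt rho = - (rsym rho * rho x * calt rho).
  rewrite -{1}(@rsym_mulr M rho rhoP (tperm (x w) (x w'))) ?tperm_fstab //.
  rewrite -mulrA -mulrA (mulrA (rho _)) -rhoM -tx rhoM -mulrA calt_mull ?tperm_fstab //.
  by rewrite odd_tperm nw mulN1r !mulrN mulrA.
by rewrite mulr2n {1}h1 addNr.
Qed.

(** Expanding the two middle factors in the square of the symmetrizer gives this integer, which
    depends on the rectangle and not on the representation. *)
Definition kappa : int :=
  \sum_(b in cstab) \sum_(a in rstab) (-1) ^+ odd_perm b * lam (a * b)%g.

Lemma rsym_calt_sqr (M : pzRingType) (rho : 'S_N -> M) : perm_rep rho ->
  (forall m : M, m *+ 2 = 0 -> m = 0) ->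
  (rsym rho * calt rho) * (rsym rho * calt rho) = (rsym rho * calt rho) *~ kappa.
Proof.
move=> rhoP tor.
have BA : calt rho * rsym rho =
    \sum_(b in cstab) \sum_(a in rstab) (-1) ^+ odd_perm b * rho (a * b)%g.
  rewrite /calt mulr_suml; apply: eq_bigr => b _.
  by rewrite /rsym mulr_sumr; apply: eq_bigr => a _; rewrite rhoP.2 mulrA.
have mid x := rsym_calt_mid x rhoP tor.
move: (rsym rho) (calt rho) BA mid => A B BA mid.
rewrite -mulrA (mulrA B) BA mulr_suml mulr_sumr /kappa mulrz_sumr.
apply: eq_bigr => b _; rewrite mulr_suml mulr_sumr mulrz_sumr.
apply: eq_bigr => a _; rewrite !mulrA commr_sign -mulrA -mulrA (mulrA A) mid.
by case: (odd_perm b); rewrite ?expr0 ?expr1 ?mul1r ?mulN1r ?mulrN ?mulrNz.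
Qed.

Definition reg (t : 'S_N) : 'M[rat]_(#|'S_N|) := \matrix_(i, j) (enum_val i == enum_val j * t)%g%:R.

Lemma regE (t : 'S_N) x y : reg t (enum_rank x) (enum_rank y) = (x == y * t)%g%:R.
Proof. by rewrite mxE !enum_rankK. Qed.

Lemma regP : perm_rep reg.
Proof.
split=> [|a b]; apply/matrixP => i j; rewrite -(enum_valK i) -(enum_valK j) regE.
  by rewrite mulg1 mxE (inj_eq enum_rank_inj).
rewrite mxE (bigD1 (enum_rank (enum_val j * a)%g)) //= !regE eqxx mulr1.
rewrite mulgA big1 ?addr0 // => k; rewrite -(enum_valK k) (inj_eq enum_rank_inj) => nk.
by rewrite !regE (negbTE nk) mulr0.
Qed.

(** Only the identity has nonzero trace in the regular representation, and a row permutation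
    composed with a column permutation is the identity only when both are. *)
Lemma trace_reg : \tr (rsym reg * calt reg) = (#|'S_N|)%:R.
Proof.
rewrite /rsym mulr_suml raddf_sum /= (bigD1 1%g) /=; last first.
  by apply/fstabP => k; rewrite perm1.
rewrite {1}regP.1 mul1r /calt raddf_sum /= (bigD1 1%g) /=; last first.
  by apply/fstabP => k; rewrite perm1.
rewrite odd_perm1 mul1r regP.1 mxtrace1 big1 ?addr0.
  rewrite big1 ?addr0 // => a /andP[ha na].
  rewrite mulr_sumr raddf_sum /= big1 // => b hb.
  rewrite mulrA commr_sign -mulrA -regP.2; set S := reg _.
  suff -> : \tr ((-1) ^+ b * S) = 0 by [].
  have trS : \tr S = 0.
    rewrite /mxtrace big1 // => i _; rewrite -(enum_valK i) regE -{1}(mulg1 (enum_val i)).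
    rewrite (inj_eq (mulgI _)) eq_sym; case: eqP => // e; case/negP: na.
    apply/eqP; apply: row_col_stab1 ha _; rewrite -fstabV.
    by rewrite -[a^-1%g]mul1g -e -mulgA mulgV mulg1.
  by case: (odd_perm b); rewrite ?expr0 ?expr1 ?mul1r ?mulN1r ?raddfN /= trS ?oppr0.
move=> b /andP[hb nb].
have trS : \tr (reg b) = 0.
  rewrite /mxtrace big1 // => i _; rewrite -(enum_valK i) regE -{1}(mulg1 (enum_val i)).
  by rewrite (inj_eq (mulgI _)) eq_sym (negbTE nb).
by case: (odd_perm b); rewrite ?expr0 ?expr1 ?mul1r ?mulN1r ?raddfN /= trS ?oppr0.
Qed.

(** In a rank factorization [m = c r], the left factor is injective and the right one surjective:
    [m *m m = 0] forces [r c = 0], and [r c] has the trace of [m]. *)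
Lemma mxtrace_sqr0 (F : fieldType) n (m : 'M[F]_n) : m *m m = 0 -> \tr m = 0.
Proof.
move=> m2; rewrite -[in \tr m](mulmx_base m) mxtrace_mulC.
suff -> : row_base m *m col_base m = 0 by rewrite raddf0.
have /row_freeP[X hX] := row_base_free m.
have /row_fullP[Y hY] := col_base_full m.
have : Y *m (m *m m) *m X = 0 by rewrite m2 mulmx0 mul0mx.
move: (mulmx_base m) X hX Y hY; move: (row_base m) (col_base m).
move: (\rank m) => k rb cb <- X hX Y hY.
by rewrite !mulmxA hY mul1mx -mulmxA hX mulmx1.
Qed.

(* Otherwise the symmetrizer would be nilpotent in the regular representation, where its
   trace is [N!]. *)
Lemma kappa_neq0 : kappa != 0.
Proof.
apply/eqP => k0; have := rsym_calt_sqr regP (@mulmx2_eq0 rat _).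
rewrite k0 mulr0z => /mxtrace_sqr0; rewrite trace_reg => /eqP.
by rewrite pnatr_eq0 => /eqP /card0_eq/(_ 1%g); rewrite inE.
Qed.

End RectSymmetrizer.

Lemma rect_cells_swap N r s (row : 'I_N -> 'I_r) (col : 'I_N -> 'I_s) :
  rect_cells row col -> rect_cells col row.
Proof.
case=> h1 h2; split=> [k l hr hc|i j]; first exact: h1.
by have [k] := h2 j i; rewrite andbC; exists k.
Qed.

(* [s |-> (-1)^s (rho s^-1)] is a representation in the opposite ring; it exchanges
   the two Young symmetrizers of the rectangle. *)
Lemma kappa_swap N r s (row : 'I_N -> 'I_r) (col : 'I_N -> 'I_s)
    (rc : rect_cells row col) : kappa (rect_cells_swap rc) = kappa rc.
Proof.
pose M := 'M[rat]_(#|'S_N|); have regP' := @regP N.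
pose rho (t : 'S_N) : M := (-1) ^+ odd_perm t * reg (t^-1)%g.
have rhoM a b : rho (a * b)%g = rho a * rho b.
  rewrite /rho odd_permM invMg regP'.2 signr_addb -!mulrA; congr (_ * _).
  by rewrite [RHS]mulrA commr_sign mulrA.
have rhoP : @perm_rep N (M^c : pzRingType) rho.
  by split=> [|a b]; rewrite ?rhoM // /rho odd_perm1 expr0 mul1r invg1 regP'.1.
have A : @rsym _ _ row (M^c : pzRingType) rho = calt row (@reg N).
  rewrite /rsym /calt [RHS](reindex_inj invg_inj).
  by apply: eq_big => a; rewrite ?fstabV ?odd_permV.
have B : @calt _ _ col (M^c : pzRingType) rho = rsym col (@reg N).
  rewrite /rsym /calt [RHS](reindex_inj invg_inj).
  apply: eq_big => a; first by rewrite fstabV.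
  move=> _; transitivity (@GRing.mul M (rho a) ((-1) ^+ odd_perm a)); last first.
    by rewrite /rho -commr_sign -mulrA -signr_addb addbb mulr1.
  by case: (odd_perm a).
have tor : forall m : M^c, m *+ 2 = 0 -> m = 0 by apply: mulmx2_eq0.
have := rsym_calt_sqr rc rhoP tor.
have := rsym_calt_sqr (rect_cells_swap rc) regP' (@mulmx2_eq0 rat _).
rewrite A B; set A' := rsym _ _; set B' := calt _ _ => e1.
(* The product of the opposite ring is unfolded: this equation and [e1] concern the same
   symmetrizer, whose trace [N!] is not zero. *)
change (A' * B' * (A' * B') = (A' * B') *~ kappa rc -> kappa (rect_cells_swap rc) = kappa rc).
rewrite e1 => /(congr1 mxtrace).
rewrite !raddfMz /= /A' /B' (trace_reg (rect_cells_swap rc)).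
rewrite -(mulrzr _ (kappa (rect_cells_swap rc))) -(mulrzr _ (kappa rc)).
move/mulfI; rewrite pnatr_eq0 -lt0n => inj.
suff /inj/eqP : (0 < #|'S_N|)%N by rewrite eqr_int => /eqP.
by apply/card_gt0P; exists 1%g.
Qed.

(** * Traces of diagonal matrices on symmetry classes of words *)

(** When all moved factors are odd the sign is the usual one: induction on the number of moved
    points, splitting off a transposition of two odd positions by the cocycle identity. *)
Lemma odd_sinv_on N (u : 'S_N) (pi : 'I_N -> bool) :
  (forall x, ~~ pi x -> u x = x) -> odd (sinv u pi) = odd_perm u.
Proof.
have [n] := ubnP #|[pred x | u x != x]|; elim: n u => // n IH u le_n hu.
have [->|[x ux]] : u = 1%g \/ exists x, u x != x.
- have [/existsP[x hx]|/existsPn h] := boolP [exists x, u x != x]; first by right; exists x.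
  by left; apply/permP => x; rewrite perm1; apply/eqP; rewrite -[_ == _]negbK h.
- by rewrite sinv1 odd_perm1.
have pix : pi x by apply: contraR ux => /hu->.
have piu y : pi (u y) = pi y.
  case hy: (pi y); last by rewrite hu hy.
  by apply: contraT => nu; have /perm_inj e := hu _ nu; rewrite e hy in nu.
set t := tperm x (u x); pose v := (u * t)%g.
have ue : u = (v * t)%g by rewrite /v -mulgA tperm2 mulg1.
have piv : pi =1 pi \o v.
  by move=> y /=; rewrite permM -(piu y) /t; case: tpermP => [->|->|_ _]; rewrite ?piu.
rewrite (eq_sinv u piv) {1}ue odd_sinvM odd_sinv_tperm ?piu //; last by rewrite eq_sym.
rewrite -(eq_sinv v piv) IH; first by rewrite /v odd_permM odd_tperm eq_sym ux pix -addbA addbb addbF.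
- rewrite -ltnS; apply: leq_ltn_trans le_n; apply/proper_card/properP; split.
    apply/subsetP => y; rewrite !inE /v permM; apply: contra => /eqP uy; rewrite uy.
    rewrite /t; case: tpermP => [yx|yu|//]; first by rewrite -yx uy yx eqxx in ux.
    by rewrite eq_sym (perm_inj (etrans uy yu)).
  by exists x; rewrite !inE /v ?permM ?tpermR ?eqxx.
move=> y hy; rewrite /v permM hu // tpermD //; first by apply: contraNneq hy => <-.
by apply: contraNneq hy => <-; rewrite piu.
Qed.

(** Restricted to the odd positions, [s] has the parity of their number minus the number of its
    cycles there, which is how [odd_perm] is defined. So each odd cycle carries one sign [-1]. *)
Lemma odd_sinv_porbits N (s : 'S_N) (pi : 'I_N -> bool) :
  (forall x, pi (s x) = pi x) ->
  odd (sinv s pi) (+) odd #|[set x | pi x]| =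
  odd #|[set O in porbits s | O \subset [set x | pi x]]|.
Proof.
move=> pis; pose f x := if pi x then s x else x.
have fI : injective f.
  move=> x y; rewrite /f; case: ifP => px; case: ifP => py //; first exact: perm_inj.
    by move=> e; rewrite -e pis px in py.
  by move=> e; rewrite e pis py in px.
pose u := perm fI.
have -> : odd (sinv s pi) = odd (sinv u pi).
  rewrite !odd_sinv; apply: eq_bigr => -[x y] _ /=; rewrite !permE /f.
  by case: (pi x); case: (pi y).
rewrite odd_sinv_on; last by move=> x px; rewrite permE /f (negbTE px).
set S := [set x | pi x]; set k := #|_|.
have inP x y : pi x -> (y \in porbit u x) = (y \in porbit s x).
  have e n : pi x -> (u ^+ n)%g x = (s ^+ n)%g x /\ pi ((s ^+ n)%g x).
    move=> px; elim: n => [|n [e1 e2]]; first by rewrite !expg0 !perm1.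
    by rewrite !expgSr !permM e1 permE /f e2 pis.
  by move=> px; apply/porbitP/porbitP => -[i ->]; exists i; case: (e i px).
have inN x : ~~ pi x -> porbit u x = [set x].
  move=> px; apply/setP => y; rewrite inE; apply/porbitP/eqP => [[i ->]|->].
    by elim: i => [|i]; rewrite ?expg0 ?perm1 // expgSr permM => ->; rewrite permE /f (negbTE px).
  by exists 0%N; rewrite perm1.
have porS x : pi x -> porbit s x \subset S.
  move=> px; apply/subsetP => y /porbitP[i ->]; rewrite inE.
  by elim: i => [|i]; rewrite ?expg0 ?perm1 // expgSr permM pis.
(* The cycles of [u] are the odd cycles of [s] and one singleton for each even position. *)
have E : porbits u = [set O in porbits s | O \subset S] :|: (set1 @: (~: S)).
  apply/setP => O; apply/imsetP/setUP => [[x _ ->]|[|]].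
  - have [px|px] := boolP (pi x); last by right; rewrite inN // imset_f // !inE.
    left; rewrite inE (_ : porbit u x = porbit s x) ?porS //; first by rewrite imset_f.
    by apply/setP => y; rewrite inP.
  - rewrite inE => /andP[/imsetP[x _ ->] /subsetP sub]; exists x => //.
    have px : pi x by have := sub x (porbit_id _ _); rewrite inE.
    by apply/setP => y; rewrite inP.
  case/imsetP=> x; rewrite !inE => px ->; by exists x; rewrite ?inN.
rewrite /odd_perm E cardsU (_ : _ :&: _ = set0); last first.
  apply/setP => O; rewrite !inE; apply/negbTE/negP => /andP[/andP[_ /subsetP sub]].
  by case/imsetP => x; rewrite !inE => /negP px e; apply: px; have := sub x; rewrite e !inE eqxx; apply.
rewrite cards0 subn0 (card_imset _ (@set1_inj _)) oddD.
rewrite -(cardsC S) oddD -/k; do 3!case: (odd _) => //.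
Qed.

Section Words.
Variables (p q N : nat).
Local Notation word := (tidx p q N).

Definition wpar (T : word) (r : 'I_N) : bool := vpar (T r).

Definition wperm (T : word) (s : 'S_N) : word := [ffun r => T (s r)].

Lemma wpermM T s t : wperm (wperm T s) t = wperm T (t * s)%g.
Proof. by apply/ffunP => r; rewrite !ffunE permM. Qed.

Lemma wperm1 T : wperm T 1%g = T.
Proof. by apply/ffunP => r; rewrite !ffunE perm1. Qed.

Lemma wpar_wperm T s : wpar (wperm T s) =1 wpar T \o s.
Proof. by move=> r; rewrite /wpar ffunE. Qed.

Lemma tparE (T : word) : tpar T = odd #|[set r | wpar T r]|.
Proof.
rewrite -sum1_card big_mkcond (big_morph odd oddD (erefl _)) /=.
by apply: eq_bigr => r _; rewrite inE /wpar; case: (vpar _).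
Qed.

Lemma tpar_wperm T s : tpar (wperm T s) = tpar T.
Proof.
by rewrite /tpar [RHS](reindex_inj (@perm_inj _ s)); apply: eq_bigr => r _; rewrite ffunE.
Qed.

Variable K : comNzRingType.

Definition wt (z : 'I_(p + q) -> K) (T : word) : K := \prod_r z (T r).

Definition psum (z : 'I_(p + q) -> K) (m : nat) : K :=
  \sum_i (-1) ^+ vpar i * z i ^+ m.

(** A fixed word is a choice of one letter per cycle, so the sum factors over the cycles;
    supertraces of permutations thus become products of supersymmetric power sums. *)
Lemma sum_fixed_words (s : 'S_N) (z : 'I_(p + q) -> K) :
  \sum_(T | wperm T s == T) (-1) ^+ (tpar T + sinv s (wpar T)) * wt z T =
  \prod_(O in porbits s) psum z #|O|.
Proof.
have fixP T : wperm T s == T -> forall x y, y \in porbit s x -> T y = T x.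
  move=> /eqP e x y /porbitP[i ->]; elim: i => [|i IH]; first by rewrite perm1.
  by rewrite expgSr permM -IH -[in RHS]e ffunE.
have tI : trivIset (porbits s).
  apply/trivIsetP => _ _ /imsetP[x _ ->] /imsetP[y _ ->]; apply: contraNT.
  case/pred0Pn => w /andP[]; rewrite /= -!eq_porbit_mem => /eqP <- /eqP->.
  by [].
have cov : cover (porbits s) = [set: 'I_N].
  apply/setP => x; rewrite inE; apply/bigcupP; exists (porbit s x); last exact: porbit_id.
  by apply: imset_f.
pose PT := {O | O \in porbits s}.
have porin x : porbit s x \in porbits s by apply: imset_f.
pose po x : PT := Sub (porbit s x) (porin x).
have repP (o : PT) : exists x, x \in val o.
  by case: o => O /= /imsetP[x _ ->]; exists x; apply: porbit_id.
pose rep o := xchoose (repP o).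
have repE o : po (rep o) = o.
  apply/val_inj; rewrite /=; have := xchooseP (repP o); rewrite -/(rep o).
  by have /imsetP[x _ /= ->] := valP o; rewrite -eq_porbit_mem => /eqP.
have poE x y : y \in porbit s x -> po y = po x.
  by rewrite -eq_porbit_mem => /eqP e; apply/val_inj.
rewrite [RHS]big_sub /psum bigA_distr_bigA /=.
rewrite (reindex_onto (fun f : {ffun PT -> 'I_(p + q)} => [ffun r => f (po r)] : word)
   (fun T => [ffun o => T (rep o)])) /=; last first.
  move=> T hT; apply/ffunP => r; rewrite !ffunE.
  by apply: fixP hT _ _ _; rewrite -[porbit s r]/(val (po r)) (xchooseP (repP _)).
apply: eq_big => [f|f /andP[hT _]].
  apply/andP; split; apply/eqP/ffunP => r; rewrite !ffunE ?repE //.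
  by rewrite (poE r (s r)) //; have := mem_porbit s 1 r; rewrite expg1.
move: hT; set T : word := [ffun _ => _] => hT.
have Tin (o : PT) x : x \in val o -> T x = f o.
  by move=> hx; rewrite ffunE -(repE o) (poE (rep o) x) //
    -[porbit s (rep o)]/(val (po (rep o))) repE.
have sgn : odd (tpar T + sinv s (wpar T)) = odd (\sum_(o : PT) vpar (f o)).
  rewrite oddD oddb tparE addbC odd_sinv_porbits; last first.
    by move=> x; have /eqP/ffunP/(_ x) := hT; rewrite /wpar ffunE => ->.
  rewrite -sum1_card (eq_bigl (fun O => (O \in porbits s) && (O \subset [set x | wpar T x]))).
    rewrite big_mkcondr big_sub /=; congr (odd _); apply: eq_bigr => o _.
    have -> : (val o \subset [set x | wpar T x]) = vpar (f o); last by case: (vpar _).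
    have ho : rep o \in val o by exact: xchooseP.
    apply/subsetP/idP => [/(_ _ ho)|h x hx]; rewrite inE /wpar ?(Tin o) //.
  by move=> O; rewrite inE.
rewrite -signr_odd sgn signr_odd big_split /= prodrXr; congr (_ * _).
rewrite /wt (eq_bigl (fun r => r \in cover (porbits s))); last by move=> r; rewrite cov inE.
rewrite big_trivIset //= big_sub; apply: eq_bigr => o _.
by rewrite -prodr_const; apply: eq_bigr => r hr; rewrite (Tin o).
Qed.
End Words.

Definition mel (R : Type) (X : finType) (M : 'M[R]_(#|X|)) (x y : X) : R :=
  M (enum_rank x) (enum_rank y).

Lemma melM (R : pzRingType) (X : finType) (M M' : 'M[R]_(#|X|)) x y :
  mel (M * M') x y = \sum_z mel M x z * mel M' z y.
Proof.
rewrite /mel mxE (reindex (@enum_rank X)) //=.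
by exists enum_val => ? _; rewrite ?enum_rankK ?enum_valK.
Qed.

Lemma mel_sum (R : pzRingType) (X : finType) I (r : seq I) (P : pred I) (f : I -> 'M[R]_(#|X|)) x y :
  mel (\sum_(i <- r | P i) f i) x y = \sum_(i <- r | P i) mel (f i) x y.
Proof. by rewrite /mel summxE. Qed.

Lemma mel_sign (R : pzRingType) (X : finType) (M : 'M[R]_(#|X|)) (b : bool) x y :
  mel ((-1) ^+ b * M) x y = (-1) ^+ b * mel M x y.
Proof. by case: b; rewrite ?expr0 ?expr1 ?mul1r ?mulN1r // /mel mxE. Qed.

Lemma melMz (R : pzRingType) (X : finType) (M : 'M[R]_(#|X|)) (k : int) x y :
  mel (M *~ k) x y = mel M x y *~ k.
Proof. by case: k => k; rewrite /mel /intmul ?mxE mulmxnE. Qed.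

Lemma melP (R : Type) (X : finType) (M M' : 'M[R]_(#|X|)) :
  (forall x y, mel M x y = mel M' x y) -> M = M'.
Proof.
by move=> e; apply/matrixP => i j; rewrite -(enum_valK i) -(enum_valK j); apply: e.
Qed.

Section WordRep.
Variables (p q N : nat) (K : comNzRingType).
Local Notation word := (tidx p q N).

(** The matrix of [perm_op s] on words. Its entries are scalars, so the version over the base field
    also acts on tensors with coefficients in [G]. *)
Definition wrep (s : 'S_N) : 'M[K]_(#|word|) := \matrix_(i, j)
  ((-1) ^+ sinv s (wpar (enum_val j)) *+ (enum_val j == wperm (enum_val i) s)).

Lemma wrepE s I J : mel (wrep s) I J = (-1) ^+ sinv s (wpar J) *+ (J == wperm I s).
Proof. by rewrite /mel mxE !enum_rankK. Qed.

Lemma wrepP : perm_rep wrep.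
Proof.
split=> [|a b]; apply: melP => I J.
  rewrite wrepE sinv1 wperm1 expr0 /mel mxE (inj_eq enum_rank_inj) eq_sym.
  by [].
rewrite melM (bigD1 (wperm I b)) //= big1 ?addr0 => [|L nL]; last first.
  by rewrite (wrepE b) (negbTE nL) mul0r.
rewrite !wrepE eqxx mulr1n wpermM; case: eqP => [->|_]; rewrite ?mulr0n ?mulr0 // !mulr1n.
rewrite -exprD -signr_odd -[in RHS]signr_odd oddD addbC -wpermM.
by rewrite !(eq_sinv _ (wpar_wperm _ a)) odd_sinvM.
Qed.

Definition strw (z : 'I_(p + q) -> K) (M : 'M[K]_(#|word|)) : K :=
  \sum_T (-1) ^+ tpar T * wt z T * mel M T T.

Definition pcyc (z : 'I_(p + q) -> K) (s : 'S_N) : K := \prod_(O in porbits s) psum z #|O|.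

Lemma strw_wrep z s : strw z (wrep s) = pcyc z s.
Proof.
rewrite /pcyc -sum_fixed_words [RHS]big_mkcond /=; apply: eq_bigr => T _.
rewrite wrepE eq_sym; case: eqP => _; rewrite ?mulr0n ?mulr0 //.
by rewrite mulr1n exprD mulrAC.
Qed.

Lemma strw_sum z I (r : seq I) (P : pred I) (f : I -> 'M[K]_(#|word|)) :
  strw z (\sum_(i <- r | P i) f i) = \sum_(i <- r | P i) strw z (f i).
Proof.
rewrite /strw exchange_big; apply: eq_bigr => T _ /=.
by rewrite mel_sum mulr_sumr.
Qed.

Lemma strw_sign z (M : 'M[K]_(#|word|)) (b : bool) :
  strw z ((-1) ^+ b * M) = (-1) ^+ b * strw z M.
Proof. by rewrite /strw mulr_sumr; apply: eq_bigr => T _; rewrite mel_sign mulrCA. Qed.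

Lemma mel_mul_tperm (M : 'M[K]_(#|word|)) I (T : word) u v : u != v -> T u = T v ->
  mel (M * wrep (tperm u v)) I T = (-1) ^+ vpar (T u) * mel M I T.
Proof.
move=> nuv e; have fixT : wperm T (tperm u v) = T.
  by apply/ffunP => r; rewrite ffunE; case: tpermP => // ->.
rewrite melM (bigD1 T) //= big1 ?addr0 => [|L nL].
  by rewrite wrepE fixT eqxx mulr1n -signr_odd odd_sinv_tperm /wpar ?e // mulrC.
rewrite wrepE (_ : (T == _) = false) ?mulr0n ?mulr0 //; apply/negbTE.
by apply: contraNneq nL => eT; rewrite -{1}fixT eT wpermM tperm2 wperm1.
Qed.

Lemma mel_tperm_mul (M : 'M[K]_(#|word|)) J (T : word) u v : u != v -> T u = T v ->
  mel (wrep (tperm u v) * M) T J = (-1) ^+ vpar (T u) * mel M T J.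
Proof.
move=> nuv e; have fixT : wperm T (tperm u v) = T.
  by apply/ffunP => r; rewrite ffunE; case: tpermP => // ->.
rewrite melM (bigD1 T) //= big1 ?addr0 => [|L nL].
  by rewrite wrepE fixT eqxx mulr1n -signr_odd odd_sinv_tperm /wpar ?e.
by rewrite wrepE fixT (negbTE nL) mul0r.
Qed.

Section Rect.
Variables (r s : nat) (row : 'I_N -> 'I_r) (col : 'I_N -> 'I_s).

Definition ysym : 'M[K]_(#|word|) := rsym row wrep * calt col wrep.

(** By [strw_ysym], the supertrace of the diagonal matrix [z] composed with the Young symmetrizer:
    [kappa] times a supersymmetric Schur function, expanded in power sums. *)
Definition fD z := \sum_(a in fstab row) \sum_(b in fstab col)
  (-1) ^+ odd_perm b * pcyc z (b * a)%g.

Lemma strw_ysym z : strw z ysym = fD z.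
Proof.
rewrite /ysym {1}/rsym mulr_suml strw_sum; apply: eq_bigr => a _.
rewrite /calt mulr_sumr strw_sum; apply: eq_bigr => b _.
by rewrite mulrA commr_sign -mulrA -wrepP.2 strw_sign strw_wrep.
Qed.

Hypothesis tor : forall x : K, x *+ 2 = 0 -> x = 0.

Lemma mel_calt0 I (T : word) u v : u != v -> col u = col v -> T u = T v -> ~~ vpar (T u) ->
  mel (calt col wrep) I T = 0.
Proof.
move=> nuv ec eT nT; have := mel_mul_tperm (calt col wrep) I nuv eT.
rewrite (calt_mulr wrepP) ?tperm_fstab // odd_tperm nuv (negbTE nT) mul1r mel_sign.
by rewrite mulN1r => h; apply: tor; rewrite mulr2n -{1}h addNr.
Qed.

Lemma mel_rsym0 J (T : word) u v : u != v -> row u = row v -> T u = T v -> vpar (T u) ->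
  mel (rsym row wrep) T J = 0.
Proof.
move=> nuv ec eT nT; have := mel_tperm_mul (rsym row wrep) J nuv eT.
rewrite (rsym_mull wrepP) ?tperm_fstab // nT mulN1r.
by move=> h; apply: tor; rewrite mulr2n {1}h addNr.
Qed.

(** An even letter repeated in a column is killed by the alternating sum, an odd letter repeated in
    a row by the symmetric sum: these are the rules for tableaux with letters of two parities. *)
Lemma mel_ysym_neq0 (T : word) : mel ysym T T != 0 ->
  (forall u v, col u = col v -> T u = T v -> ~~ vpar (T u) -> u = v) /\
  (forall u v, row u = row v -> T u = T v -> vpar (T u) -> u = v).
Proof.
move=> h; split=> u v e eT hT; apply/eqP/contraT => nuv; case/eqP: h; rewrite /ysym melM.
  by rewrite big1 // => J _; rewrite (mel_calt0 J nuv) ?mulr0.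
by rewrite big1 // => J _; rewrite (mel_rsym0 J nuv) ?mul0r.
Qed.

End Rect.
End WordRep.

(** * Rectangle traces as polynomials in the scale of the even letters *)

Lemma rect_cells_card N r s (row : 'I_N -> 'I_r) (col : 'I_N -> 'I_s) :
  rect_cells row col -> N = (r * s)%N.
Proof.
case=> inj surj; suff : #|'I_N| = #|{: 'I_r * 'I_s}| by rewrite card_prod !card_ord.
apply: (bij_eq_card (f := fun k => (row k, col k))).
exists (fun ij => if [pick k | (row k == ij.1) && (col k == ij.2)] is Some k then k
   else xchoose (surj ij.1 ij.2)) => [k|[i j]] /=.
  case: pickP => [l /andP[/eqP e1 /eqP e2]|/(_ k)]; first exact: inj.
  by rewrite !eqxx.
case: pickP => [l /andP[/eqP -> /eqP ->]//|h].
by have [k] := surj i j; rewrite h.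
Qed.

Lemma roots_eq0 (F : fieldType) (P : {poly F}) (X : finType) (f : X -> F) (A : {set X}) :
  {in A &, injective f} -> (forall x, x \in A -> P.[f x] = 0) -> (size P <= #|A|)%N -> P = 0.
Proof.
move=> inj hr hs; apply: (@roots_geq_poly_eq0 _ P [seq f x | x <- enum A]).
- by apply/allP => _ /mapP[x hx ->]; apply/rootP/hr; rewrite mem_enum in hx.
- by rewrite map_inj_in_uniq ?enum_uniq // => x y; rewrite !mem_enum; apply: inj.
by rewrite size_map -cardE.
Qed.

Section Diagonal.
Variables (F : numFieldType) (p q : nat).
Implicit Types z : 'I_(p + q) -> F.

Definition esupp z : {set 'I_(p + q)} := [set i | ~~ vpar i && (z i != 0)].
Definition osupp z : {set 'I_(p + q)} := [set i | vpar i && (z i != 0)].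

Definition escale z (t : F) i := if vpar i then z i else t * z i.

Definition kill z i j k := if (k == i) || (k == j) then 0 else z k.

(** Division-free form of the distinctness of the ratios [z j / z i], which will be counted as roots
    of a polynomial. *)
Definition generic z := forall i i' j j', i \in esupp z -> i' \in esupp z ->
  j \in osupp z -> j' \in osupp z -> z j * z i' = z j' * z i -> i = i' /\ j = j'.

Definition evn N (T : tidx p q N) : nat := #|[set k | ~~ vpar (T k)]|.

Lemma tor2 (x : F) : x *+ 2 = 0 -> x = 0.
Proof. by move/eqP; rewrite mulrn_eq0 /= => /eqP. Qed.

Lemma wt_escale N z t (T : tidx p q N) : wt (escale z t) T = t ^+ evn T * wt z T.
Proof.
rewrite /wt /evn -prodr_const [X in X * _]big_mkcond -big_split; apply: eq_bigr => k _ /=.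
by rewrite inE /escale; case: vpar; rewrite ?mul1r.
Qed.

Lemma psum_kill z i j m : ~~ vpar i -> vpar j -> z i = z j -> (0 < m)%N ->
  psum (kill z i j) m = psum z m.
Proof.
move=> ni pj e m0; rewrite /psum.
have nij : j != i by apply: contraNneq ni => <-.
rewrite (bigD1 i) // [in RHS](bigD1 i) //= (bigD1 j) // [in RHS](bigD1 j) //=.
rewrite /kill !eqxx /= orbT (negbTE ni) pj e expr0n (gtn_eqF m0) !mulr0 !add0r.
rewrite expr0 expr1 mul1r mulN1r addrA subrr add0r.
by apply: eq_bigr => k /andP[/negbTE-> /negbTE->].
Qed.

Lemma eq_fD N r s (row : 'I_N -> 'I_r) (col : 'I_N -> 'I_s) z z' :
  z =1 z' -> fD row col z = fD row col z'.
Proof.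
move=> e; apply: eq_bigr => a _; apply: eq_bigr => b _; congr (_ * _).
by apply: eq_bigr => O _; apply: eq_bigr => i _; rewrite e.
Qed.

Lemma fD_kill N r s (row : 'I_N -> 'I_r) (col : 'I_N -> 'I_s) z i j :
  ~~ vpar i -> vpar j -> z i = z j -> fD row col (kill z i j) = fD row col z.
Proof.
move=> ni pj e; apply: eq_bigr => a _; apply: eq_bigr => b _; congr (_ * _).
apply: eq_bigr => _ /imsetP[x _ ->]; apply: psum_kill => //.
by rewrite lt0n card_porbit_neq0.
Qed.

Section Rect.
Variables (N r s : nat) (row : 'I_N -> 'I_r) (col : 'I_N -> 'I_s).
Hypothesis rc : rect_cells row col.
Local Notation word := (tidx p q N).
Local Notation Y := (@ysym p q N F r s row col).

(** By the tableau rules, an even letter and a column, or an odd letter and a row, determine at most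
    one cell. *)
Lemma evn_le z (T : word) : mel Y T T != 0 -> wt z T != 0 ->
  (evn T <= #|esupp z| * s)%N /\ (N - evn T <= #|osupp z| * r)%N.
Proof.
move=> hY hT; have [hc hr] := mel_ysym_neq0 tor2 hY.
have nz k : z (T k) != 0 by have /prodf_neq0/(_ k isT) := hT.
have cs : (N - evn T = #|[set k | vpar (T k)]|)%N.
  have := cardsC [set k | vpar (T k)]; rewrite card_ord /evn => {1}<-.
  have -> : ~: [set k | vpar (T k)] = [set k | ~~ vpar (T k)] by apply/setP => k; rewrite !inE.
  by rewrite addnK.
split; rewrite ?cs.
  rewrite /evn -(card_ord s) -cardsT -cardsX.
  rewrite -(@card_in_imset _ _ (fun k => (T k, col k))).
    apply/subset_leq_card/subsetP => x /imsetP[k]; rewrite !inE => hk ->.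
    by rewrite /= hk nz.
  by move=> u v; rewrite !inE => hu hv [e1 e2]; apply: hc.
rewrite -(card_ord r) -cardsT -cardsX.
rewrite -(@card_in_imset _ _ (fun k => (T k, row k))).
  apply/subset_leq_card/subsetP => x /imsetP[k]; rewrite !inE => hk ->.
  by rewrite /= hk nz.
by move=> u v; rewrite !inE => hu hv [e1 e2]; apply: hr.
Qed.

Definition wcoef z (T : word) : F := (-1) ^+ tpar T * wt z T * mel Y T T.

(** The trace as a polynomial in the scale [t] of the even letters, divided by [t ^+ m]. Truncated
    subtraction is harmless: terms with [evn T < m] vanish as soon as [m + #|osupp z| * r <= N]. *)
Definition epoly z m : {poly F} := \sum_T wcoef z T *: 'X^(evn T - m).

Lemma epolyE z m t : (m + #|osupp z| * r <= N)%N ->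
  t ^+ m * (epoly z m).[t] = fD row col (escale z t).
Proof.
move=> hm; rewrite -strw_ysym /strw /epoly horner_sum mulr_sumr.
apply: eq_bigr => T _; rewrite hornerZ hornerXn wt_escale /wcoef.
have [->|hT] := eqVneq (wt z T) 0; first by rewrite !(mulr0, mul0r).
have [->|hY] := eqVneq (mel Y T T) 0; first by rewrite !(mulr0, mul0r).
have [_ le2] := evn_le hY hT.
have {2}<- : (m + (evn T - m) = evn T)%N by rewrite subnKC //; lia.
rewrite exprD; move: (_ ^+ (tpar T)) (t ^+ m) (t ^+ _) (wt z T) (mel Y T T) => x1 x2 x3 x4 x5.
by ring.
Qed.

Lemma size_epoly z m : (m + #|osupp z| * r <= N)%N ->
  (size (epoly z m) <= (#|esupp z| * s).+1 - m)%N.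
Proof.
move=> hm.
apply: leq_trans (size_sum _ _ _) _; apply/bigmax_leqP => T _.
have [c0|] := eqVneq (wcoef z T) 0; first by rewrite c0 scale0r size_poly0.
rewrite !mulf_eq0 !negb_or -andbA => /and3P[_ hT hY]; have [le1 le2] := evn_le hY hT.
apply: leq_trans (size_scale_leq _ _) _; rewrite size_polyXn.
move: #|osupp z| #|esupp z| (evn T) hm le1 le2 => o e v hm le1 le2; lia.
Qed.

Lemma escale_esupp z t : t != 0 -> esupp (escale z t) = esupp z.
Proof.
move=> t0; apply/setP => i; rewrite !inE /escale; case: vpar => //=.
by rewrite mulf_eq0 negb_or t0.
Qed.

Lemma escale_osupp z t : osupp (escale z t) = osupp z.
Proof. by apply/setP => i; rewrite !inE /escale; case: vpar. Qed.

Lemma generic_escale z t : t != 0 -> generic z -> generic (escale z t).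
Proof.
move=> t0 gz i i' j j'; rewrite !escale_esupp // !escale_osupp => hi hi' hj hj'.
move: (hi) (hi') (hj) (hj'); rewrite !inE /escale.
case/andP=> /negbTE-> _ /andP[/negbTE-> _] /andP[-> _] /andP[-> _] e.
by apply: gz => //; apply: (mulfI t0); rewrite mulrCA e mulrCA.
Qed.

Lemma kill_esupp z i j : vpar j -> esupp (kill z i j) = esupp z :\ i.
Proof.
move=> pj; apply/setP => k; rewrite !inE /kill; case: (k =P i) => [->|_] /=.
  by rewrite eqxx andbF.
by case: (k =P j) => [->|//]; rewrite pj.
Qed.

Lemma kill_osupp z i j : ~~ vpar i -> osupp (kill z i j) = osupp z :\ j.
Proof.
move=> pj; apply/setP => k; rewrite !inE /kill orbC; case: (k =P j) => [->|_] /=.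
  by rewrite eqxx andbF.
by case: (k =P i) => [->|//]; rewrite (negbTE pj).
Qed.

Lemma generic_kill z i j : ~~ vpar i -> vpar j -> generic z -> generic (kill z i j).
Proof.
move=> ni pj gz a a' b b'; rewrite kill_esupp // kill_osupp // !inE.
case/andP=> nai ha /andP[na'i ha'] /andP[nbj hb] /andP[nb'j hb'].
have pick (k : 'I_(p + q)) : ~~ vpar k -> k != i -> kill z i j k = z k.
  by move=> pk; rewrite /kill => /negbTE->; case: eqP => // e; rewrite e pj in pk.
have pick' (k : 'I_(p + q)) : vpar k -> k != j -> kill z i j k = z k.
  by move=> pk; rewrite /kill orbC => /negbTE->; case: eqP => // e; rewrite e (negbTE ni) in pk.
case/andP: (ha) => pa _; case/andP: (ha') => pa' _.
case/andP: (hb) => pb _; case/andP: (hb') => pb' _.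
by rewrite (pick a) // (pick a') // (pick' b) // (pick' b') // => e; apply: gz; rewrite ?inE.
Qed.

(** At this scale the even letter [i] equals the odd letter [j]; they cancel in all power sums,
    which leaves one nonzero letter fewer of each parity. *)
Lemma fD_ratio_eq0 z i j : generic z ->
    (forall z', generic z' -> (#|esupp z'| < #|esupp z|)%N ->
       (#|osupp z'| < #|osupp z|)%N -> fD row col z' = 0) ->
    i \in esupp z -> j \in osupp z -> fD row col (escale z (z j / z i)) = 0.
Proof.
move=> gz IH hi hj; move: (hi) (hj); rewrite !inE => /andP[pi zi] /andP[pj zj].
have t0 : z j / z i != 0 by rewrite mulf_neq0 ?invr_eq0.
rewrite -(@fD_kill _ _ _ _ _ _ i j) //; last first.
  by rewrite /escale pj (negbTE pi) divfK.
apply: IH; first by apply: generic_kill => //; apply: generic_escale.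
  by rewrite kill_esupp // escale_esupp // [X in (_ < X)%N](cardsD1 i) hi.
by rewrite kill_osupp // escale_osupp // [X in (_ < X)%N](cardsD1 j) hj.
Qed.

Definition ratio z (ij : 'I_(p + q) * 'I_(p + q)) : F := z ij.2 / z ij.1.

Lemma ratio_inj z : generic z -> {in setX (esupp z) (osupp z) &, injective (ratio z)}.
Proof.
move=> gz [i j] [i' j']; rewrite !in_setX /= => /andP[hi hj] /andP[hi' hj'].
rewrite /ratio /= => /eqP; rewrite eqr_div; last first.
- by move: hi'; rewrite inE => /andP[].
- by move: hi; rewrite inE => /andP[].
by move=> /eqP e; case: (gz _ _ _ _ hi hi' hj hj' e) => -> ->.
Qed.

(* Induction on the number of nonzero letters: as a polynomial in the scaling of the even
   letters, the left-hand side has more roots than its degree allows. *)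
Lemma fD_hook_eq0 z : generic z -> (#|esupp z| < r)%N -> (#|osupp z| < s)%N ->
  fD row col z = 0.
Proof.
have [n] := ubnP #|esupp z|; elim: n z => // n IH z le_n gz he ho.
have hN := rect_cells_card rc.
(* [m] is [N] minus the largest possible number of odd letters. After division by [t ^+ m] the
   degree is below the number of ratios because [(r - #|esupp z|) * (s - #|osupp z|)] is
   positive. *)
pose m := (r * (s - #|osupp z|))%N.
have hm : (m + #|osupp z| * r <= N)%N by rewrite /m hN; nia.
have P0 : epoly z m = 0.
  apply: (roots_eq0 (ratio_inj gz)); last first.
    rewrite cardsX; apply: leq_trans (size_epoly hm) _; rewrite /m.
    move: #|esupp z| #|osupp z| he ho => e o he ho.
    have [d ->] : exists d, s = (o + d.+1)%N by exists (s - o).-1; lia.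
    have [c ->] : exists c, r = (e + c.+1)%N by exists (r - e).-1; lia.
    rewrite addKn; nia.
  case=> i j; rewrite in_setX => /andP[hi hj].
  have t0 : ratio z (i, j) != 0.
    move: hi hj; rewrite /ratio /= !inE => /andP[_ zi] /andP[_ zj].
    by rewrite mulf_neq0 ?invr_eq0.
  apply: (mulfI (expf_neq0 m t0)); rewrite mulr0 epolyE //.
  apply: fD_ratio_eq0 => // z' gz' h1 h2; apply: IH => //; lia.
have := epolyE 1 hm; rewrite P0 horner0 mulr0 => ->; apply: eq_fD => i.
by rewrite /escale mul1r; case: vpar.
Qed.

End Rect.
End Diagonal.

Lemma vpar_lshift p q (i : 'I_p) : vpar (lshift q i) = false.
Proof. by rewrite /vpar /= leqNgt ltn_ord. Qed.

Lemma vpar_rshift p q (j : 'I_q) : vpar (rshift p j) = true.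
Proof. by rewrite /vpar /= leq_addr. Qed.

(** * Rectangles filled with odd letters only *)

Section OddRectangle.
Variables (F : numFieldType) (p q N r : nat) (row : 'I_N -> 'I_r) (col : 'I_N -> 'I_q).
Hypothesis rc : rect_cells row col.
Local Notation word := (tidx p q N).
Local Notation rho := (@wrep p q N F).
Local Notation A := (rsym row (@wrep p q N F)).
Local Notation B := (calt col (@wrep p q N F)).

(** Every cell carries the odd letter of its column; the orbit of this word under row permutations
    is all that contributes when the even letters vanish. *)
Let T0 : word := [ffun k => rshift p (col k)].

Let wpar_T0 a : wpar (wperm T0 a) =1 xpredT.
Proof. by move=> k; rewrite /wpar !ffunE vpar_rshift. Qed.

Let sgn_sinv a (T : word) : wpar T =1 xpredT -> (-1) ^+ sinv a (wpar T) = (-1) ^+ odd_perm a :> F.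
Proof. by move=> h; rewrite -signr_odd odd_sinv_on // => x; rewrite h. Qed.

Let wpar_T01 : wpar T0 =1 xpredT.
Proof. by move=> k; rewrite -[T0]wperm1 wpar_T0. Qed.

Lemma mel_wrep_mul (M : 'M[F]_(#|word|)) a I J :
  mel (rho a * M) I J = (-1) ^+ sinv a (wpar (wperm I a)) * mel M (wperm I a) J.
Proof.
rewrite melM (bigD1 (wperm I a)) //= big1 ?addr0 ?wrepE ?eqxx ?mulr1n // => L nL.
by rewrite wrepE (negbTE nL) mul0r.
Qed.

Lemma mel_mul_wrep (M : 'M[F]_(#|word|)) a I J :
  mel (M * rho a) I J = mel M I (wperm J a^-1) * (-1) ^+ sinv a (wpar J).
Proof.
rewrite melM (bigD1 (wperm J a^-1)) //= big1 ?addr0 => [|L nL].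
  by rewrite wrepE wpermM mulgV wperm1 eqxx.
rewrite wrepE (_ : (J == _) = false) ?mulr0 //; apply/negbTE.
by apply: contraNneq nL => ->; rewrite wpermM mulVg wperm1.
Qed.

Let mel_A_T0 : mel A T0 T0 = 1.
Proof.
rewrite mel_sum (bigD1 1%g) /=; last by apply/fstabP => k; rewrite perm1.
rewrite wrepE wperm1 eqxx sinv1 big1 ?addr0 // => a /andP[ha na].
rewrite wrepE; case: eqP => // e; case/negP: na; apply/eqP/(row_col_stab1 rc) => //.
apply/fstabP => k; have /ffunP/(_ k) := e; rewrite !ffunE.
by move/rshift_inj.
Qed.

Let mel_B_T0 (M : 'M[F]_(#|word|)) I : mel (M * B) I T0 = (#|fstab col|)%:R * mel M I T0.
Proof.
rewrite mulr_sumr mel_sum -sumr_const mulr_suml; apply: eq_bigr => b hb.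
rewrite mulrA commr_sign -mulrA mel_sign mel_mul_wrep sgn_sinv //.
rewrite mulrCA mul1r -signr_addb addbb mulr1; congr (mel _ _ _).
apply/ffunP => k; rewrite !ffunE; congr rshift.
by move: hb; rewrite -fstabV => /fstabP ->.
Qed.

(** The symmetrizer [A * B] has square [kappa] times itself; compare the entries at [T0]. A last
    factor [B] only multiplies them by the order of the column stabilizer, which can be
    cancelled. *)
Let mel_ABA_T0 : mel (A * B * A) T0 T0 = (kappa rc)%:~R.
Proof.
have := rsym_calt_sqr rc (@wrepP p q N F) (@mulmx2_eq0 _ _); rewrite mulrA.
move/(congr1 (fun M => mel M T0 T0)); rewrite melMz !mel_B_T0 mel_A_T0 mulr1.
have C0 : #|fstab col|%:R != 0 :> F.
  rewrite pnatr_eq0 -lt0n; apply/card_gt0P; exists 1%g.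
  by apply/fstabP => k; rewrite perm1.
by rewrite -mulrzr => /(mulfI C0).
Qed.

Lemma card_col j : #|[pred k | col k == j]| = r.
Proof.
rewrite -[RHS]card_ord -(card_in_image (f := row) (A := [pred k | col k == j])).
  apply: eq_card => i; rewrite !inE; apply/imageP; exists (cell rc i j).
    by rewrite inE col_cell.
  by rewrite row_cell.
by move=> k l; rewrite !inE => /eqP e1 /eqP e2 e; apply: rc.1; rewrite // e1.
Qed.

Lemma fD_odd_rect (z : 'I_(p + q) -> F) : (forall i, z (lshift q i) = 0) ->
  fD row col z = (-1) ^+ N * (kappa rc)%:~R * \prod_j z (rshift p j) ^+ r.
Proof.
move=> z0; rewrite -strw_ysym /strw.
pose P (T : word) := [exists a in fstab row, T == wperm T0 a].
rewrite (bigID P) /= [X in _ + X]big1 ?addr0 => [|T]; last first.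
  apply: contraNeq; rewrite mulf_eq0 !negb_or mulf_eq0 negb_or => /andP[/andP[_ hT] hY].
  have [_ hr] := mel_ysym_neq0 (@tor2 F) hY.
  have nz k : z (T k) != 0 by have /prodf_neq0/(_ k isT) := hT.
  have [f hf] : exists f : 'I_N -> 'I_q, forall k, T k = rshift p (f k).
    apply: (@fin_all_exists _ (fun=> 'I_q) (fun k j => T k = rshift p j)) => k; case: (splitP (T k)) => j e.
      by case/eqP: (nz k); rewrite (_ : T k = lshift q j) ?z0 //; apply/val_inj.
    by exists j; apply/val_inj.
  (* A row has [q] cells carrying distinct odd letters, so it contains each of the [q] odd letters
     once: the word is [T0] after a row permutation. *)
  have aI : injective (fun k => cell rc (row k) (f k)).
    move=> k l e; have er : row k = row l by rewrite -(row_cell rc (row k) (f k)) e row_cell.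
    have ef : f k = f l by rewrite -(col_cell rc (row k) (f k)) e col_cell.
    by apply: hr; rewrite // !hf ?ef // vpar_rshift.
  apply/existsP; exists (perm aI); apply/andP; split.
    by apply/fstabP => k; rewrite permE row_cell.
  by apply/eqP/ffunP => k; rewrite !ffunE permE col_cell hf.
have wtT0 a : wt z (wperm T0 a) = \prod_j z (rshift p j) ^+ r.
  rewrite /wt (eq_bigr (fun k => z (T0 (a k)))) => [|k _]; last by rewrite ffunE.
  transitivity (\prod_k z (T0 k)); first by rewrite [RHS](reindex_inj (@perm_inj _ a)).
  rewrite (partition_big col xpredT) //=; apply: eq_bigr => j _.
  rewrite -(card_col j) -prodr_const.
  by apply: eq_big => [k|k /eqP <-]; rewrite ?inE ?ffunE.
have tparT0 a : (-1) ^+ tpar (wperm T0 a) = (-1) ^+ N :> F.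
  rewrite tparE (_ : [set _ | _] = setT) ?cardsT ?card_ord ?signr_odd //.
  by apply/setP => k; rewrite !inE wpar_T0.
have T0I : {in fstab row &, injective (wperm T0)}.
  move=> a b /fstabP ha /fstabP hb e; apply/permP => k; apply: rc.1; rewrite ?ha ?hb //.
  by have /ffunP/(_ k) := e; rewrite !ffunE => /rshift_inj.
transitivity (\sum_(a in fstab row) (-1) ^+ N * (\prod_j z (rshift p j) ^+ r) *
   mel (A * B) (wperm T0 a) (wperm T0 a)).
  rewrite (eq_bigl (fun T => T \in [set wperm T0 a | a in fstab row])); last first.
    move=> T; apply/existsP/imsetP => [[a /andP[ha /eqP->]]|[a ha ->]]; first by exists a.
    by exists a; rewrite ha eqxx.
  by rewrite big_imset //=; apply: eq_bigr => a _; rewrite tparT0 wtT0.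
rewrite -mulr_sumr [RHS]mulrAC; congr (_ * _).
(* Summing the diagonal entries of [A * B] over the orbit of [T0] rebuilds a right factor [A]. *)
have E : A * B * A = \sum_(a in fstab row) A * B * rho a by rewrite -mulr_sumr.
rewrite -mel_ABA_T0 E mel_sum [RHS](reindex_inj invg_inj).
apply: eq_big => [a|a ha]; first by rewrite fstabV.
rewrite mel_mul_wrep (sgn_sinv a^-1%g wpar_T01) odd_permV invgK.
have {2}<- : rho a * A = A by rewrite (rsym_mull (wrepP _ _ _ _)).
rewrite -(mulrA (rho a)) mel_wrep_mul (sgn_sinv a (wpar_T0 a)) mulrC.
by rewrite mulrA -signr_addb addbb mul1r.
Qed.
End OddRectangle.

(** * Exchange of the two kinds of letters, and values at the two rectangles *)

Definition zxy (K : Type) p q (x : 'I_p -> K) (y : 'I_q -> K) (k : 'I_(p + q)) : K :=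
  match split k with inl i => x i | inr j => y j end.

Lemma zxyl (K : Type) p q (x : 'I_p -> K) (y : 'I_q -> K) i : zxy x y (lshift q i) = x i.
Proof. by rewrite /zxy (unsplitK (inl i)). Qed.

Lemma zxyr (K : Type) p q (x : 'I_p -> K) (y : 'I_q -> K) j : zxy x y (rshift p j) = y j.
Proof. by rewrite /zxy (unsplitK (inr j)). Qed.

Lemma psum_zxy (K : comNzRingType) p q (x : 'I_p -> K) (y : 'I_q -> K) m :
  psum (zxy x y) m = \sum_i x i ^+ m - \sum_j y j ^+ m.
Proof.
rewrite /psum big_split_ord /= -sumrN; congr (_ + _); apply: eq_bigr => i _.
  by rewrite vpar_lshift zxyl mul1r.
by rewrite vpar_rshift zxyr mulN1r.
Qed.

Lemma pcyc_opp (K : comNzRingType) p q p' q' N (z : 'I_(p + q) -> K) (z' : 'I_(p' + q') -> K)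
    (s : 'S_N) : (forall m, psum z' m = - psum z m) ->
  pcyc z' s = (-1) ^+ N * (-1) ^+ odd_perm s * pcyc z s.
Proof.
move=> h; rewrite /pcyc (eq_bigr (fun O : {set 'I_N} => -1 * psum z #|O|)) => [|O _]; last first.
  by rewrite h mulN1r.
rewrite big_split prodr_const /= /odd_perm card_ord signr_addb !signr_odd mulrA -expr2.
by rewrite sqrr_sign mul1r.
Qed.

(** Negating the power sums gives one sign per cycle, that is, the sign of the permutation up to
    [(-1) ^+ N]; it turns symmetrization into alternation and so transposes the diagram. *)
Lemma fD_swap (K : comNzRingType) p q p' q' N r s (row : 'I_N -> 'I_r) (col : 'I_N -> 'I_s)
    (z : 'I_(p + q) -> K) (z' : 'I_(p' + q') -> K) : (forall m, psum z' m = - psum z m) ->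
  fD col row z' = (-1) ^+ N * fD row col z.
Proof.
move=> h; rewrite /fD [in RHS]exchange_big /= [in RHS](reindex_inj invg_inj) /= mulr_sumr.
apply: eq_big => [b|b _]; first by rewrite fstabV.
rewrite [in RHS](reindex_inj invg_inj) /= mulr_sumr.
apply: eq_big => [a|a _]; first by rewrite fstabV.
rewrite (pcyc_opp _ h) -invMg /pcyc porbitsV odd_permV odd_permM signr_addb.
move: (\prod_(_ in _) _) ((-1) ^+ N) ((-1) ^+ odd_perm b) => P u v.
by case: (odd_perm a); rewrite ?expr0 ?expr1; ring.
Qed.

Section Evaluation.
Variables (F : numFieldType) (p q : nat) (x : 'I_p -> F) (y : 'I_q -> F).
Hypotheses (x0 : forall i, x i != 0) (y0 : forall j, y j != 0).
Hypothesis xy : forall i i' j j', y j * x i' = y j' * x i -> i = i' /\ j = j'.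

Lemma generic_zxy : generic (zxy x y).
Proof.
move=> a a' b b'; rewrite !inE.
case/andP=> ha _ /andP[ha' _] /andP[hb _] /andP[hb' _].
case: (split_ordP a) ha => i ->; rewrite ?vpar_rshift // => _.
case: (split_ordP a') ha' => i' ->; rewrite ?vpar_rshift // => _.
case: (split_ordP b) hb => j ->; rewrite ?vpar_lshift // => _.
case: (split_ordP b') hb' => j' ->; rewrite ?vpar_lshift // => _.
by rewrite !zxyl !zxyr => /xy[-> ->].
Qed.

Lemma esupp_zxy : esupp (zxy x y) = [set lshift q i | i in 'I_p].
Proof.
apply/setP => a; rewrite !inE; case: (split_ordP a) => i ->.
  by rewrite vpar_lshift zxyl x0 imset_f.
by rewrite vpar_rshift; apply/esym/negbTE/imsetP => -[j _ /eqP]; rewrite eq_rlshift.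
Qed.

Lemma osupp_zxy : osupp (zxy x y) = [set rshift p j | j in 'I_q].
Proof.
apply/setP => a; rewrite !inE; case: (split_ordP a) => i ->.
  by rewrite vpar_lshift; apply/esym/negbTE/imsetP => -[j _ /eqP]; rewrite eq_lrshift.
by rewrite vpar_rshift zxyr y0 imset_f.
Qed.

Variables (N : nat) (row : 'I_N -> 'I_p.+1) (col : 'I_N -> 'I_q).
Hypothesis rc : rect_cells row col.

(** As a polynomial in the scale of [x], the left side has degree at most [p * q] and [p * q] known
    roots: removing some [x i] and [y j] leaves too few letters for [p.+1] rows and [q] columns. Its
    constant term is the value of the odd rectangle. *)
Lemma fD_high_rect : fD row col (zxy x y) =
  (-1) ^+ N * (kappa rc)%:~R * \prod_j (y j * \prod_i (y j - x i)).
Proof.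
set z := zxy x y; have gz := generic_zxy; rewrite -/z in gz.
have ce : #|esupp z| = p by rewrite esupp_zxy card_imset ?card_ord //; apply: lshift_inj.
have co : #|osupp z| = q by rewrite osupp_zxy card_imset ?card_ord //; apply: rshift_inj.
have hN := rect_cells_card rc.
have hm : (0 + #|osupp z| * p.+1 <= N)%N by rewrite co hN; lia.
pose P := epoly row col z 0.
pose Q : {poly F} := \prod_(ij : 'I_p * 'I_q) (1 - (x ij.1 / y ij.2) *: 'X).
have sQ : (size Q <= (p * q).+1)%N.
  rewrite /Q; apply: leq_trans (size_poly_prod_leq _ _) _.
  set k := #|_|; have kE : k = (p * q)%N.
    by rewrite -[p in RHS]card_ord -[q in RHS]card_ord -card_prod; apply: eq_card.
  apply: (@leq_trans ((2 * k).+1 - k)); last by rewrite kE; lia.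
  apply: leq_sub2r; rewrite ltnS /k -sum1_card big_distrr; apply: leq_sum => ij _.
  rewrite (leq_trans (size_polyD _ _)) // geq_max size_poly1 size_polyN /=.
  by rewrite (leq_trans (size_scale_leq _ _)) // size_polyX.
have PE t : P.[t] = fD row col (escale z t) by rewrite -(epolyE row col t hm) expr0 mul1r.
have root_ratio i j : P.[y j / x i] = 0.
  have -> : y j / x i = z (rshift p j) / z (lshift q i) by rewrite /z zxyl zxyr.
  rewrite PE; apply: (fD_ratio_eq0 gz).
  - move=> z' gz'; rewrite ce co => h1 h2.
    by apply: (fD_hook_eq0 rc gz') => //; apply: ltnW.
  - by rewrite esupp_zxy imset_f.
  by rewrite osupp_zxy imset_f.
have Q0 : Q.[0] = 1.
  rewrite /Q horner_prod big1 // => ij _.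
  by rewrite hornerD hornerN hornerZ hornerX mulr0 subr0 hornerC.
have E : P = P.[0] *: Q.
  apply/eqP; rewrite -subr_eq0; apply/eqP; set D := P - _.
  (* [None] adds the point [0] to the ratios: the two polynomials agree at [p * q + 1] points. *)
  pose f (o : option ('I_p * 'I_q)) := if o is Some ij then y ij.2 / x ij.1 else 0.
  apply: (@roots_eq0 _ D _ f setT).
  - have nz ij : f (Some ij) != 0 by rewrite mulf_neq0 ?invr_eq0.
    move=> [[i j]|] [[i' j']|] _ _ // e; last first.
    - by have := nz (i', j'); rewrite -e eqxx.
    - by have := nz (i, j); rewrite e eqxx.
    by move/eqP: e; rewrite /f /= eqr_div // => /eqP /xy[-> ->].
  - move=> [[i j]|] _; rewrite /f /D hornerD hornerN hornerZ; last by rewrite Q0 mulr1 subrr.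
    rewrite root_ratio /Q horner_prod (bigD1 (i, j)) //= hornerD hornerN hornerZ hornerX hornerC.
    by rewrite mulf_div [y j * x i]mulrC divff ?mulf_neq0 // subrr mul0r mulr0 subrr.
  rewrite cardsT card_option card_prod !card_ord.
  rewrite (leq_trans (size_polyD _ _)) // geq_max size_polyN.
  rewrite (leq_trans (size_scale_leq _ _)) // andbT.
  by apply: leq_trans (size_epoly row col hm) _; rewrite ce subn0.
have -> : fD row col z = P.[1].
  by rewrite PE; apply: eq_fD => i; rewrite /escale mul1r; case: vpar.
rewrite E hornerZ PE (fD_odd_rect rc) => [|i]; last first.
  by rewrite /escale vpar_lshift mul0r.
rewrite -[LHS]mulrA; congr (_ * _).
rewrite /Q horner_prod -(pair_bigA _ (fun i j => (1 - (x i / y j) *: 'X).[1])) /=.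
rewrite exchange_big -big_split /=; apply: eq_bigr => j _.
rewrite /escale vpar_rshift /z zxyr exprS -mulrA; congr (_ * _).
rewrite -[X in _ ^+ X](card_ord p) -prodr_const -big_split /=; apply: eq_bigr => i _.
rewrite hornerD hornerN hornerZ hornerX hornerC mulr1 mulrBr mulr1 mulrC divfK //.
Qed.
End Evaluation.

Lemma fD_wide_rect (F : numFieldType) (p q : nat) (x : 'I_p -> F) (y : 'I_q -> F) :
  (forall i, x i != 0) -> (forall j, y j != 0) ->
  (forall i i' j j', y j * x i' = y j' * x i -> i = i' /\ j = j') ->
  forall (N : nat) (row : 'I_N -> 'I_p) (col : 'I_N -> 'I_q.+1) (rc : rect_cells row col),
  fD row col (zxy x y) = (kappa rc)%:~R * \prod_i (x i * \prod_j (x i - y j)).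
Proof.
move=> x0 y0 xy N row col rc.
rewrite -[LHS]mul1r -[1](@sqrr_sign F N) expr2 -mulrA -(@fD_swap _ _ _ _ _ _ _ _ _ _ _ (zxy y x)).
  rewrite (fD_high_rect y0 x0 _ (rect_cells_swap rc)) ?kappa_swap //.
    by rewrite !mulrA -expr2 sqrr_sign mul1r.
  move=> j j' i i' e; have [] := xy i i' j j'; last by [].
  by rewrite mulrC -e mulrC.
by move=> m; rewrite !psum_zxy opprB.
Qed.

(** * Hankel determinants of elementary supersymmetric functions *)

Lemma sum_perm_fix_max (R : nmodType) k (f : 'S_k.+1 -> R) :
  \sum_(s : 'S_k.+1 | s ord_max == ord_max) f s = \sum_(s : 'S_k) f (lift_perm ord_max ord_max s).
Proof.
rewrite (reindex (lift_perm ord_max ord_max)) /=.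
  by apply: eq_bigl => s; rewrite lift_perm_id eqxx.
pose ulsf (s : 'S_k.+1) j := odflt j (unlift (s ord_max) (s (lift ord_max j))).
have ulsfK (s : 'S_k.+1) j: lift (s ord_max) (ulsf s j) = s (lift ord_max j).
  rewrite /ulsf; have := neq_lift ord_max j.
  by rewrite -(can_eq (permK s)) => /unlift_some[] ? ? ->.
have inj_ulsf s : injective (ulsf s).
  move=> a b e; apply: (@lift_inj _ ord_max); apply: (@perm_inj _ s).
  by rewrite -!ulsfK e.
exists (fun s => perm (@inj_ulsf s)) => [s _|s].
  by apply/permP=> j; rewrite permE /ulsf lift_perm_lift lift_perm_id liftK.
move/(s _ =P _) => si0; apply/permP=> j.
case: (unliftP ord_max j) => [j'|] ->; rewrite ?lift_perm_id //.
by rewrite lift_perm_lift permE -[X in lift X _]si0 ulsfK.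
Qed.

Lemma lift_max k (i : 'I_k) : lift ord_max i = widen_ord (leqnSn k) i.
Proof. by apply: val_inj; rewrite /= /bump leqNgt ltn_ord. Qed.

Lemma sinv_lift_max k (s : 'S_k) (pi : 'I_k.+1 -> bool) :
  sinv (lift_perm ord_max ord_max s) pi = sinv s (pi \o lift ord_max).
Proof.
rewrite /sinv big_ord_recr /= [X in (_ + X)%N]big_pred0 ?addn0 => [|j]; last first.
  by rewrite ltnNge -ltnS ltn_ord.
apply: eq_bigr => i _; rewrite big_mkcond big_ord_recr /= -lift_max lift_perm_id.
have nlt (x : 'I_k.+1) : (@ord_max k < x)%N = false by rewrite ltnNge leq_ord.
rewrite nlt andbF addn0.
rewrite [RHS]big_mkcond; apply: eq_bigr => j _.
have lv (x : 'I_k) : lift ord_max x = x :> nat by rewrite lift_max.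
by rewrite -lift_max !lift_perm_lift !lv.
Qed.

Section Insertion.
Variables (F : numFieldType) (p q : nat).
Implicit Types z : 'I_(p + q) -> F.

(** For a constant column map this is the antisymmetrizer, the case of a diagram with one column. *)
Definition walt k : 'M[F]_(#|tidx p q k|) := calt (fun=> ord0 : 'I_1) (@wrep p q k F).

Lemma mel_waltE k (T J : tidx p q k) : mel (walt k) T J =
  \sum_(s : 'S_k) (-1) ^+ odd_perm s * ((-1) ^+ sinv s (wpar J) *+ (J == wperm T s)).
Proof.
rewrite mel_sum; apply: eq_big => [s|s _]; first by apply/fstabP.
by rewrite mel_sign wrepE.
Qed.

(* [k!] times the trace of the diagonal matrix [z] on the [k]-th exterior power. *)
Definition zc z k : F := strw z (walt k).

Lemma zcE z k : zc z k = \sum_(s : 'S_k) (-1) ^+ odd_perm s * pcyc z s.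
Proof.
rewrite /zc /walt /calt strw_sum; apply: eq_big => [s|s _].
  by apply/fstabP.
by rewrite strw_sign strw_wrep.
Qed.

Definition setz z (i0 : 'I_(p + q)) (t : F) i := if i == i0 then t else z i.

Variables (z : 'I_(p + q) -> F) (i0 : 'I_(p + q)).
Hypothesis even_i0 : ~~ vpar i0.

Definition avoid k (T : tidx p q k) := [forall r, T r != i0].

Lemma zc_avoid k : zc (setz z i0 0) k =
  \sum_(T | avoid T) (-1) ^+ tpar T * wt z T * mel (walt k) T T.
Proof.
rewrite /zc /strw [RHS]big_mkcond; apply: eq_bigr => T _.
case: (boolP (avoid T)) => [/forallP h|/forallPn[r /negPn/eqP e]].
  congr (_ * _ * _); apply: eq_bigr => r _.
  by rewrite /setz (negbTE (h r)).
by rewrite /wt (bigD1 r) //= /setz e eqxx mul0r mulr0 mul0r.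
Qed.

(** Lets a distinguished letter be moved to the last place without changing diagonal entries: for
    [T = J] the sign is a square. *)
Lemma mel_walt_perm k a (T J : tidx p q k) : (a * a = 1)%g ->
  mel (walt k) (wperm T a) (wperm J a) *
    ((-1) ^+ sinv a (wpar T) * (-1) ^+ sinv a (wpar J)) = mel (walt k) T J.
Proof.
move=> a2; have va : a^-1%g = a by apply/eqP; rewrite eq_invg_mul a2.
have ca : a \in @fstab k 1 (fun=> ord0) by apply/fstabP.
have h1 U L : mel (walt k) (wperm U a) L * (-1) ^+ sinv a (wpar (wperm U a)) =
   (-1) ^+ odd_perm a * mel (walt k) U L.
  by rewrite mulrC -mel_wrep_mul (calt_mull (wrepP _ _ _ _)) // mel_sign.
have h2 U L : mel (walt k) U (wperm L a) * (-1) ^+ sinv a (wpar L) =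
   (-1) ^+ odd_perm a * mel (walt k) U L.
  by rewrite -{1}va -mel_mul_wrep (calt_mulr (wrepP _ _ _ _)) // mel_sign.
have e : (-1) ^+ sinv a (wpar T) = (-1) ^+ sinv a (wpar (wperm T a)) :> F.
  rewrite -signr_odd -[RHS]signr_odd; congr (_ ^+ nat_of_bool _).
  have := odd_sinvM a a (wpar T); rewrite a2 sinv1 (eq_sinv a (wpar_wperm T a)).
  by rewrite /=; case: (odd _); case: (odd _).
rewrite e [X in _ * X]mulrC mulrA h2 -mulrA h1 mulrA -signr_addb addbb mul1r //.
Qed.

(** The recurrence of elementary symmetric functions when an even letter is added: [i0] occurs at
    most once, and its [k.+1] possible places contribute equally. *)
Lemma zc_insert k : zc z k.+1 = zc (setz z i0 0) k.+1 + (k.+1)%:R * (z i0 * zc (setz z i0 0) k).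
Proof.
rewrite !zc_avoid.
pose W (T : tidx p q k.+1) := (-1) ^+ tpar T * wt z T * mel (walt k.+1) T T.
rewrite {1}/zc /strw (bigID (@avoid _)) /= -!/(W _); congr (_ + _).
pose only u (T : tidx p q k.+1) := [forall r, (T r == i0) == (r == u)].
have only_uniq u v T : only u T -> only v T -> u = v.
  by move=> /forallP/(_ u); rewrite eqxx => /eqP e /forallP/(_ u); rewrite e => /eqP/esym/eqP.
rewrite (eq_bigr W) // (bigID (fun T => [exists u, only u T])) /=.
rewrite [X in _ + X]big1 ?addr0 => [|T /andP[/forallPn[u /negPn/eqP eu] /existsPn nT]]; last first.
  have /forallPn[v nv] := nT u.
  have nuv : u != v.
    by apply: contraNneq nv => <-; rewrite eu !eqxx.
  have ev : T v = i0 by apply/eqP; move: nv; rewrite [v == u]eq_sym (negbTE nuv); case: (T v == i0).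
  rewrite /W (mel_calt0 (@tor2 F) T nuv) ?mulr0 ?eu ?ev //.
rewrite (eq_bigl (fun T => [exists u, only u T])) => [|T]; last first.
  apply: andb_idl => /existsP[u /forallP/(_ u)]; rewrite eqxx => /eqP e.
  by apply/forallPn; exists u; rewrite e.
transitivity (\sum_u \sum_(T | only u T) W T).
  rewrite (exchange_big_dep xpredT) //= [LHS]big_mkcond; apply: eq_bigr => T _ //=.
  case: (boolP [exists u, only u T]) => [/existsP[u hu]|/existsPn h].
    by rewrite (big_pred1 u) // => v; apply/idP/eqP => [hv|-> //]; apply: only_uniq hv hu.
  by rewrite big_pred0 // => u; apply/negbTE/h.
rewrite (eq_bigr (fun=> \sum_(T | only ord_max T) W T)) => [|u _]; last first.
  pose t := tperm u ord_max; rewrite (reindex (fun T => wperm T t)) /=; last first.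
    by exists (fun T => wperm T t) => T _; rewrite wpermM tperm2 wperm1.
  apply: eq_big => [T|T _].
    have e1 r : (t r == u) = (r == ord_max).
      by rewrite -[X in _ == X](tpermR u ord_max) (inj_eq perm_inj).
    have e2 r : (t r == ord_max) = (r == u).
      by rewrite -[X in _ == X](tpermL u ord_max) (inj_eq perm_inj).
    apply/forallP/forallP => h r; have := h (t r); last by rewrite ffunE e2.
    by rewrite ffunE /t tpermK -/t e1.
  rewrite /W tpar_wperm -(@mel_walt_perm k.+1 t T T) ?tperm2 // -expr2 sqrr_sign mulr1.
  congr (_ * _ * _); rewrite /wt [RHS](reindex_inj (@perm_inj _ t)).
  by apply: eq_bigr => r _; rewrite ffunE.
transitivity ((k.+1)%:R * \sum_(T | only ord_max T) W T).
  by rewrite sumr_const card_ord mulr_natl.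
congr (_ * _); rewrite mulr_sumr.
pose ext (T : tidx p q k) : tidx p q k.+1 :=
  [ffun r => if unlift ord_max r is Some r' then T r' else i0].
pose res (T : tidx p q k.+1) : tidx p q k := [ffun r => T (lift ord_max r)].
have extl T r : ext T (lift ord_max r) = T r by rewrite ffunE liftK.
have nl (r : 'I_k) : (lift ord_max r == ord_max) = false.
  by rewrite eq_sym (negbTE (neq_lift _ _)).
have extm T : ext T ord_max = i0 by rewrite ffunE unlift_none.
rewrite (reindex_onto ext res) /=; last first.
  move=> T /forallP h; apply/ffunP => r; case: (unliftP ord_max r) => [r' ->|->].
    by rewrite extl ffunE.
  by rewrite extm; have /eqP := h ord_max; rewrite eqxx => /eqP.
apply: eq_big => [T|T hT].
  rewrite (_ : res (ext T) = T) ?eqxx ?andbT; last by apply/ffunP => r; rewrite ffunE extl.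
  apply/forallP/forallP => [h r|h r].
    by have /eqP := h (lift ord_max r); rewrite extl nl => ->.
  case: (unliftP ord_max r) => [r' ->|->]; last by rewrite extm !eqxx.
  by rewrite extl nl (negbTE (h r')).
have Tav r : T r != i0.
  case/andP: hT => /forallP/(_ (lift ord_max r)).
  by rewrite extl nl => /eqP ->.
rewrite /W; have -> : tpar (ext T) = tpar T.
  rewrite /tpar big_ord_recr /= extm (negbTE even_i0) addbF.
  by apply: eq_bigr => r _; rewrite -lift_max extl.
have -> : wt z (ext T) = wt z T * z i0.
  by rewrite /wt big_ord_recr /= extm; congr (_ * _); apply: eq_bigr => r _; rewrite -lift_max extl.
suff -> : mel (walt k.+1) (ext T) (ext T) = mel (walt k) T T.
  by move: ((-1) ^+ _) (wt z T) (mel _ _ _) => u v w; ring.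
have wE : wpar (ext T) \o lift ord_max =1 wpar T by move=> r; rewrite /wpar /= extl.
rewrite !mel_waltE.
(* Since [i0] occurs in the last place only, a permutation moving that place cannot fix the word. *)
rewrite (bigID (fun s : 'S_k.+1 => s ord_max == ord_max)) /= [X in _ + X]big1 ?addr0 => [|s ns].
  rewrite sum_perm_fix_max; apply: eq_bigr => s _; rewrite odd_lift_perm addbb addFb sinv_lift_max (eq_sinv _ wE); congr (_ * (_ *+ nat_of_bool _)).
  apply/eqP/eqP => /ffunP e; apply/ffunP => r.
    by rewrite [RHS]ffunE -extl e ffunE lift_perm_lift extl.
  case: (unliftP ord_max r) => [r' ->|->]; first by rewrite [RHS]ffunE lift_perm_lift !extl e ffunE.
  by rewrite [RHS]ffunE lift_perm_id.
case: eqP => [e|_]; rewrite ?mulr0n ?mulr0 //.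
have /ffunP/(_ ord_max) := e; rewrite extm ffunE.
case: (unliftP ord_max (s ord_max)) ns => [r -> _|->]; last by rewrite eqxx.
by rewrite extl => eT; have /negP := Tav r; rewrite -eT eqxx.
Qed.
End Insertion.

Definition hk (K : comNzRingType) (c : int -> K) (a : int) (m : nat) : K :=
  \det (\matrix_(i < m, j < m) c (a + i%:Z + j%:Z)).

Lemma eq_hk (K : comNzRingType) (c c' : int -> K) a m : c =1 c' -> hk c a m = hk c' a m.
Proof. by move=> e; congr (\det _); apply/matrixP => i j; rewrite !mxE e. Qed.

(* The Hankel matrix of order [q + 1] maps the coefficients of the recurrence to [up]
   times the first basis vector. *)
Lemma hankel_ratio (K : comNzRingType) (c : int -> K) (w : nat -> K) (q : nat) (a : int) (up : K) :
  (forall i : 'I_q.+1, \sum_(j < q.+1) w j * c (a + i%:Z + j%:Z) = up *+ (i == 0 :> nat)) ->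
  w 0%N * hk c a q.+1 = up * hk c (a + 2) q.
Proof.
move=> h; rewrite /hk; set M := \matrix_(i, j) _.
pose W : 'cV[K]_q.+1 := \col_j w j.
have MW : M *m W = up *: delta_mx 0 0.
  apply/matrixP => i j; rewrite ord1 !mxE eqxx andbT mulr_natr -(h i).
  by apply: eq_bigr => l _; rewrite !mxE mulrC.
have : \adj M *m (M *m W) = \adj M *m (up *: delta_mx 0 0) by rewrite MW.
rewrite mulmxA mul_adj_mx mul_scalar_mx -scalemxAr => /matrixP/(_ 0 0).
rewrite !mxE mulrC => ->; congr (_ * _).
rewrite (bigD1 0) //= big1 ?addr0 => [|l nl]; last by rewrite !mxE (negbTE nl) mulr0.
rewrite !mxE !eqxx mulr1 /cofactor expr0 mul1r; congr (\det _).
by apply/matrixP => i j; rewrite !mxE /= !/bump /=; congr c; lia.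
Qed.

(* Shifting the Hankel matrix amounts to multiplying it by the companion matrix. *)
Lemma hankel_shift (K : comNzRingType) (c : int -> K) (w : {poly K}) (q : nat) (a : int) (x : K) :
  w \is monic -> size w = q.+1 ->
  (forall i : 'I_q, \sum_(j < q.+1) w`_j * c (a + i%:Z + j%:Z) = 0) ->
  hk (fun k => c k + x * c (k - 1)) (a + 1) q = (-1) ^+ q * w.[- x] * hk c a q.
Proof.
move=> mw sw; have -> : q = (size w).-1 by rewrite sw.
set n := (size w).-1 => h; have lw : w`_n = 1 by rewrite -[w`_n]/(lead_coef w) (monicP mw).
pose B := \matrix_(i < n, j < n) c (a + i%:Z + j%:Z).
have -> : hk (fun k => c k + x * c (k - 1)) (a + 1) n = \det (B *m ((companionmx w)^T + x%:M)).
  congr (\det _); rewrite mulmxDr mul_mx_scalar; apply/matrixP => i j.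
  rewrite [LHS]mxE [RHS]mxE [(x *: B) i j]mxE [B i j]mxE; congr (_ + x * c _); last by lia.
  rewrite mxE; case: (eqVneq (j : nat) n.-1) => ej.
    have := h i; rewrite big_ord_recr /= lw mul1r addrC => /eqP; rewrite addr_eq0 => /eqP.
    have -> : a + i%:Z + n%:Z = a + 1 + i%:Z + j%:Z by have := ltn_ord j; lia.
    move=> ->; rewrite -sumrN; apply: eq_bigr => l _.
    by rewrite !mxE ej eqxx mulrN mulrC.
  have jn : (j.+1 < n)%N by have := ltn_ord j; lia.
  rewrite (bigD1 (Ordinal jn)) //= big1 ?addr0 => [|l nl]; last first.
    by rewrite !mxE (negbTE ej) (_ : (j.+1 == l) = false) ?mulr0 //; apply/negbTE; rewrite eq_sym.
  by rewrite !mxE (negbTE ej) eqxx mulr1; congr c; rewrite /=; lia.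
rewrite det_mulmx mulrC; congr (_ * _).
rewrite -[in RHS](companionmxK mw) /char_poly -horner_evalE -det_map_mx -[LHS]det_tr.
rewrite -detZ; congr (\det _); apply/matrixP => i j.
rewrite !mxE [j == i]eq_sym; set e := if _ then _ else _.
case: (i == j); rewrite ?mulr1n ?mulr0n rmorphB /= /horner_eval ?hornerX ?horner0 hornerC.
  by rewrite mulN1r opprB opprK.
by rewrite mulN1r opprB subr0 addr0.
Qed.

Section Lists.
Variable F : numFieldType.
Implicit Types xs ys : seq F.

Definition lps xs ys (m : nat) : F := \sum_(x <- xs) x ^+ m - \sum_(y <- ys) y ^+ m.

(** The elementary supersymmetric function, written in power sums: the coefficient of degree [k] in
    the quotient of the product of the [1 + x z] by that of the [1 + y z]. *)
Definition csym xs ys (k : nat) : F := (k`!%:R)^-1 *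
  \sum_(s : 'S_k) (-1) ^+ odd_perm s * \prod_(O in porbits s) lps xs ys #|O|.

Lemma eq_csym xs ys xs' ys' k : (forall m, (0 < m)%N -> lps xs ys m = lps xs' ys' m) ->
  csym xs ys k = csym xs' ys' k.
Proof.
move=> h; congr (_ * _); apply: eq_bigr => s _; congr (_ * _).
by apply: eq_bigr => _ /imsetP[x _ ->]; apply: h; rewrite lt0n card_porbit_neq0.
Qed.

Lemma psum_nth xs ys m :
  psum (zxy (fun i : 'I_(size xs) => xs`_i) (fun j : 'I_(size ys) => ys`_j)) m = lps xs ys m.
Proof. by rewrite psum_zxy /lps; congr (_ - _); rewrite [RHS](big_nth 0) big_mkord. Qed.

Lemma csym_zc xs ys k p q (z : 'I_(p + q) -> F) :
  (forall m, (0 < m)%N -> psum z m = lps xs ys m) -> zc z k = k`!%:R * csym xs ys k.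
Proof.
move=> h; rewrite /csym mulVKf ?pnatr_eq0 -?lt0n ?fact_gt0 // zcE.
apply: eq_bigr => s _; congr (_ * _); rewrite /pcyc.
by apply: eq_bigr => _ /imsetP[x _ ->]; apply: h; rewrite lt0n card_porbit_neq0.
Qed.

Lemma csym_cons x xs ys k : csym (x :: xs) ys k.+1 = csym xs ys k.+1 + x * csym xs ys k.
Proof.
pose z := zxy (fun i : 'I_(size (x :: xs)) => (x :: xs)`_i) (fun j : 'I_(size ys) => ys`_j).
pose i0 := lshift (size ys) (@ord0 (size xs)).
have ni0 : ~~ vpar i0 by rewrite vpar_lshift.
have := zc_insert z ni0 k.
have h0 m : (0 < m)%N -> psum (setz z i0 0) m = lps xs ys m.
  move=> m0; have := psum_nth (x :: xs) ys m; rewrite -/z.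
  have t0 : (-1) ^+ vpar i0 * z i0 ^+ m = x ^+ m :> F.
    by rewrite /z zxyl (negbTE ni0) mul1r.
  rewrite /psum (bigD1 i0) // t0 /= => e.
  rewrite (bigD1 i0) //= {1}/setz eqxx expr0n gtn_eqF // mulr0 add0r.
  transitivity (\sum_(i | i != i0) (-1) ^+ vpar i * z i ^+ m).
    by apply: eq_bigr => i ni; rewrite /setz (negbTE ni).
  by apply: (addrI (x ^+ m)); rewrite e /lps big_cons addrA.
rewrite !(csym_zc _ h0) (csym_zc (xs := x :: xs) (ys := ys)) => [|m _]; last exact: psum_nth.
have -> : z i0 = x by rewrite /z zxyl.
rewrite [x * (_ * _)]mulrCA (mulrA (k.+1)%:R) -natrM -factS -mulrDr.
by apply: mulfI; rewrite pnatr_eq0 -lt0n fact_gt0.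
Qed.

Lemma csym0 xs ys : csym xs ys 0 = 1.
Proof.
rewrite /csym fact0 invr1 mul1r (big_pred1 1%g) => [|s]; last first.
  by apply/esym; rewrite /=; apply/eqP/permP => -[].
rewrite odd_perm1 mul1r big_pred0 // => O; apply/negbTE/imsetP => -[[m]] //.
Qed.

Lemma csym_nil k : csym [::] [::] k.+1 = 0.
Proof.
rewrite /csym big1 ?mulr0 // => s _; rewrite (bigD1 (porbit s ord0)) ?imset_f //=.
by rewrite /lps !big_nil subrr mul0r mulr0.
Qed.

Lemma csym_cancel t xs ys k : csym (t :: xs) (t :: ys) k = csym xs ys k.
Proof. by apply: eq_csym => m _; rewrite /lps !big_cons opprD addrACA subrr add0r. Qed.

Definition cz xs ys (k : int) : F := if k is Posz n then csym xs ys n else 0.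

Lemma cz_cons x xs ys k : cz (x :: xs) ys k = cz xs ys k + x * cz xs ys (k - 1).
Proof.
case: k => [[|k]|k].
- by rewrite sub0r /= !csym0 mulr0 addr0.
- by rewrite (_ : Posz k.+1 - 1 = k) /= ?csym_cons //; lia.
by rewrite (_ : Negz k - 1 = Negz k.+1) /= ?mulr0 ?addr0 //; lia.
Qed.

Lemma cz_cancel t xs ys k : cz (t :: xs) (t :: ys) k = cz xs ys k.
Proof. by case: k => k //=; apply: csym_cancel. Qed.

(** The denominator of the generating series with its coefficients reversed, so that the recurrence
    runs over increasing indices. *)
Definition wpoly ys : {poly F} := \prod_(y <- ys) ('X + y%:P).

Lemma wpoly_monic ys : wpoly ys \is monic.
Proof. by apply: monic_prod => y _; rewrite -[y]opprK polyCN monicXsubC. Qed.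

Lemma size_wpoly ys : size (wpoly ys) = (size ys).+1.
Proof.
elim: ys => [|y ys IH]; first by rewrite /wpoly big_nil size_poly1.
rewrite /wpoly big_cons -[y]opprK polyCN size_monicM ?monicXsubC ?monic_neq0 ?wpoly_monic //.
by rewrite size_XsubC -/(wpoly ys) IH.
Qed.

Lemma cz_nil xs (k : int) : (k >= (size xs)%:Z)%R -> cz xs [::] k = (\prod_(x <- xs) x) *+ (k == (size xs)%:Z).
Proof.
elim: xs k => [|x xs IH] k; first by case: k => [[|k]|k] //= _; rewrite big_nil ?csym0 ?csym_nil.
move=> hk; rewrite cz_cons !IH; try by move: hk => /=; lia.
rewrite big_cons (_ : (k == size xs) = false) ?mulr0n ?add0r; last by move: hk => /=; lia.
by rewrite mulrnAr; congr (_ *+ _); congr nat_of_bool; rewrite /=; lia.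
Qed.

(** Clearing the denominator leaves the polynomial attached to [xs], of which only the leading
    coefficient survives from degree [size xs] on. In the induction the factor ['X + y] adds [y] to
    the numerator, where it cancels the [y] of the denominator. *)
Lemma cz_rec xs ys (k : int) : (k + (size ys)%:Z >= (size xs)%:Z)%R ->
  \sum_(j < (size ys).+1) (wpoly ys)`_j * cz xs ys (k + j%:Z) =
  (\prod_(x <- xs) x) *+ (k + (size ys)%:Z == (size xs)%:Z).
Proof.
elim: ys xs k => [|y ys IH] xs k hk.
  rewrite big_ord1 /wpoly big_nil coef1 mul1r addr0 cz_nil; last by move: hk => /=; lia.
  by congr (_ *+ nat_of_bool _); rewrite /=; lia.
have e j : (wpoly (y :: ys))`_j = (if j is j'.+1 then (wpoly ys)`_j' else 0) + y * (wpoly ys)`_j.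
  by rewrite /wpoly big_cons mulrDl coefD coefXM coefCM; case: j.
rewrite (eq_bigr (fun j : 'I_(size (y :: ys)).+1 =>
    (if val j is j'.+1 then (wpoly ys)`_j' else 0) * cz xs (y :: ys) (k + j%:Z) +
    (wpoly ys)`_j * (y * cz xs (y :: ys) (k + j%:Z)))); last first.
  by move=> j _; rewrite e mulrDl -mulrA mulrCA.
rewrite big_split /= big_ord_recl /= mul0r add0r [X in _ + X]big_ord_recr /=.
rewrite (nth_default 0 (n := (size ys).+1)) ?size_wpoly // mul0r addr0 -big_split /=.
rewrite -[RHS](_ : (\prod_(x <- xs) x) *+ ((k + 1) + (size ys)%:Z == (size xs)%:Z) = _); last first.
  by congr (_ *+ _); congr nat_of_bool; rewrite /=; lia.
rewrite -IH; last by move: hk => /=; lia.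
apply: eq_bigr => j _; rewrite -mulrDr; congr (_ * _).
rewrite -(cz_cancel y xs ys) cz_cons; congr (cz _ _ _ + _ * cz _ _ _); rewrite /bump /=; lia.
Qed.

Lemma hankel_high xs ys :
  (\prod_(y <- ys) y) * hk (cz xs ys) ((size xs)%:Z - (size ys)%:Z) (size ys).+1 =
  (\prod_(x <- xs) x) * hk (cz xs ys) ((size xs)%:Z - (size ys)%:Z + 2) (size ys).
Proof.
have -> : \prod_(y <- ys) y = (wpoly ys)`_0.
  elim: ys => [|y ys IH]; rewrite /wpoly ?big_nil ?coef1 // !big_cons.
  by rewrite mulrDl coefD coefXM add0r coefCM IH.
apply: (hankel_ratio (w := fun j => (wpoly ys)`_j)) => i.
rewrite cz_rec; last by lia.
by congr (_ *+ nat_of_bool _); lia.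
Qed.

(** Reversal of [q.+1] points, which brings the antidiagonal of a Hankel matrix of order [q.+1] to
    its diagonal. *)
Definition antidiag_sign (q : nat) : bool := odd_perm (perm (@rev_ord_inj q.+1)).

(** For empty [xs] the determinant of order one higher is triangular about its antidiagonal, where
    the entries are [1], since [cz] vanishes at negative indices; [hankel_high] then gives the base
    case. Each further [x] is a shift, by [hankel_shift]. *)
Lemma hankel_eval xs ys :
  hk (cz xs ys) ((size xs)%:Z - (size ys)%:Z + 2) (size ys) =
  (-1) ^+ antidiag_sign (size ys) * (-1) ^+ (size xs * size ys) *
  \prod_(y <- ys) (y * \prod_(x <- xs) (y - x)).
Proof.
elim: xs => [|x xs IH].
  have := hankel_high [::] ys; rewrite big_nil mul1r => <- /=.
  rewrite mul0n expr0 mulr1 mulrC; congr (_ * _); last first.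
    by apply: eq_bigr => y _; rewrite big_nil mulr1.
  rewrite /hk; set M := \matrix_(i, j) _; set q := size ys.
  pose s := perm (@rev_ord_inj q.+1).
  have t : is_trig_mx (col_perm s M).
    apply/is_trig_mxP => i j ij; rewrite !mxE permE /=.
    case e : (_ + _ + _) => [n|n] //; exfalso; have := ltn_ord j; move: e => /=; lia.
  have := det_trig t; rewrite big1 => [|i _]; last first.
    rewrite !mxE permE; have -> : 0%:Z - (size ys)%:Z + i%:Z + (rev_ord i)%:Z = 0.
      by have := ltn_ord i; rewrite /=; lia.
    by rewrite /= csym0.
  rewrite col_permE det_mulmx det_perm odd_permV => e.
  transitivity (\det M * (-1) ^+ s * (-1) ^+ s).
    by rewrite -mulrA -expr2 sqrr_sign mulr1.
  by rewrite e mul1r.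
have -> : hk (cz (x :: xs) ys) ((size (x :: xs))%:Z - (size ys)%:Z + 2) (size ys) =
   hk (fun k => cz xs ys k + x * cz xs ys (k - 1))
     ((size xs)%:Z - (size ys)%:Z + 2 + 1) (size ys).
  rewrite (eq_hk _ _ (cz_cons x xs ys)); congr (hk _ _ _); rewrite /=; lia.
rewrite (hankel_shift _ (wpoly_monic ys) (size_wpoly ys)) => [|i]; last first.
  rewrite cz_rec; last by lia.
  by rewrite (_ : (_ == _) = false) //; apply/negbTE; lia.
rewrite IH /= mulSn exprD.
have -> : (wpoly ys).[- x] = \prod_(y <- ys) (y - x).
  by rewrite /wpoly horner_prod; apply: eq_bigr => y _; rewrite !hornerE addrC.
have -> : \prod_(y <- ys) (y * \prod_(x' <- x :: xs) (y - x')) =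
    \prod_(y <- ys) (y - x) * \prod_(y <- ys) (y * \prod_(x <- xs) (y - x)).
  by rewrite -big_split /=; apply: eq_bigr => y _; rewrite big_cons mulrCA.
move: (\prod_(_ <- _) _) (\prod_(_ <- _) _) ((-1) ^+ _) ((-1) ^+ _) ((-1) ^+ _) => *.
by ring.
Qed.

End Lists.

(** * Polynomial laws in two square matrices *)

(** [K] need not be a domain, so roots cannot be counted. Instead, a Vandermonde matrix on natural
    numbers, invertible over [F], recovers the coefficients from the values. *)
Lemma poly_eq0_on_nat (F : numFieldType) (K : comNzRingType) (io : {rmorphism F -> K}) (P : {poly K}) :
  (forall c : F, P.[io c] = 0) -> P = 0.
Proof.
move=> h; set m := size P.
pose V : 'M[F]_m := Vandermonde m (\row_(i < m) i%:R).
have uV : V \in unitmx.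
  rewrite unitmxE det_Vandermonde unitfE; apply/prodf_neq0 => i _; apply/prodf_neq0 => j ij.
  by rewrite !mxE subr_eq0 eqr_nat neq_ltn orbC ij.
pose r : 'rV[K]_m := \row_i P`_i.
have rV : r *m map_mx io V = 0.
  apply/matrixP => i j; rewrite !mxE -[RHS](h j%:R) horner_coef.
  by apply: eq_bigr => k _; rewrite !mxE rmorphXn.
have r0 : r = 0.
  have := congr1 (mulmx^~ (map_mx io (invmx V))) rV.
  by rewrite -mulmxA -map_mxM mulmxV // map_mx1 mulmx1 mul0mx.
apply/polyP => k; rewrite coef0; case: (ltnP k m) => [lt_k|]; last exact: nth_default.
by have /matrixP/(_ 0 (Ordinal lt_k)) := r0; rewrite !mxE.
Qed.

Section Transfer.
Variables (F : numFieldType) (E : finType).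
Variable L : forall K : comNzRingType, {rmorphism F -> K} -> {ffun E -> K} -> K.
Hypothesis natL : forall (K K' : comNzRingType) (io : {rmorphism F -> K}) (io' : {rmorphism F -> K'})
  (phi : {rmorphism K -> K'}) w, (forall c, phi (io c) = io' c) ->
  phi (L io w) = L io' [ffun e => phi (w e)].

(** Naturality in [K] stands for being polynomial. Induction on the number of coordinates that are
    not scalars: one of them is replaced by an indeterminate, and the resulting polynomial vanishes
    at all scalars. *)
Lemma law_transfer : (forall w, L idfun w = 0) ->
  forall (K : comNzRingType) (io : {rmorphism F -> K}) w, L io w = 0.
Proof.
move=> L0 K io w.
suff H n : forall (K : comNzRingType) (io : {rmorphism F -> K}) (w : {ffun E -> K}),
    (forall e, (n <= enum_rank e)%N -> exists c, w e = io c) -> L io w = 0.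
  by apply: (H #|E|) => e; rewrite leqNgt ltn_ord.
elim: n => [|n IH] {K io w} K io w hw.
  have [w' hw'] : exists w' : E -> F, forall e, w e = io (w' e).
    by apply: (@fin_all_exists _ (fun=> F) (fun e c => w e = io c)) => e; apply: hw.
  have -> : w = [ffun e => io ([ffun e => w' e] e)] by apply/ffunP => e; rewrite !ffunE.
  by rewrite -(@natL F K idfun io io [ffun e => w' e]) // L0 rmorph0.
pose io' : {rmorphism F -> {poly K}} := polyC \o io.
pose W : {ffun E -> {poly K}} := [ffun e => if enum_rank e == n :> nat then 'X else (w e)%:P].
pose at_ (c : K) : {rmorphism {poly K} -> K} := horner_eval c.
have atL c : (L io' W).[c] = L io [ffun e => if enum_rank e == n :> nat then c else w e].
  rewrite -[LHS]/(at_ c _) (natL (io' := io)) => [|b]; last by rewrite /= /horner_eval hornerC.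
  congr (L _ _); apply/ffunP => e; rewrite !ffunE /= /horner_eval.
  by case: ifP => _; rewrite ?hornerX ?hornerC.
have P0 : L io' W = 0.
  apply: (poly_eq0_on_nat (io := io)) => c; rewrite atL; apply: IH => e le_n; rewrite ffunE.
  case: eqP => [_|/eqP ne]; first by exists c.
  by apply: hw; rewrite ltn_neqAle eq_sym ne.
have [/existsP[e0 /eqP e0n]|/existsPn no] := boolP [exists e : E, enum_rank e == n :> nat].
  have := atL (w e0); rewrite P0 horner0 => ->; congr (L _ _); apply/ffunP => e; rewrite ffunE.
  by case: eqP => // en; congr (w _); apply: enum_rank_inj; apply: val_inj; rewrite /= e0n en.
apply: IH => e le_n; apply: hw; rewrite ltn_neqAle eq_sym le_n andbT; exact: no.
Qed.
End Transfer.

Section WordTrace.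
Variables (p q N : nat).

(* The supertrace of [B^(x)N] composed with [s], for [B] with commuting entries. *)
Definition wtr (K : comNzRingType) (B : 'M[K]_(p + q)) (s : 'S_N) : K :=
  \sum_(J : tidx p q N) (-1) ^+ (tpar J + sinv s (wpar J)) * \prod_r B (J (s r)) (J r).

Lemma rmorph_wtr (K K' : comNzRingType) (phi : {rmorphism K -> K'}) (B : 'M[K]_(p + q)) s :
  phi (wtr B s) = wtr (map_mx phi B) s.
Proof.
rewrite rmorph_sum; apply: eq_bigr => J _; rewrite rmorphM rmorphXn rmorphN1 rmorph_prod.
by congr (_ * _); apply: eq_bigr => r _; rewrite mxE.
Qed.

(** A nonzero term needs [J r <= J (s r)] for all [r]; both sides have the same sum over [r], so
    they are equal and the word is fixed by [s]. *)
Lemma wtr_trig (K : comNzRingType) (B : 'M[K]_(p + q)) s : is_trig_mx B ->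
  wtr B s = pcyc (fun i => B i i) s.
Proof.
move=> /is_trig_mxP tB; rewrite /pcyc -sum_fixed_words [RHS]big_mkcond /wtr.
apply: eq_bigr => J _; case: eqP => [e|ne].
  by congr (_ * _); apply: eq_bigr => r _; have /ffunP/(_ r) := e; rewrite ffunE => ->.
have [/forallP h|/forallPn[r]] := boolP [forall r, (J r <= J (s r))%N].
  case: ne; apply/ffunP => r; rewrite ffunE; apply: val_inj; apply/esym/eqP.
  have := leqif_sum (fun (r : 'I_N) (_ : xpredT r) => leqif_eq (h r)).
  rewrite [X in (_ <= X ?= iff _)%N](_ : _ = (\sum_i J i)%N).
    by case=> _ /esym; rewrite eqxx => /forallP/(_ r).
  by rewrite [RHS](reindex_inj (@perm_inj _ s)).
by rewrite -ltnNge => lt; rewrite (bigD1 r) //= tB // mul0r mulr0.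
Qed.

(** [P] preserves parity, so replacing letters through [P] does not change the sign of a word;
    reindexing by [s] then brings each entry of [P] next to one of [Q]. *)
Lemma wtr_conj (K : comNzRingType) (B P Q : 'M[K]_(p + q)) s :
  (forall i j, vpar i != vpar j -> P i j = 0) ->
  Q *m P = 1%:M -> wtr (P *m B *m Q) s = wtr B s.
Proof.
move=> hP QP; rewrite /wtr.
pose sg (J : tidx p q N) : K := (-1) ^+ (tpar J + sinv s (wpar J)).
have sgE (J J' : tidx p q N) : (forall r, vpar (J r) = vpar (J' r)) -> sg J = sg J'.
  move=> h; congr (_ ^+ (nat_of_bool _ + _)); first by apply: eq_bigr => r _; rewrite h.
  by apply: eq_sinv => r; rewrite /wpar h.
transitivity (\sum_(J : tidx p q N) \sum_(k : tidx p q N) \sum_(l : tidx p q N)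
   sg k * \prod_r (P (J (s r)) (k (s r)) * B (k (s r)) (l r) * Q (l r) (J r))).
  apply: eq_bigr => J _; rewrite -/(sg J).
  transitivity (sg J * \sum_(k : tidx p q N) \sum_(l : tidx p q N)
     \prod_r (P (J (s r)) (k (s r)) * B (k (s r)) (l r) * Q (l r) (J r))).
    congr (_ * _); rewrite exchange_big /=.
    transitivity (\sum_(l : tidx p q N) \prod_r ((P *m B) (J (s r)) (l r) * Q (l r) (J r))).
      rewrite -(bigA_distr_bigA (fun r l => (P *m B) (J (s r)) l * Q l (J r))).
      by apply: eq_bigr => r _; rewrite mxE.
    apply: eq_bigr => l _.
    transitivity (\sum_(k : tidx p q N)
       \prod_r (P (J (s r)) (k r) * B (k r) (l r) * Q (l r) (J r))).
      rewrite -(bigA_distr_bigA (fun r k => P (J (s r)) k * B k (l r) * Q (l r) (J r))).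
      by apply: eq_bigr => r _; rewrite mxE mulr_suml.
    rewrite (reindex (fun k => wperm k s)) /=; last first.
      by exists (fun k => wperm k s^-1%g) => k _; rewrite wpermM ?mulVg ?mulgV wperm1.
    by apply: eq_bigr => k _; apply: eq_bigr => r _; rewrite ffunE.
  rewrite mulr_sumr; apply: eq_bigr => k _; rewrite mulr_sumr; apply: eq_bigr => l _.
  have [/forallP h|/forallPn[r nr]] := boolP [forall r, vpar (J r) == vpar (k r)].
    by congr (_ * _); apply: sgE => r; exact: eqP (h r).
  by rewrite (bigD1 (s^-1%g r)) //= permKV hP // !mul0r !mulr0.
rewrite exchange_big /=; apply: eq_bigr => k _; rewrite exchange_big /= (bigD1 k) //=.
have E (l : tidx p q N) : \sum_(J : tidx p q N) sg k *
      \prod_r (P (J (s r)) (k (s r)) * B (k (s r)) (l r) * Q (l r) (J r)) =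
    sg k * \prod_r B (k (s r)) (l r) * (l == k)%:R.
  transitivity (sg k * \prod_r B (k (s r)) (l r) *
      \sum_(J : tidx p q N) \prod_r (Q (l r) (J r) * P (J r) (k r))).
    rewrite mulr_sumr; apply: eq_bigr => J _; rewrite -mulrA; congr (_ * _).
    rewrite !big_split /= [X in X * _ * _ = _](_ : _ = \prod_r P (J r) (k r)); last first.
      by rewrite [RHS](reindex_inj (@perm_inj _ s)).
    move: (\prod_(_ < _) _) (\prod_(_ < _) _) (\prod_(_ < _) _) => u v w; ring.
  congr (_ * _); rewrite -(bigA_distr_bigA (fun r j => Q (l r) j * P j (k r))).
  rewrite (eq_bigr (fun r => (l r == k r)%:R)) => [|r _]; last first.
    by have /matrixP/(_ (l r) (k r)) := QP; rewrite !mxE.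
  have [->|nlk] := eqVneq l k; first by rewrite big1 // => r _; rewrite eqxx.
  have [r nr] : exists r, l r != k r.
    by apply/existsP; apply: contraNT nlk => /existsPn h; apply/eqP/ffunP => r; apply/eqP/negPn.
  by rewrite (bigD1 r) //= (negbTE nr) mul0r.
rewrite E eqxx mulr1 [X in _ + X]big1 ?addr0 // => l nl; by rewrite E (negbTE nl) mulr0.
Qed.
End WordTrace.

(** * Reduction to generic triangular blocks over the base field *)

Section BlockLaw.
Variables (F : numClosedFieldType) (p q : nat).

Definition gen_xy (x : 'I_p -> F) (y : 'I_q -> F) : Prop :=
  [/\ forall i, x i != 0, forall j, y j != 0 &
   forall i i' j j', y j * x i' = y j' * x i -> i = i' /\ j = j'].

(** An explicit generic direction: the exponent [p * j + i] with [i < p] determines [i] and [j], so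
    all the ratios are distinct. *)
Let xi (i : 'I_p) : F := (2 ^ i)%:R.
Let up (j : 'I_q) : F := (2 ^ (p * j))%:R.

Let xi_up i i' j j' : up j * xi i' = up j' * xi i -> i = i' /\ j = j'.
Proof.
move=> /eqP; rewrite /up /xi -!natrM -!expnD eqr_nat => /eqP /expnI e.
have {}e : (p * j + i' = p * j' + i)%N by apply: e.
have li := ltn_ord i; have li' := ltn_ord i'.
have ej : j = j' :> nat.
  case: (ltngtP (j : nat) j') => // lt; exfalso; nia.
split; apply: val_inj => //=; move: e; rewrite ej; lia.
Qed.

(** [Q] is the product of all quantities that must not vanish along the line; the top coefficient of
    each factor comes from the direction, which is generic, so no factor is zero. *)
Lemma generic_line (x : 'I_p -> F) (y : 'I_q -> F) :
  exists2 Q : {poly F}, Q != 0 &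
    forall e, Q.[e] != 0 -> gen_xy (fun i => x i + e * xi i) (fun j => y j + e * up j).
Proof.
pose X i : {poly F} := (x i)%:P + xi i *: 'X; pose Y j : {poly F} := (y j)%:P + up j *: 'X.
have hX i e : (X i).[e] = x i + e * xi i by rewrite !hornerE mulrC.
have hY j e : (Y j).[e] = y j + e * up j by rewrite !hornerE mulrC.
pose D (t : ('I_p * 'I_p) * ('I_q * 'I_q)) := Y t.2.1 * X t.1.2 - Y t.2.2 * X t.1.1.
exists (\prod_i X i * \prod_j Y j * \prod_(t | ~~ ((t.1.1 == t.1.2) && (t.2.1 == t.2.2))) D t).
  rewrite !mulf_neq0 //; apply/prodf_neq0.
  - move=> i _; apply/eqP => /polyP/(_ 1%N); rewrite coefD coefC coefZ coefX coef0 /= add0r mulr1.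
    by apply/eqP; rewrite pnatr_eq0 expn_eq0.
  - move=> i _; apply/eqP => /polyP/(_ 1%N); rewrite coefD coefC coefZ coefX coef0 /= add0r mulr1.
    by apply/eqP; rewrite pnatr_eq0 expn_eq0.
  move=> [[i i'] [j j']] /= ne; apply/eqP => /polyP/(_ 2%N); rewrite coef0 /D /= coefB.
  have c2 u v (a b : F) : ((u%:P + a *: 'X) * (v%:P + b *: 'X))`_2 = a * b.
    rewrite coefM !big_ord_recr big_ord0 /= !coefD !coefC !coefZ !coefX /=.
    by rewrite !(mulr0, mulr1, mul0r, add0r, addr0).
  by rewrite !c2 => /eqP; rewrite subr_eq0 => /eqP/xi_up[ei ej]; rewrite ei ej !eqxx in ne.
move=> e; rewrite !hornerM !horner_prod !mulf_eq0 !negb_or => /andP[/andP[/prodf_neq0 h1 /prodf_neq0 h2] /prodf_neq0 h3].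
split=> [i|j|i i' j j' E]; rewrite -?hX -?hY ?h1 ?h2 //.
case: (boolP ((i == i') && (j == j'))) => [/andP[/eqP-> /eqP->] //|ne].
by have := h3 ((i, i'), (j, j')) ne; rewrite /D /= hornerD hornerN !hornerM !hX !hY E subrr eqxx.
Qed.

Variable L : forall K : comNzRingType, {rmorphism F -> K} -> 'M[K]_p -> 'M[K]_q -> K.
Hypothesis natL : forall (K K' : comNzRingType) (io : {rmorphism F -> K}) (io' : {rmorphism F -> K'})
  (phi : {rmorphism K -> K'}) a d, (forall c, phi (io c) = io' c) ->
  phi (L io a d) = L io' (map_mx phi a) (map_mx phi d).
Hypothesis conjL : forall a d (P : 'M[F]_p) (Q : 'M[F]_q), P \in unitmx -> Q \in unitmx ->
  L idfun (P *m a *m invmx P) (Q *m d *m invmx Q) = L idfun a d.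
Hypothesis trigL : forall (a : 'M[F]_p) (d : 'M[F]_q), is_trig_mx a -> is_trig_mx d ->
  gen_xy (fun i => a i i) (fun j => d j j) -> L idfun a d = 0.

(** On a generic line the law times [Q] vanishes everywhere, as [Q] is zero where genericity fails.
    Polynomials over [F] form a domain, so the law vanishes along the whole line, also at its
    origin. *)
Lemma trig_law (a : 'M[F]_p) (d : 'M[F]_q) : is_trig_mx a -> is_trig_mx d -> L idfun a d = 0.
Proof.
move=> ta td; have [Q Q0 hQ] := generic_line (fun i => a i i) (fun j => d j j).
pose io : {rmorphism F -> {poly F}} := polyC.
pose aX := \matrix_(i, j) ((a i j)%:P + (xi i *: 'X) *+ (i == j)).
pose dX := \matrix_(i, j) ((d i j)%:P + (up i *: 'X) *+ (i == j)).
pose P := L io aX dX.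
have PE e : P.[e] = L idfun (\matrix_(i, j) (a i j + (e * xi i) *+ (i == j)))
                            (\matrix_(i, j) (d i j + (e * up i) *+ (i == j))).
  rewrite -[LHS]/(horner_eval e _) (natL (io' := idfun)) => [|c]; last by rewrite /= /horner_eval hornerC.
  by congr (L _ _ _); apply/matrixP => i j; rewrite !mxE /= /horner_eval hornerD hornerC hornerMn
    hornerZ hornerX mulrC.
have P0 : P = 0.
  apply/eqP; have : P * Q == 0.
    apply/eqP/(@poly_eq0_on_nat F F idfun) => e /=; rewrite hornerM.
    have [->|/hQ ge] := eqVneq Q.[e] 0; first by rewrite mulr0.
    rewrite PE trigL ?mul0r //.
    - apply/is_trig_mxP => i j ij; rewrite mxE (is_trig_mxP ta) // add0r.
      by rewrite (_ : i == j = false) //; apply/eqP => e'; rewrite e' ltnn in ij.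
    - apply/is_trig_mxP => i j ij; rewrite mxE (is_trig_mxP td) // add0r.
      by rewrite (_ : i == j = false) //; apply/eqP => e'; rewrite e' ltnn in ij.
    case: ge => g1 g2 g3; split=> [i|j|i i' j j']; rewrite !mxE !eqxx //; exact: g3.
  by rewrite mulf_eq0 (negbTE Q0) orbF.
have := PE 0; rewrite P0 horner0 => /esym; congr (L _ _ _ = _);
  by apply/matrixP => i j; rewrite !mxE mul0r mul0rn addr0.
Qed.

Lemma trigonalize n (A : 'M[F]_n) : exists2 P, P \in unitmx & is_trig_mx (P *m A *m invmx P).
Proof.
case: n A => [|n] A; first by exists 1%:M; rewrite ?unitmx1 //; apply/is_trig_mxP => -[].
have [P /unitarymx_unit uP] := Schur A (ltn0Sn n).
by rewrite /similar_to conjumx //; exists P.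
Qed.

Lemma block_law (K : comNzRingType) (io : {rmorphism F -> K}) a d : L io a d = 0.
Proof.
pose E := ('I_p * 'I_p + 'I_q * 'I_q)%type.
pose ma (K : comNzRingType) (w : {ffun E -> K}) : 'M[K]_p := \matrix_(i, j) w (inl (i, j)).
pose md (K : comNzRingType) (w : {ffun E -> K}) : 'M[K]_q := \matrix_(i, j) w (inr (i, j)).
pose LE (K : comNzRingType) (io : {rmorphism F -> K}) w := L io (ma K w) (md K w).
pose w : {ffun E -> K} := [ffun e => match e with inl ij => a ij.1 ij.2 | inr ij => d ij.1 ij.2 end].
have -> : a = ma K w by apply/matrixP => i j; rewrite !mxE ffunE.
have -> : d = md K w by apply/matrixP => i j; rewrite !mxE ffunE.
apply: (@law_transfer F E LE) => {K io a d w} [K K' io io' phi w h|w].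
  by rewrite /LE (natL (io' := io')) //; congr (L _ _ _); apply/matrixP => i j; rewrite !mxE ffunE.
rewrite /LE; have [P uP tP] := trigonalize (ma F w); have [Q uQ tQ] := trigonalize (md F w).
by rewrite -(conjL _ _ uP uQ); apply: trig_law.
Qed.
End BlockLaw.

Lemma char_poly_conj (F : fieldType) n (P A : 'M[F]_n) : P \in unitmx ->
  char_poly (P *m A *m invmx P) = char_poly A.
Proof.
move=> uP; have PP : map_mx polyC P *m map_mx polyC (invmx P) = 1%:M.
  by rewrite -map_mxM mulmxV // map_mx1.
rewrite /char_poly.
have -> : char_poly_mx (P *m A *m invmx P) =
    map_mx polyC P *m char_poly_mx A *m map_mx polyC (invmx P).
  rewrite /char_poly_mx mulmxBr mulmxBl !map_mxM /=; congr (_ - _).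
  by rewrite scalar_mxC -mulmxA PP mulmx1.
rewrite !det_mulmx mulrAC -det_mulmx PP det1 mul1r //.
Qed.

Lemma size_index_ord n : size (index_enum 'I_n) = n.
Proof. by rewrite -sum1_size sum1_card card_ord. Qed.

Lemma det_conj (F : fieldType) n (P A : 'M[F]_n) : P \in unitmx ->
  \det (P *m A *m invmx P) = \det A.
Proof. by move=> uP; rewrite !det_mulmx mulrAC -det_mulmx mulmxV // det1 mul1r. Qed.

(** * Identities for two commuting-entry blocks *)

Section Laws.
Variables (F : numClosedFieldType) (p q : nat).

Definition bdiag (K : comNzRingType) (a : 'M[K]_p) (d : 'M[K]_q) : 'M[K]_(p + q) :=
  block_mx a 0 0 d.

Definition ck (K : comNzRingType) (io : {rmorphism F -> K}) a d (k : int) : K :=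
  if k is Posz n then
    io (n`!%:R)^-1 * \sum_(s : 'S_n) (-1) ^+ odd_perm s * wtr (bdiag a d) s
  else 0.

Definition fw N r s (row : 'I_N -> 'I_r) (col : 'I_N -> 'I_s) (K : comNzRingType)
    (a : 'M[K]_p) (d : 'M[K]_q) : K :=
  \sum_(u in fstab row) \sum_(v in fstab col) (-1) ^+ odd_perm v * wtr (bdiag a d) (v * u)%g.

Lemma map_bdiag (K K' : comNzRingType) (phi : {rmorphism K -> K'}) (a : 'M[K]_p) (d : 'M[K]_q) :
  map_mx phi (bdiag a d) = bdiag (map_mx phi a) (map_mx phi d).
Proof. by rewrite /bdiag map_block_mx !map_mx0. Qed.

Section Nat.
Variables (K K' : comNzRingType) (io : {rmorphism F -> K}) (io' : {rmorphism F -> K'}).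
Variable phi : {rmorphism K -> K'}.
Hypothesis h : forall c, phi (io c) = io' c.

Lemma rmorph_ck a d k : phi (ck io a d k) = ck io' (map_mx phi a) (map_mx phi d) k.
Proof.
case: k => n /=; last exact: rmorph0.
rewrite rmorphM h rmorph_sum; congr (_ * _); apply: eq_bigr => s _.
by rewrite rmorphM rmorphXn rmorphN1 rmorph_wtr map_bdiag.
Qed.

Lemma rmorph_hk (c : int -> K) b m : phi (hk c b m) = hk (fun k => phi (c k)) b m.
Proof.
by rewrite /hk -det_map_mx; congr (\det _); apply/matrixP => i j; rewrite !mxE.
Qed.

Lemma rmorph_fw N r s (row : 'I_N -> 'I_r) (col : 'I_N -> 'I_s) a d :
  phi (fw row col a d) = fw row col (map_mx phi a) (map_mx phi d).
Proof.
rewrite rmorph_sum; apply: eq_bigr => u _; rewrite rmorph_sum; apply: eq_bigr => v _.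
by rewrite rmorphM rmorphXn rmorphN1 rmorph_wtr map_bdiag.
Qed.
End Nat.

Lemma wtr_bdiag_conj N (a : 'M[F]_p) (d : 'M[F]_q) P Q (s : 'S_N) :
  P \in unitmx -> Q \in unitmx ->
  wtr (bdiag (P *m a *m invmx P) (Q *m d *m invmx Q)) s = wtr (bdiag a d) s.
Proof.
move=> uP uQ.
have -> : bdiag (P *m a *m invmx P) (Q *m d *m invmx Q) =
    bdiag P Q *m bdiag a d *m bdiag (invmx P) (invmx Q).
  by rewrite /bdiag !mulmx_block !(mul0mx, mulmx0, addr0, add0r).
apply: wtr_conj.
  move=> i j; case: (split_ordP i) => i' ->; case: (split_ordP j) => j' ->;
  by rewrite ?vpar_lshift ?vpar_rshift // ?block_mxEur ?block_mxEdl ?mxE.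
by rewrite /bdiag mulmx_block !(mul0mx, mulmx0, addr0, add0r) !mulVmx // -scalar_mx_block.
Qed.

Lemma ck_conj a d P Q k : P \in unitmx -> Q \in unitmx ->
  ck idfun (P *m a *m invmx P) (Q *m d *m invmx Q) k = ck idfun a d k.
Proof.
move=> uP uQ; case: k => n //=; congr (_ * _); apply: eq_bigr => s _.
by rewrite wtr_bdiag_conj.
Qed.

Lemma fw_conj N r s (row : 'I_N -> 'I_r) (col : 'I_N -> 'I_s) (a : 'M[F]_p) (d : 'M[F]_q) P Q :
  P \in unitmx -> Q \in unitmx ->
  fw row col (P *m a *m invmx P) (Q *m d *m invmx Q) = fw row col a d.
Proof.
move=> uP uQ; apply: eq_bigr => u _; apply: eq_bigr => v _.
by rewrite wtr_bdiag_conj.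
Qed.

Section Trig.
Variables (a : 'M[F]_p) (d : 'M[F]_q).
Hypotheses (ta : is_trig_mx a) (td : is_trig_mx d).
Let x i := a i i.
Let y j := d j j.

Lemma wtr_bdiag_trig N (s : 'S_N) : wtr (bdiag a d) s = pcyc (zxy x y) s.
Proof.
rewrite wtr_trig; last by rewrite is_trig_block_mx // eqxx ta td.
apply: eq_bigr => O _; apply: eq_bigr => i _; congr (_ * _ ^+ _).
by case: (split_ordP i) => j ->; rewrite ?zxyl ?zxyr ?block_mxEul ?block_mxEdr.
Qed.

Lemma ck_trig k : ck idfun a d k = cz (map x (index_enum 'I_p)) (map y (index_enum 'I_q)) k.
Proof.
case: k => n //=; congr (_ * _); apply: eq_bigr => s _; rewrite wtr_bdiag_trig.
congr (_ * _); apply: eq_bigr => O _; by rewrite psum_zxy /lps !big_map.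
Qed.

Lemma fw_trig N r s (row : 'I_N -> 'I_r) (col : 'I_N -> 'I_s) :
  fw row col a d = fD row col (zxy x y).
Proof.
by apply: eq_bigr => u _; apply: eq_bigr => v _; rewrite wtr_bdiag_trig.
Qed.

Lemma hk_trig : hk (ck idfun a d) (p%:Z - q%:Z + 2) q =
  (-1) ^+ antidiag_sign q * (-1) ^+ (p * q) * \prod_j (y j * \prod_i (y j - x i)).
Proof.
have := hankel_eval (map x (index_enum 'I_p)) (map y (index_enum 'I_q)).
rewrite !size_map !size_index_ord big_map /=.
rewrite (eq_bigr (fun j => y j * \prod_i (y j - x i))) => [<-|j _]; last first.
  by rewrite big_map.
by apply: eq_hk => k; rewrite ck_trig.
Qed.
End Trig.

(** [char_poly (- d)] is the product of ['X + y] over the eigenvalues [y] of [d], that is,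
    [wpoly]. *)
Lemma law_rec (K : comNzRingType) (io : {rmorphism F -> K}) a d (i : nat) :
  \sum_(j < q.+1) (char_poly (- d))`_j * ck io a d (p%:Z - q%:Z + i%:Z + j%:Z) =
  \det a *+ (i == 0%N).
Proof.
apply/eqP; rewrite -subr_eq0; apply/eqP.
apply: (@block_law F p q (fun K io a d => \sum_(j < q.+1) (char_poly (- d))`_j *
   ck io a d (p%:Z - q%:Z + i%:Z + j%:Z) - \det a *+ (i == 0%N))).
- move=> {K io a d} K K' io io' phi a d h.
  rewrite rmorphB rmorph_sum rmorphMn det_map_mx; congr (_ - _).
  apply: eq_bigr => j _; rewrite rmorphM (rmorph_ck h); congr (_ * _).
  by rewrite -map_mxN -map_char_poly coef_map.
- move=> {K io a d} a d P Q uP uQ.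
  have -> : char_poly (- (Q *m d *m invmx Q)) = char_poly (- d).
    by rewrite -[RHS](char_poly_conj _ uQ) mulmxN mulNmx.
  rewrite det_conj //; congr (_ - _); apply: eq_bigr => j _; by rewrite ck_conj.
move=> {K io a d} a d ta td _; apply/eqP; rewrite subr_eq0; apply/eqP.
have := @cz_rec F (map (fun i => a i i) (index_enum 'I_p)) (map (fun j => d j j) (index_enum 'I_q)) (p%:Z - q%:Z + i%:Z).
rewrite !size_map !size_index_ord => H.
have {H} := H _; rewrite (_ : (_ == _) = (i == 0%N)); last by lia.
rewrite !big_map /= det_trig // => <-; last by lia.
apply: eq_bigr => j _; rewrite ck_trig //; congr (_`__ * _).
rewrite char_poly_trig; last by apply/is_trig_mxP => k l kl; rewrite mxE (is_trig_mxP td) // oppr0.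
rewrite /wpoly big_map (eq_bigr (fun k => 'X + (d k k)%:P)) // => k _; by rewrite mxE polyCN opprK.
Qed.

Lemma hk_ratio (K : comNzRingType) (io : {rmorphism F -> K}) a d :
  \det d * hk (ck io a d) (p%:Z - q%:Z) q.+1 = \det a * hk (ck io a d) (p%:Z - q%:Z + 2) q.
Proof.
rewrite -(hankel_ratio (w := fun j => (char_poly (- d))`_j)) => [|i]; last first.
  exact: law_rec.
congr (_ * _); rewrite -horner_coef0 /char_poly -horner_evalE -det_map_mx; congr (\det _).
apply/matrixP => i j; rewrite !mxE /= /horner_eval hornerD hornerN hornerC hornerMn hornerX.
by rewrite mul0rn add0r opprK.
Qed.

Definition mxpow (K : comNzRingType) n (a : 'M[K]_n) k := iter k (mulmx a) 1%:M.

(** Evaluation at a matrix as a sum of fixed length: it makes sense in order 0, and commutes with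
    ring morphisms even when they lower the size of [w]. *)
Definition mxhorner (K : comNzRingType) n m (a : 'M[K]_n) (w : {poly K}) : 'M[K]_n :=
  \sum_(k < m) w`_k *: mxpow a k.

Lemma map_mxhorner (K K' : comNzRingType) (phi : {rmorphism K -> K'}) n m (a : 'M[K]_n) w :
  map_mx phi (mxhorner m a w) = mxhorner m (map_mx phi a) (map_poly phi w).
Proof.
rewrite raddf_sum; apply: eq_bigr => k _; rewrite /= map_mxZ coef_map; congr (_ *: _).
by elim: (val k) => [|l IH]; rewrite ?map_mx1 //= map_mxM IH.
Qed.

Lemma mxhorner_conj n m (a P : 'M[F]_n) w : P \in unitmx ->
  mxhorner m (P *m a *m invmx P) w = P *m mxhorner m a w *m invmx P.
Proof.
move=> uP; rewrite mulmx_sumr mulmx_suml; apply: eq_bigr => k _.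
rewrite -scalemxAr -scalemxAl; congr (_ *: _).
elim: (val k) => [|l IH]; first by rewrite /= mulmx1 mulmxV.
by rewrite /= IH !mulmxA mulmxKV.
Qed.

Lemma mxpow_trig n (a : 'M[F]_n) k : is_trig_mx a ->
  is_trig_mx (mxpow a k) /\ forall i, mxpow a k i i = a i i ^+ k.
Proof.
move=> ta; elim: k => [|k [IH1 IH2]].
  by split=> [|i]; rewrite ?scalar_mx_is_trig // !mxE eqxx.
have h (i j l : 'I_n) : (i <= j)%N -> (i != l) || (l != j) -> a i l * mxpow a k l j = 0.
  move=> ij nl; case: (ltnP i l) => il; first by rewrite (is_trig_mxP ta) ?mul0r.
  case: (ltnP l j) => lj; first by rewrite (is_trig_mxP IH1) ?mulr0.
  by case/orP: nl => /eqP[]; apply: val_inj => /=; lia.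
split=> [|i].
  apply/is_trig_mxP => i j ij; rewrite mxE big1 // => l _; apply: h; first exact: ltnW.
  by case: eqP => // <-; apply/eqP => e; rewrite e ltnn in ij.
rewrite mxE (bigD1 i) //= IH2 big1 ?addr0 ?exprS // => l nl.
by apply: h => //; rewrite eq_sym nl.
Qed.

Lemma det_mxhorner_trig n m (a : 'M[F]_n) (w : {poly F}) : is_trig_mx a -> (size w <= m)%N ->
  \det (mxhorner m a w) = \prod_i w.[a i i].
Proof.
move=> ta sw; rewrite det_trig.
  apply: eq_bigr => i _; rewrite summxE (horner_coef_wide _ sw).
  by apply: eq_bigr => k _; rewrite mxE (mxpow_trig _ ta).2.
apply/is_trig_mxP => i j ij; rewrite summxE big1 // => k _.
by rewrite mxE (is_trig_mxP (mxpow_trig k ta).1) ?mulr0.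
Qed.

(** The last factor is the resultant of the two characteristic polynomials; its invertibility, read
    off from the Hankel determinant, is what makes the Sylvester equation solvable. *)
Lemma law_res (K : comNzRingType) (io : {rmorphism F -> K}) a d :
  hk (ck io a d) (p%:Z - q%:Z + 2) q =
  (-1) ^+ antidiag_sign q * \det d * \det (mxhorner q.+1 a (char_poly d)).
Proof.
apply/eqP; rewrite -subr_eq0; apply/eqP.
apply: (@block_law F p q (fun K io a d => hk (ck io a d) (p%:Z - q%:Z + 2) q -
  (-1) ^+ antidiag_sign q * \det d * \det (mxhorner q.+1 a (char_poly d)))).
- move=> {K io a d} K K' io io' phi a d h.
  rewrite rmorphB rmorph_hk !rmorphM rmorphXn rmorphN1 -!det_map_mx map_mxhorner.
  by rewrite map_char_poly (eq_hk _ _ (rmorph_ck h a d)).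
- move=> {K io a d} a d P Q uP uQ.
  rewrite char_poly_conj // mxhorner_conj // (eq_hk _ _ (fun k => ck_conj a d k uP uQ)).
  by rewrite !det_conj.
move=> {K io a d} a d ta td _; apply/eqP; rewrite subr_eq0; apply/eqP.
rewrite hk_trig // det_mxhorner_trig ?size_char_poly // char_poly_trig // (det_trig td).
rewrite -!mulrA; congr (_ * _); rewrite big_split /= mulrCA; congr (_ * _).
rewrite mulnC exprM -[X in (_ ^+ _) ^+ X](card_ord p) -prodr_const.
rewrite exchange_big -big_split /=; apply: eq_bigr => i _.
rewrite horner_prod -[X in (-1) ^+ X](card_ord q) -prodr_const -big_split /=.
by apply: eq_bigr => j _; rewrite !hornerE mulN1r opprB.
Qed.

Lemma law_high N (row : 'I_N -> 'I_p.+1) (col : 'I_N -> 'I_q) (rc : rect_cells row col)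
    (K : comNzRingType) (io : {rmorphism F -> K}) a d :
  fw row col a d = (-1) ^+ antidiag_sign q * (-1) ^+ (p * q) * (-1) ^+ N * (kappa rc)%:~R *
    hk (ck io a d) (p%:Z - q%:Z + 2) q.
Proof.
apply/eqP; rewrite -subr_eq0; apply/eqP.
apply: (@block_law F p q (fun K io a d => fw row col a d -
  (-1) ^+ antidiag_sign q * (-1) ^+ (p * q) * (-1) ^+ N * (kappa rc)%:~R *
    hk (ck io a d) (p%:Z - q%:Z + 2) q)).
- move=> {K io a d} K K' io io' phi a d h.
  rewrite rmorphB rmorph_fw !rmorphM rmorph_hk !rmorphXn rmorphN1 rmorph_int.
  by rewrite (eq_hk _ _ (rmorph_ck h a d)).
- move=> {K io a d} a d P Q uP uQ.
  by rewrite fw_conj // (eq_hk _ _ (fun k => ck_conj a d k uP uQ)).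
move=> {K io a d} a d ta td [x0 y0 xy]; apply/eqP; rewrite subr_eq0; apply/eqP.
rewrite hk_trig // fw_trig // (fD_high_rect x0 y0 xy rc).
move: (\prod_(_ < _) _) => X; rewrite mulrA; congr (_ * X).
have := sqrr_sign F (antidiag_sign q); have := sqrr_sign F (p * q).
move: ((-1) ^+ N) ((-1) ^+ antidiag_sign q) ((-1) ^+ (p * q)) (_%:~R) => u v w z ew ev.
rewrite [RHS](_ : _ = u * z * (v ^+ 2) * (w ^+ 2)); last by ring.
by rewrite ev ew !mulr1.
Qed.

(** The two traces share the product of all differences of eigenvalues and differ by [det a] against
    [det d]; the two integers [kappa] are put on opposite sides to avoid division. *)
Lemma law_wide N (row : 'I_N -> 'I_p.+1) (col : 'I_N -> 'I_q) (rc : rect_cells row col)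
    N' (row' : 'I_N' -> 'I_p) (col' : 'I_N' -> 'I_q.+1) (rc' : rect_cells row' col')
    (K : comNzRingType) (io : {rmorphism F -> K}) (a : 'M[K]_p) (d : 'M[K]_q) :
  (kappa rc)%:~R * (\det d * fw row' col' a d) =
  (-1) ^+ (N + p * q) * (kappa rc')%:~R * (\det a * fw row col a d).
Proof.
apply/eqP; rewrite -subr_eq0; apply/eqP.
apply: (@block_law F p q (fun K io a d => (kappa rc)%:~R * (\det d * fw row' col' a d) -
  (-1) ^+ (N + p * q) * (kappa rc')%:~R * (\det a * fw row col a d))) io a d.
- move=> K1 K' io io' phi a d h.
  by rewrite rmorphB !rmorphM !rmorph_fw !rmorphXn rmorphN1 !rmorph_int -!det_map_mx.
- move=> a d P Q uP uQ.
  rewrite !fw_conj //.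
  by rewrite !det_conj.
move=> a d ta td [x0 y0 xy]; apply/eqP; rewrite subr_eq0; apply/eqP.
rewrite !fw_trig // (fD_high_rect x0 y0 xy rc) (fD_wide_rect x0 y0 xy rc') !det_trig // !big_split /=.
have -> : \prod_(i < p) \prod_(j < q) (a i i - d j j) =
   (-1) ^+ (p * q) * \prod_(j < q) \prod_(i < p) (d j j - a i i).
  rewrite exprM -[X in (_ ^+ _) ^+ X](card_ord q) -prodr_const.
  rewrite exchange_big -big_split /=; apply: eq_bigr => i _.
  rewrite -[X in (-1) ^+ X](card_ord p) -prodr_const -big_split /=.
  by apply: eq_bigr => j _; rewrite mulN1r opprB.
rewrite exprD; have := sqrr_sign F N.
move: ((-1) ^+ N) ((-1) ^+ (p * q)) (_%:~R) (_%:~R) (\prod_(_ < _) _) (\prod_(_ < _) _) (\prod_(_ < _) _) => u w k k' X Y Z eu.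
rewrite [RHS](_ : _ = u ^+ 2 * (w * k' * k * X * Y * Z)); last by ring.
by rewrite eu; ring.
Qed.

End Laws.

(** * Supertraces of subquotients *)

Section Super.
Variables (F : fieldType) (G : unitAlgType F) (gr : bool -> {pred G}).
Hypothesis hG : supercommutative gr.

Lemma gr_sum_in I (r : seq I) (P : pred I) (f : I -> G) e :
  (forall i, P i -> f i \in gr e) -> \sum_(i <- r | P i) f i \in gr e.
Proof.
by move=> h; elim/big_ind: _ => //; [exact: gr0 hG e | exact: grD hG e].
Qed.

Lemma gr_opp e x : x \in gr e -> - x \in gr e.
Proof. by move=> h; rewrite -scaleN1r; apply: (grZ hG). Qed.

Lemma gr_sign e (b : bool) x : x \in gr e -> (-1) ^+ b * x \in gr e.
Proof. by case: b; rewrite ?mul1r ?mulN1r // => h; apply: gr_opp. Qed.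

Lemma gr_add_eq0 e x y : x \in gr e -> y \in gr (~~ e) -> x + y \in gr e -> y = 0.
Proof.
move=> hx hy hxy; have : y \in gr e by rewrite -[y](addKr x) addrC (grD hG) // gr_opp.
by case: e hy {hx hxy} => /= h1 h2; apply: (gr_direct hG).
Qed.

Lemma gr_split e x : exists y z, [/\ y \in gr e, z \in gr (~~ e) & x = y + z].
Proof.
have [x0 [x1 [h0 h1 ->]]] := gr_sum hG x.
by case: e; [exists x1, x0; rewrite addrC | exists x0, x1].
Qed.

Section Matrix.
Variables (X : finType) (par : X -> bool).
Implicit Types (t : {ffun X -> G}) (E : 'M[F]_(#|X|)).

Definition opm E t : {ffun X -> G} := [ffun x => \sum_y mel E x y *: t y].
Definition opg (f : X -> X -> G) t : {ffun X -> G} := [ffun x => \sum_y f x y * t y].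

Lemma opmM E E' t : opm (E * E') t = opm E (opm E' t).
Proof.
apply/ffunP => x; rewrite !ffunE.
under eq_bigr do rewrite melM scaler_suml.
rewrite exchange_big; apply: eq_bigr => y _; rewrite ffunE scaler_sumr.
by apply: eq_bigr => z _; rewrite scalerA.
Qed.

Lemma opmD E t t' : opm E (t + t') = opm E t + opm E t'.
Proof.
apply/ffunP => x; rewrite !ffunE -big_split; apply: eq_bigr => y _.
by rewrite ffunE scalerDr.
Qed.

Lemma opmB E t t' : opm E (t - t') = opm E t - opm E t'.
Proof.
apply/ffunP => x; rewrite !ffunE -sumrB; apply: eq_bigr => y _.
by rewrite !ffunE scalerBr.
Qed.

Lemma opmZ E t (a : G) : opm E (rscale t a) = rscale (opm E t) a.
Proof.
apply/ffunP => x; rewrite !ffunE mulr_suml; apply: eq_bigr => y _.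
by rewrite ffunE scalerAl.
Qed.

Lemma opgZ f t (a : G) : opg f (rscale t a) = rscale (opg f t) a.
Proof.
apply/ffunP => x; rewrite !ffunE mulr_suml; apply: eq_bigr => y _.
by rewrite ffunE mulrA.
Qed.

Lemma opm_sum E I (r : seq I) (P : pred I) (t : I -> {ffun X -> G}) :
  opm E (\sum_(i <- r | P i) t i) = \sum_(i <- r | P i) opm E (t i).
Proof.
elim/big_rec2: _ => [|i y1 y2 _ <-]; last exact: opmD.
by apply/ffunP => x; rewrite !ffunE big1 // => y _; rewrite ffunE scaler0.
Qed.

Lemma lincombE m (b : 'I_m -> {ffun X -> G}) a x : lincomb b a x = \sum_i b i x * a i.
Proof. by rewrite sum_ffunE; apply: eq_bigr => i _; rewrite ffunE. Qed.

Lemma opm_lincomb E m (b : 'I_m -> {ffun X -> G}) a :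
  opm E (lincomb b a) = lincomb (fun i => opm E (b i)) a.
Proof. by rewrite opm_sum; apply: eq_bigr => i _; rewrite opmZ. Qed.

Variables (E : 'M[F]_(#|X|)) (f : X -> X -> G).
Hypothesis EE : E * E = E.
Hypothesis Epar : forall x y, par x != par y -> mel E x y = 0.
Hypothesis fpar : forall x y, f x y \in gr (par x (+) par y).
Hypothesis fE : forall t, opg f (opm E t) = opm E (opg f t).

(** By [strace_value] this is the supertrace of [f] on the image of the idempotent [E], but computed
    in the standard basis and therefore additive in [E]. *)
Definition supertrace : G := \sum_x \sum_y (-1) ^+ par x * (mel E x y *: f y x).

Lemma fEm x y : \sum_z mel E z y *: f x z = \sum_z mel E x z *: f z y.
Proof.
pose d : {ffun X -> G} := [ffun z => (z == y)%:R].
have := congr1 (fun t : {ffun X -> G} => t x) (fE d); rewrite !ffunE.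
have dE (g : X -> F) : \sum_z g z *: d z = (g y)%:A.
  rewrite (bigD1 y) //= big1 ?addr0 ?ffunE ?eqxx // => z ny.
  by rewrite ffunE (negbTE ny) scaler0.
have dE' (g : X -> G) : \sum_z g z * d z = g y.
  rewrite (bigD1 y) //= big1 ?addr0 ?ffunE ?eqxx ?mulr1 // => z ny.
  by rewrite ffunE (negbTE ny) mulr0.
under eq_bigr do rewrite ffunE dE -scalerAr mulr1.
by under [RHS]eq_bigr do rewrite ffunE dE'.
Qed.

Lemma opm_homog e t : homog gr par e t -> homog gr par e (opm E t).
Proof.
move=> h x; rewrite ffunE; apply: gr_sum_in => y _.
have [->|/eqP ne] := par x =P par y; last by rewrite Epar // scale0r (gr0 hG).
by apply: (grZ hG).
Qed.

Section Value.
Variables (m : nat) (b : 'I_m -> {ffun X -> G}) (pi : 'I_m -> bool) (M : 'M[G]_m).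
Hypothesis bE : forall i, opm E (b i) = b i.
Hypothesis bhom : forall i, homog gr par (pi i) (b i).
Hypothesis gen : forall t, exists a, opm E t = lincomb b a.
Hypothesis free : forall a, lincomb b a = 0 -> forall i, a i = 0.
Hypothesis bM : forall j, opg f (b j) = lincomb b (fun i => M i j).

Let uniq a a' : lincomb b a = lincomb b a' -> forall i, a i = a' i.
Proof.
move=> e i; apply/eqP; rewrite -subr_eq0; apply/eqP; move: i; apply: free.
apply/ffunP => x; rewrite ffunE lincombE; move/ffunP/(_ x): e; rewrite !lincombE => e.
by rewrite (eq_bigr _ (fun i _ => mulrBr _ _ _)) sumrB e subrr.
Qed.

(** Independence of the basis. The coordinates [L] of the projected standard vectors are dual to
    [b], so [M] is [L f b]; moving [b] to the front by supercommutativity changes the sign of parity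
    [pi i] into that of [par y]. *)
Lemma strace_value : \sum_i (-1) ^+ pi i * M i i = supertrace.
Proof.
pose d y : {ffun X -> G} := [ffun z => (z == y)%:R].
have Ed x y : opm E (d y) x = (mel E x y)%:A.
  rewrite ffunE (bigD1 y) //= big1 ?addr0 ?ffunE ?eqxx // => z ny.
  by rewrite ffunE (negbTE ny) scaler0.
have [L LE] : exists L : X -> 'I_m -> G, forall y, opm E (d y) = lincomb b (L y).
  by have [L h] := boolp.choice (fun y => gen (d y)); exists L.
have BL x y : \sum_i b i x * L y i = (mel E x y)%:A by rewrite -Ed LE lincombE.
(* The part of [L y] of the wrong parity gives a vanishing combination of [b], hence is zero by
   freeness. *)
have Lhom y i : L y i \in gr (pi i (+) par y).
  have [L0 hL0] := boolp.choice (fun i => gr_split (pi i (+) par y) (L y i)).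
  have [L1 hL1] := boolp.choice hL0.
  suff -> : L y i = L0 i by have [] := hL1 i.
  have [_ _ ->] := hL1 i; rewrite [X in _ + X](_ : _ = 0) ?addr0 //.
  move: i; apply: free; apply/ffunP => x; rewrite lincombE ffunE.
  have g0 i : b i x * L0 i \in gr (par x (+) par y).
    have [h _ _] := hL1 i; rewrite -[par x](addbK (pi i)) -addbA.
    by apply: (grM hG) => //; apply: bhom.
  have g1 i : b i x * L1 i \in gr (~~ (par x (+) par y)).
    have [_ h _] := hL1 i; rewrite -[par x](addbK (pi i)) -addbA -addbN.
    by apply: (grM hG) => //; apply: bhom.
  apply: (@gr_add_eq0 (par x (+) par y) (\sum_i b i x * L0 i)); rewrite ?gr_sum_in //.
  rewrite -big_split /= (eq_bigr (fun i => b i x * L y i)) => [|i _]; last first.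
    by have [_ _ ->] := hL1 i; rewrite mulrDr.
  rewrite BL; have [->|/eqP ne] := par x =P par y; last by rewrite Epar // scale0r (gr0 hG).
  by rewrite addbb; apply: (grZ hG); apply: (gr1 hG).
have LB i j : \sum_x L x i * b j x = (i == j)%:R.
  move: i; apply: uniq; apply/ffunP => z; rewrite !lincombE.
  transitivity (opm E (b j) z).
    rewrite ffunE; under eq_bigr do rewrite mulr_sumr.
    rewrite exchange_big; apply: eq_bigr => x _.
    by under eq_bigr do rewrite mulrA; rewrite -mulr_suml BL -scalerAl mul1r.
  rewrite bE (bigD1 j) //= big1 ?addr0 ?eqxx ?mulr1 // => i ni.
  by rewrite (negbTE ni) mulr0.
have ME i j : M i j = \sum_x \sum_y L x i * f x y * b j y.
  transitivity (\sum_x L x i * opg f (b j) x).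
    rewrite bM; under eq_bigr do rewrite lincombE mulr_sumr.
    rewrite exchange_big /= (bigD1 i) //= [X in _ + X]big1 ?addr0 => [|k nk].
      by under eq_bigr do rewrite mulrA; rewrite -mulr_suml LB eqxx mul1r.
    by under eq_bigr do rewrite mulrA; rewrite -mulr_suml LB eq_sym (negbTE nk) mul0r.
  apply: eq_bigr => x _; rewrite ffunE mulr_sumr.
  by apply: eq_bigr => y _; rewrite mulrA.
rewrite /supertrace; transitivity (\sum_i \sum_y \sum_x (-1) ^+ par y * (b i y * (L x i * f x y))).
  apply: eq_bigr => i _; rewrite ME mulr_sumr; under eq_bigr do rewrite mulr_sumr.
  rewrite exchange_big /=; apply: eq_bigr => y _; apply: eq_bigr => x _.
  have h1 : L x i * f x y \in gr (pi i (+) par y).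
    by rewrite -[pi i](addbK (par x)) -addbA (grM hG).
  have h2 : b i y \in gr (par y (+) pi i) by apply: bhom.
  rewrite (gr_comm hG h1 h2).
  by case: (pi i); case: (par y); rewrite /= ?expr0 ?expr1 ?mulN1r ?opprK ?mul1r ?opprK.
rewrite exchange_big /=; apply: eq_bigr => y _; rewrite exchange_big /=.
apply: eq_bigr => x _; rewrite -mulr_sumr; congr (_ * _).
by under eq_bigr do rewrite mulrA; rewrite -mulr_suml BL -scalerAl mul1r.
Qed.
End Value.

Lemma idem_factor (r : nat) (D : 'M[F]_r) : D *m D = D ->
  row_base D *m col_base D = 1%:M.
Proof.
move=> DD; apply: (row_free_inj (row_base_free D)); rewrite mul1mx.
apply: (row_full_inj (col_base_full D)).
move: (col_base D) (row_base D) (mulmx_base D) => c r' e.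
by rewrite mulmxA (mulmxA c) e -mulmxA e DD.
Qed.

(** A homogeneous basis of the image exists with scalar coordinates: [E] commutes with the two
    parity projections, and each of its parts has a rank factorization over the field [F]. *)
Lemma homog_factor : exists m (b : 'I_m -> X -> F) (pi : 'I_m -> bool) (L : 'I_m -> X -> F),
  [/\ forall i x, par x != pi i -> b i x = 0,
      forall x y, \sum_i b i x * L i y = mel E x y &
      forall i j, \sum_x L i x * b j x = (i == j)%:R].
Proof.
pose P e : 'M[F]_#|X| := diag_mx (\row_k (par (enum_val k) == e)%:R).
have PE e x y : mel (P e *m E) x y = mel E x y *+ (par x == e).
  by rewrite /mel mul_diag_mx !mxE enum_rankK mulr_natl.
have EP e : P e *m E = E *m P e.
  apply: melP => x y; rewrite PE /mel mul_mx_diag !mxE enum_rankK mulr_natr.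
  rewrite -![E _ _]/(mel E x y); have [->|/eqP ne] := par x =P par y => //.
  by rewrite Epar // !mul0rn.
have PP e : P e *m P e = P e.
  apply/matrixP => i j; rewrite mul_diag_mx !mxE.
  by case: (_ == e); rewrite ?mul1r ?mul0r ?mul0rn.
have PP0 e e' : e != e' -> P e *m P e' = 0.
  move=> ne; apply/matrixP => i j; rewrite mul_diag_mx !mxE.
  have [->|_] := eqVneq i j; last by rewrite mulr0.
  by case: (par _) ne; case: e; case: e'; rewrite ?mul0r ?mulr0.
pose D e := P e *m E.
have DD e : D e *m D e = D e.
  by rewrite /D -mulmxA EP (mulmxA E E) [E *m E]EE -EP mulmxA PP.
have PD e : P e *m D e = D e by rewrite /D mulmxA PP.
have D0 e e' : e != e' -> D e *m D e' = 0.
  by move=> ne; rewrite /D EP -mulmxA (mulmxA (P e)) PP0 // mul0mx mulmx0.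
have [r [B [L [BL LB]]]] : exists (r : bool -> nat) (B : forall e, 'M[F]_(#|X|, r e))
    (L : forall e, 'M[F]_(r e, #|X|)), (forall e, B e *m L e = D e) /\ (forall e, L e *m B e = 1%:M).
  exists (fun e => \rank (D e)), (fun e => col_base (D e)), (fun e => row_base (D e)).
  by split=> e; [apply: mulmx_base | apply: idem_factor].
have LB0 e e' : e != e' -> L e *m B e' = 0.
  move=> ne; have := D0 _ _ ne; rewrite -!BL => h.
  have := congr1 (fun Z => L e *m Z *m B e') h.
  by rewrite mulmx0 mul0mx !mulmxA LB mul1mx -mulmxA LB mulmx1.
have Bpar e i x : par x != e -> B e (enum_rank x) i = 0.
  move=> ne; have -> : B e = P e *m B e.
    by rewrite -[B e in RHS]mulmx1 -(LB e) !mulmxA -(mulmxA (P e)) BL PD -BL -mulmxA LB mulmx1.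
  by rewrite mul_diag_mx !mxE enum_rankK (negbTE ne) mul0r.
pose BB := row_mx (B false) (B true); pose LL := col_mx (L false) (L true).
exists _, (fun i x => BB (enum_rank x) i), (fun i => if split i is inl _ then false else true),
  (fun i x => LL i (enum_rank x)).
split=> [i x||].
- by case: (split_ordP i) => k ->; rewrite ?unsplitK ?row_mxEl ?row_mxEr => h; rewrite Bpar.
- move=> x y; have : BB *m LL = E.
    rewrite mul_row_col !BL; apply: melP => u v; rewrite /mel mxE -![_ + _]/(mel (D false) u v + mel (D true) u v).
    by rewrite !PE; case: (par u); rewrite ?addr0 ?add0r.
  by move=> <-; rewrite /mel mxE.
have h : LL *m BB = 1%:M by rewrite mul_col_row !LB !LB0 // -scalar_mx_block.
move=> i j; have /matrixP/(_ i j) := h; rewrite !mxE => <-.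
rewrite (reindex (@enum_rank X)) //=.
by exists enum_val => ? _; rewrite ?enum_rankK ?enum_valK.
Qed.

Variable op : {ffun X -> G} -> {ffun X -> G}.
Hypothesis opE : forall t, op t = opg f t.

Lemma is_strace_range (W I : classical_sets.set {ffun X -> G}) :
  (forall w, W w <-> exists u, w = opm E u) -> (forall w, I w <-> w = 0) ->
  forall t : G, is_strace gr par W I op t <-> t = supertrace.
Proof.
move=> hW hI t; have EEt u : opm E (opm E u) = opm E u by rewrite -opmM EE.
split=> [[m [b [pi [M [[h1 h2 h3] h4 ->]]]]]|->].
  apply: (@strace_value _ b) => [i|i|u|a /hI|j].
  - by have [/hW[u ->] _] := h1 i; rewrite EEt.
  - by have [] := h1 i.
  - have [|a /hI/eqP] := h2 (opm E u); first by apply/hW; exists u.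
    by rewrite subr_eq0 => /eqP; exists a.
  - exact: h3.
  by have /hI/eqP := h4 j; rewrite subr_eq0 opE => /eqP.
have [m [b [pi [L [hb hE hL]]]]] := homog_factor.
pose B i : {ffun X -> G} := [ffun x => (b i x)%:A].
have Eb x i : \sum_y mel E x y * b i y = b i x.
  under eq_bigr do rewrite -hE mulr_suml.
  rewrite exchange_big /= (bigD1 i) //= [X in _ + X]big1 ?addr0 => [|j nj].
    by under eq_bigr do rewrite -mulrA; rewrite -mulr_sumr hL eqxx mulr1.
  by under eq_bigr do rewrite -mulrA; rewrite -mulr_sumr hL (negbTE nj) mulr0.
have EB i : opm E (B i) = B i.
  apply/ffunP => x; rewrite !ffunE; under eq_bigr do rewrite ffunE scalerA.
  by rewrite -scaler_suml Eb.
have bhom i : homog gr par (pi i) (B i).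
  move=> x; rewrite ffunE; have [->|/eqP ne] := par x =P pi i.
    by rewrite addbb; apply: (grZ hG); apply: (gr1 hG).
  by rewrite hb // scale0r (gr0 hG).
have gen u : opm E u = lincomb B (fun i => \sum_y L i y *: u y).
  apply/ffunP => x; rewrite lincombE ffunE.
  under eq_bigr do rewrite -hE scaler_suml.
  rewrite exchange_big; apply: eq_bigr => i _; rewrite mulr_sumr.
  by apply: eq_bigr => y _; rewrite ffunE -scalerA -scalerAl mul1r.
have free a : lincomb B a = 0 -> forall i, a i = 0.
  move=> h i; have {h} hx x : \sum_j b j x *: a j = 0.
    move/ffunP/(_ x): h; rewrite lincombE ffunE.
    by under eq_bigr do rewrite ffunE -scalerAl mul1r.
  have : \sum_x L i x *: (\sum_j b j x *: a j) = 0 by rewrite big1 // => x _; rewrite hx scaler0.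
  under eq_bigr do rewrite scaler_sumr.
  rewrite exchange_big /= (bigD1 i) //= [X in _ + X]big1 ?addr0 => [|j nj].
    by under eq_bigr do rewrite scalerA; rewrite -scaler_suml hL eqxx scale1r.
  by under eq_bigr do rewrite scalerA; rewrite -scaler_suml hL eq_sym (negbTE nj) scale0r.
pose M : 'M[G]_m := \matrix_(i, j) \sum_y L i y *: opg f (B j) y.
have bM j : opg f (B j) = lincomb B (fun i => M i j).
  rewrite -{1}EB fE gen; apply: eq_bigr => i _; congr rscale.
  by rewrite mxE.
exists m, B, pi, M; split; last 2 first.
- by move=> j; apply/hI; rewrite opE -bM subrr.
- by apply/esym/(@strace_value _ B) => // u; eexists; apply: gen.
split=> [i|w /hW[u ->]|a /hI]; last exact: free.
  by split; [apply/hW; exists (B i) | ].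
by exists (fun i => \sum_y L i y *: u y); apply/hI; rewrite -gen subrr.
Qed.

Lemma strace_range (W I : classical_sets.set {ffun X -> G}) :
  (forall w, W w <-> exists u, w = opm E u) -> (forall w, I w <-> w = 0) ->
  strace gr par W I op = supertrace.
Proof.
move=> hW hI; rewrite /strace; apply: (classical_sets.xget_unique 0).
  exact/(is_strace_range hW hI).
by move=> t /(is_strace_range hW hI).
Qed.

(** [E] identifies the quotient by its kernel with its image, compatibly with [op] and with parity,
    so both have the same supertraces. *)
Lemma strace_quotient (W I : classical_sets.set {ffun X -> G}) :
  (forall w, W w) -> (forall w, I w <-> opm E w = 0) ->
  strace gr par W I op = supertrace.
Proof.
move=> hW hI.
pose W' : classical_sets.set {ffun X -> G} := fun w => exists u, w = opm E u.
pose I' : classical_sets.set {ffun X -> G} := fun w => w = 0.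
have EEt u : opm E (opm E u) = opm E u by rewrite -opmM EE.
have H (t : G) : is_strace gr par W I op t <-> is_strace gr par W' I' op t.
  split=> -[m [b [pi [M [[h1 h2 h3] h4 ->]]]]].
    exists m, (fun i => opm E (b i)), pi, M; split=> //; last first.
      move=> j; rewrite /I' -opm_lincomb opE fE -opE -opmB; exact/hI.
    split=> [i|_ [u ->]|a h].
    - by split; [exists (b i) | apply: opm_homog; have [] := h1 i].
    - have [a /hI ha] := h2 u (hW u); exists a.
      by rewrite /I' -opm_lincomb -opmB.
    by apply: h3; apply/hI; rewrite opm_lincomb.
  have bE i : opm E (b i) = b i by have [[u ->] _] := h1 i; rewrite EEt.
  have lE a : opm E (lincomb b a) = lincomb b a.
    by rewrite opm_lincomb; apply: eq_bigr => i _; rewrite bE.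
  exists m, b, pi, M; split=> //; last first.
    move=> j; apply/hI; rewrite (h4 j : _ = 0).
    by apply/ffunP => x; rewrite !ffunE big1 // => y _; rewrite ffunE scaler0.
  split=> [i|w _|a /hI h].
  - by split; [apply: hW | have [] := h1 i].
  - have [a ha] := h2 (opm E w) (ex_intro _ w erefl); exists a.
    by apply/hI; rewrite opmB lE.
  by apply: h3; rewrite /I' -lE.
have HR (t : G) := @is_strace_range W' I' (fun w => iff_refl _) (fun w => iff_refl _) t.
rewrite /strace; apply: (classical_sets.xget_unique 0).
  exact/H/HR.
by move=> t /H/HR.
Qed.
End Matrix.
End Super.

(** * Tensor powers *)

(** Products of noncommuting homogeneous factors are easily reordered only by swapping neighbours,
    and the generators of [ext_ideal] involve only such swaps. *)
Lemma perm_adj_ind n (P : 'S_n -> Prop) : P 1%g ->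
  (forall s t, P s -> P t -> P (s * t)%g) ->
  (forall i j : 'I_n, j = i.+1 :> nat -> P (tperm i j)) -> forall s, P s.
Proof.
move=> P1 PM Padj.
have Pt (i j : 'I_n) : P (tperm i j).
  wlog ij : i j / (i <= j)%N.
    by move=> h; case: (leqP i j) => [|/ltnW] /h //; rewrite tpermC.
  elim/ltn_ind: {j}(j : nat) {-2}j (erefl (j : nat)) ij => m IH j ej ij.
  case: (ltnP i.+1 j) => [lt|le]; last first.
    case: (eqVneq i j) => [->|nij]; first by rewrite tperm1.
    by apply: Padj; apply/eqP; rewrite eqn_leq le ltn_neqAle ij nij.
  have lj : (j.-1 < n)%N by have := ltn_ord j; lia.
  pose k := Ordinal lj; have jk : j = k.+1 :> nat by rewrite /=; lia.
  have -> : tperm i j = (tperm i k ^ tperm k j)%g.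
    rewrite tpermJ tpermL tpermD //; apply/eqP => /(congr1 val) /=; lia.
  rewrite /conjg tpermV; apply: (PM); first exact: Padj.
  apply: (PM); last exact: Padj.
  apply: (IH k) => //=; lia.
move=> s; have [ts -> _] := prod_tpermP s.
by elim/big_rec: _ => // t s' _ IH; apply: PM.
Qed.

Lemma odd_sum_pairs n (h : 'I_n -> 'I_n -> bool) :
  odd (\sum_(s < n) \sum_(r < n | (r < s)%N) h r s)%N =
  \big[addb/false]_(u : 'I_n * 'I_n | (u.1 < u.2)%N) h u.1 u.2.
Proof.
rewrite (exchange_big_dep xpredT) //= pair_big_dep /= (big_morph odd oddD (erefl _)).
by apply: eq_bigr => u _; rewrite oddb.
Qed.

Lemma addb_pairs_adj n (h : 'I_n -> 'I_n -> bool) (i j : 'I_n) : j = i.+1 :> nat ->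
  \big[addb/false]_(u : 'I_n * 'I_n | (u.1 < u.2)%N) h (tperm i j u.1) (tperm i j u.2) =
  \big[addb/false]_(u : 'I_n * 'I_n | (u.1 < u.2)%N) h u.1 u.2 (+) h i j (+) h j i.
Proof.
move=> ij; rewrite (bigD1 (i, j)) /=; last by lia.
rewrite [in RHS](bigD1 (i, j)) /=; last by lia.
rewrite tpermL tpermR addbC; set X := \big[_/_]_(_ | _) _; set Y := \big[_/_]_(_ | _) _.
suff -> : X = Y by case: Y; case: (h i j); case: (h j i).
rewrite {}/X (reindex_inj (h := fun u => (tperm i j u.1, tperm i j u.2))) /=; last first.
  by move=> [a b] [a' b'] [/perm_inj-> /perm_inj->].
apply: eq_big => [[a b]|[a b] _]; rewrite /= ?tpermK // !xpair_eqE.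
have ne (a' b' : 'I_n) : a' <> b' -> a' <> b' :> nat by move=> h' /val_inj.
by case: tpermP => [->|->|/ne h1 /ne h2]; case: tpermP => [->|->|/ne h3 /ne h4];
  rewrite -!(inj_eq val_inj) /=; lia.
Qed.

Lemma odd_sinv_adj n (pi : 'I_n -> bool) (i j : 'I_n) : j = i.+1 :> nat ->
  odd (sinv (tperm i j) pi) = pi i && pi j.
Proof.
move=> ij; pose h (a b : 'I_n) := [&& (b < a)%N, pi (tperm i j a) & pi (tperm i j b)].
have := addb_pairs_adj h ij; rewrite odd_sinv [X in X (+) _ (+) _]big1 => [|u]; last first.
  by rewrite /h ltnNge => /negbTE h1; rewrite ltnNge [(u.1 <= u.2)%N](contraFT _ h1) // -ltnNge => /ltnW.
have lij : (i < j)%N by rewrite ij.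
have -> : h i j = false by rewrite /h ltnNge (ltnW lij).
have -> : h j i = pi i && pi j by rewrite /h lij tpermL tpermR.
rewrite addbF /=.
move=> <-; apply: eq_bigr => u lu; rewrite /h !tpermK lu.
have : tperm i j u.1 != tperm i j u.2.
  by apply: contraTneq lu => /perm_inj ->; rewrite ltnn.
rewrite -(inj_eq val_inj) /=; case: (pi u.1); case: (pi u.2); rewrite ?andbF ?andbT //=; by case: ltngtP.
Qed.

Section Tens.
Variables (F : fieldType) (G : unitAlgType F) (gr : bool -> {pred G}).
Hypothesis hG : supercommutative gr.

Lemma gr_prod (n : nat) (P : pred 'I_n) (e : 'I_n -> bool) (x : 'I_n -> G) :
  (forall r, P r -> x r \in gr (e r)) ->
  \prod_(r < n | P r) x r \in gr (\big[addb/false]_(r < n | P r) e r).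
Proof.
by move=> h; elim/big_rec2: _ => [|r a b Pr hab]; [apply: (gr1 hG) | apply: (grM hG) => //; apply: h].
Qed.

Lemma sign_comm (b : bool) (x : G) : x * (-1) ^+ b = (-1) ^+ b * x.
Proof. by case: b; rewrite ?expr0 ?mulr1 ?mul1r // expr1 mulrN1 mulN1r. Qed.

Lemma sign_commn (b : nat) (x : G) : x * (-1) ^+ b = (-1) ^+ b * x.
Proof. by rewrite -signr_odd sign_comm. Qed.

Lemma prod_adj n (e : 'I_n -> bool) (x : 'I_n -> G) (i j : 'I_n) : j = i.+1 :> nat ->
  (forall r, x r \in gr (e r)) ->
  \prod_r x (tperm i j r) = (-1) ^+ (e i && e j) * \prod_r x r.
Proof.
move=> ij hx; pose X m := if insub m is Some r then x r else 1.
pose Y m := if insub m is Some r then x (tperm i j r) else 1.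
have XE (r : 'I_n) : X r = x r by rewrite /X valK.
have YE (r : 'I_n) : Y r = x (tperm i j r) by rewrite /Y valK.
have -> : \prod_r x r = \prod_(0 <= m < n) X m by rewrite big_mkord; apply: eq_bigr.
have -> : \prod_r x (tperm i j r) = \prod_(0 <= m < n) Y m by rewrite big_mkord; apply: eq_bigr.
have hj : (i.+2 <= n)%N by rewrite -ij ltn_ord.
have Yo (m : nat) : m != i -> m != j -> Y m = X m.
  move=> h1 h2; rewrite /X /Y; case: insubP => // r _ em.
  by rewrite tpermD // -(inj_eq val_inj) em eq_sym.
have split Z : \prod_(0 <= m < n) Z m = \prod_(0 <= m < i) Z m * (Z i * Z j) * \prod_(i.+2 <= m < n) Z m :> G.
  rewrite (@big_cat_nat _ _ _ i) //=; last by lia.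
  rewrite (@big_cat_nat _ _ _ i.+2 i) //=; last by lia.
  by rewrite mulrA (@big_nat_recr _ _ _ i.+1 i) //= big_nat1 ij.
rewrite !split !XE !YE tpermL tpermR (gr_comm hG (hx j) (hx i)) andbC.
have -> : \prod_(0 <= m < i) Y m = \prod_(0 <= m < i) X m.
  by apply: eq_big_nat => m hm; apply: Yo; lia.
have -> : \prod_(i.+2 <= m < n) Y m = \prod_(i.+2 <= m < n) X m.
  by apply: eq_big_nat => m hm; apply: Yo; lia.
by rewrite !mulrA sign_comm.
Qed.

Variables (p q N : nat).
Local Notation word := (tidx p q N).
Local Notation tens e v := (@tens G p q N e v).

Lemma perm_opE s (t : tensor G p q N) K :
  perm_op s t K = (-1) ^+ odd (sinv s (wpar (wperm K s))) * t (wperm K s).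
Proof. by rewrite ffunE signr_odd. Qed.

Lemma perm_op_opm s (t : tensor G p q N) : perm_op s t = opm (@wrep p q N F s) t.
Proof.
apply/ffunP => K; rewrite [RHS]ffunE (bigD1 (wperm K s)) //= [X in _ = _ + X]big1 => [|J nJ].
  rewrite addr0 wrepE eqxx mulr1n -signr_odd scaler_sign -mulr_sign signr_odd.
  by rewrite ffunE.
by rewrite wrepE (negbTE nJ) scale0r.
Qed.

(** Makes the sign conventions of [tens] and [perm_op] match: the second term of a generator of
    [ext_ideal] is the first one permuted. *)
Lemma perm_op_tens e v (i j : 'I_N) : j = i.+1 :> nat -> (forall r, vhomog gr (e r) (v r)) ->
  perm_op (tperm i j) (tens e v) =
  rscale (tens (fun r => e (tperm i j r)) (fun r => v (tperm i j r))) ((-1) ^+ (e i && e j)).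
Proof.
move=> ij hv; apply/ffunP => K; rewrite perm_op_opm ffunE.
set s := tperm i j; rewrite (bigD1 (wperm K s)) //= big1 ?addr0 => [|J nJ]; last first.
  by rewrite wrepE (negbTE nJ) scale0r.
rewrite wrepE eqxx mulr1n !ffunE -signr_odd scaler_sign -mulr_sign.
rewrite sign_comm -[X in _ = _ * (X * _)]signr_odd -[X in _ * (X * _) = _]signr_odd.
rewrite !(odd_sum_pairs (fun r s => _ && _)).
pose h r t := (e r (+) vpar (K (s r))) && vpar (K (s t)).
rewrite (eq_bigr (fun u => h u.1 u.2)) => [|u _]; last by rewrite !ffunE.
have := addb_pairs_adj h ij; rewrite -/s.
rewrite (eq_bigr (fun u => (e (s u.1) (+) vpar (K u.1)) && vpar (K u.2))) => [->|u _]; last first.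
  by rewrite /h !tpermK.
have -> : \prod_r v r (wperm K s r) 0 = (-1) ^+ ((e i (+) vpar (K j)) && (e j (+) vpar (K i))) *
     \prod_r v (s r) (K r) 0.
  pose x r := v (s r) (K r) 0.
  transitivity (\prod_r x (s r)); first by apply: eq_bigr => r _; rewrite /x tpermK ffunE.
  rewrite (prod_adj (e := fun r => vpar (K r) (+) e (s r)) ij) /=; last first.
    by move=> r; apply: hv.
  by rewrite tpermL tpermR andbC ![vpar _ (+) _]addbC.
rewrite !mulrA -!signr_addb; congr (_ ^+ nat_of_bool _ * _).
rewrite (odd_sinv_adj _ ij) /wpar !ffunE; move: (\big[_/_]_(_ | _) _) => B.
rewrite /h /s tpermL tpermR; case: B; case: (vpar (K i)); case: (vpar (K j)); by case: (e i); case: (e j).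
Qed.

Lemma gr_swap_prod n e (f : 'I_n -> bool) x (y : 'I_n -> G) : x \in gr e ->
  (forall r, y r \in gr (f r)) ->
  x * \prod_r y r = (-1) ^+ (\sum_r (e && f r))%N * (\prod_r y r * x).
Proof.
move=> hx hy; elim/big_rec2: _ => [|r m y1 _ IH]; first by rewrite mulr1 mul1r mul1r.
rewrite mulrA (gr_comm hG hx (hy r)) -!mulrA IH !mulrA exprD -!mulrA; congr (_ * _).
by rewrite mulrA sign_commn !mulrA.
Qed.

(** The sign records each [y r] passing the factors [x s] with [r < s]. *)
Lemma prod_shuffle n (e f : 'I_n -> bool) (x y : 'I_n -> G) :
  (forall r, x r \in gr (e r)) -> (forall r, y r \in gr (f r)) ->
  \prod_r x r * \prod_r y r =
  (-1) ^+ (\sum_(s < n) \sum_(r < n | (r < s)%N) (f r && e s))%N * \prod_r (x r * y r).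
Proof.
elim: n e f x y => [|n IH] e f x y hx hy; first by rewrite !big_ord0 !mul1r.
rewrite !(big_ord_recr n) /=.
rewrite -!mulrA [x ord_max * _]mulrA.
rewrite (gr_swap_prod (f := fun r => f (widen_ord (leqnSn n) r)) (hx _)) //.
rewrite -!mulrA [X in X = _]mulrA sign_commn -!mulrA.
rewrite [\prod_(i < n) x _ * _]mulrA (IH (fun r => e (widen_ord (leqnSn n) r))
   (fun r => f (widen_ord (leqnSn n) r))) // !mulrA -exprD; congr (_ ^+ _ * _ * _ * _).
rewrite addnC; congr (_ + _)%N.
  apply: eq_bigr => s _; rewrite [RHS]big_mkcond big_ord_recr /= ltnNge ltnW ?ltn_ord //= addn0.
  by rewrite -big_mkcond.
rewrite [RHS]big_mkcond big_ord_recr /= ltnn addn0.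
by apply: eq_bigr => r _; rewrite ltn_ord andbC.
Qed.

Lemma prod_zero n (x : 'I_n -> G) r : x r = 0 -> \prod_r x r = 0.
Proof.
elim: n x r => [|n IH] x r h; first by case: r h.
rewrite big_ord_recl; case: (unliftP ord0 r) h => [r' ->|->] h; last by rewrite h mul0r.
by rewrite (IH _ r') ?mulr0.
Qed.

Definition tfun (A : 'M[G]_(p + q)) (I J : word) : G :=
  tens (fun r => vpar (J r)) (fun r => col (J r) A) I.

Lemma tens_opE A (t : tensor G p q N) : tens_op A t = opg (tfun A) t.
Proof.
apply/ffunP => I; rewrite sum_ffunE ffunE; apply: eq_bigr => J _.
by rewrite ffunE.
Qed.

Lemma tfunE A I J : tfun A I J =
  (-1) ^+ (\sum_(s < N) \sum_(r < N | (r < s)%N) ((vpar (J r) (+) vpar (I r)) && vpar (I s)))%N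
  * \prod_r A (I r) (J r).
Proof. by rewrite /tfun ffunE; congr (_ * _); apply: eq_bigr => r _; rewrite mxE. Qed.

Lemma tparD (I J : word) :
  \big[addb/false]_(r < N) (vpar (I r) (+) vpar (J r)) = tpar I (+) tpar J.
Proof. exact: big_split. Qed.

Lemma tfun_par A I J : even_mx gr A -> tfun A I J \in gr (tpar I (+) tpar J).
Proof.
move=> hA; rewrite tfunE -signr_odd; apply: gr_sign => //; rewrite -tparD.
by apply: gr_prod => r _; apply: hA.
Qed.

(** Functoriality of the tensor power: the products of entries are interleaved by [prod_shuffle],
    and the signs agree for each pair of places separately. *)
Lemma tfunM A B I K : even_mx gr A -> even_mx gr B ->
  tfun (A *m B) I K = \sum_J tfun A I J * tfun B J K.
Proof.
move=> hA hB; rewrite tfunE.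
under [X in _ * X = _]eq_bigr do rewrite mxE.
rewrite bigA_distr_bigA mulr_sumr; apply: eq_bigr => J _.
rewrite !tfunE mulrA -[X in _ = X * _]mulrA sign_commn -!mulrA.
rewrite (prod_shuffle (e := fun r => vpar (I r) (+) vpar (J r))
   (f := fun r => vpar (J r) (+) vpar (K r))) //.
rewrite !mulrA -!exprD; congr (_ * _).
rewrite -signr_odd -[RHS]signr_odd; congr (_ ^+ nat_of_bool _).
rewrite !oddD !(odd_sum_pairs (fun r s => _ && _)) -!big_split /=.
apply: eq_bigr => u _.
by case: (vpar (I u.1)); case: (vpar (J u.1)); case: (vpar (K u.1)); case: (vpar (I u.2)); case: (vpar (J u.2)).
Qed.

Lemma tfun1 I J : tfun 1%:M I J = (I == J)%:R.
Proof.
rewrite tfunE; have [->|nIJ] := eqVneq I J.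
  rewrite !big1 ?mul1r // => [r _|r _]; first by rewrite mxE eqxx.
  by rewrite big1 // => s _; rewrite addbb.
have [r nr] : exists r, I r != J r.
  by apply/existsP; apply: contraNT nIJ => /existsPn h; apply/eqP/ffunP => r; apply/eqP/negPn.
by rewrite (prod_zero (r := r)) ?mulr0 // mxE (negbTE nr).
Qed.

Lemma perm_opM s s' (t : tensor G p q N) : perm_op s (perm_op s' t) = perm_op (s' * s)%g t.
Proof. by rewrite !perm_op_opm -opmM -(wrepP _ _ _ _).2. Qed.

Lemma perm_op1 (t : tensor G p q N) : perm_op 1 t = t.
Proof.
rewrite perm_op_opm (wrepP _ _ _ _).1; apply/ffunP => I; rewrite ffunE (bigD1 I) //=.
rewrite big1 ?addr0 => [|J nJ]; rewrite /mel mxE (inj_eq enum_rank_inj) ?eqxx ?scale1r //.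
by rewrite eq_sym (negbTE nJ) scale0r.
Qed.

Lemma vhomog_col (A : 'M[G]_(p + q)) j : even_mx gr A -> vhomog gr (vpar j) (col j A).
Proof. by move=> hA i; rewrite mxE. Qed.

Lemma perm_op_adj (i j : 'I_N) (t : tensor G p q N) (J : word) : j = i.+1 :> nat ->
  perm_op (tperm i j) t (wperm J (tperm i j)) = (-1) ^+ (vpar (J i) && vpar (J j)) * t J.
Proof.
by move=> ij; rewrite perm_opE wpermM tperm2 wperm1 odd_sinv_adj.
Qed.

Lemma tens_op_perm (A : 'M[G]_(p + q)) s (t : tensor G p q N) : even_mx gr A ->
  tens_op A (perm_op s t) = perm_op s (tens_op A t).
Proof.
move=> hA; elim/perm_adj_ind: s t => [t|s s' IH IH' t|i j ij t].
- by rewrite !perm_op1.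
- by rewrite -!perm_opM IH' IH.
rewrite [tens_op A t]/tens_op [RHS]perm_op_opm opm_sum /tens_op.
rewrite (reindex (fun J => wperm J (tperm i j))) /=; last first.
  by exists (fun k => wperm k (tperm i j)) => k _; rewrite wpermM tperm2 wperm1.
apply: eq_bigr => J _; rewrite perm_op_adj // opmZ -perm_op_opm (perm_op_tens ij) => [|r]; last first.
  exact: vhomog_col.
apply/ffunP => I; rewrite !ffunE -!mulrA; congr (_ ^+ _ * (_ * (_ * _))).
- by apply: eq_bigr => b _; apply: eq_bigr => a _; rewrite ffunE.
by apply: eq_bigr => r _; rewrite !mxE ffunE.
Qed.

Lemma tens_op1 (t : tensor G p q N) : tens_op 1%:M t = t.
Proof.
rewrite tens_opE; apply/ffunP => I; rewrite ffunE (bigD1 I) //= tfun1 eqxx mul1r.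
by rewrite big1 ?addr0 // => J nJ; rewrite tfun1 eq_sym (negbTE nJ) mul0r.
Qed.

Lemma even_mx1 : even_mx gr (1%:M : 'M[G]_(p + q)).
Proof.
move=> i j; rewrite mxE; have [->|_] := eqVneq i j; last exact: (gr0 hG).
by rewrite addbb; apply: (gr1 hG).
Qed.

Lemma ext_ideal_sum I (r : seq I) (P : pred I) (t : I -> tensor G p q N) :
  (forall i, P i -> ext_ideal gr (t i)) -> ext_ideal gr (\sum_(i <- r | P i) t i).
Proof. by move=> h; elim/big_ind: _ => //; [exact: ExtIdeal0 | exact: ExtIdealD]. Qed.

(** Modulo the ideal a permutation acts by its sign. For neighbours, expand [t] over the standard
    words: the difference becomes a combination of generators. *)
Lemma ext_ideal_perm s (t : tensor G p q N) :
  ext_ideal gr (t - rscale (perm_op s t) ((-1) ^+ odd_perm s)).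
Proof.
elim/perm_adj_ind: s t => [t|s s' IH IH' t|i j ij t].
- rewrite perm_op1 odd_perm1 (_ : _ - _ = 0); first exact: ExtIdeal0.
  by apply/ffunP => I; rewrite !ffunE mulr1 subrr.
- have := ExtIdealD (IH t) (ExtIdealZ ((-1) ^+ odd_perm s) (IH' (perm_op s t))).
  rewrite perm_opM odd_permM; congr ext_ideal; apply/ffunP => I; rewrite !ffunE.
  by rewrite signr_addb mulrBl addrACA addrA addrK -mulrA -[(-1) ^+ s * _]sign_comm; congr (_ + _).
rewrite -[t](tens_op1 t) perm_op_opm opm_sum.
have -> : odd_perm (tperm i j) by rewrite odd_tperm -(inj_eq val_inj) /= ij; lia.
rewrite -[X in ext_ideal _ X](_ : \sum_(J : word) rscale
   (tens (fun r => vpar (J r)) (fun r => col (J r) 1%:M) + perm_op (tperm i j)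
   (tens (fun r => vpar (J r)) (fun r => col (J r) 1%:M))) (t J) = _); last first.
  apply/ffunP => I; rewrite !ffunE !sum_ffunE mulrN1 opprK -big_split.
  by apply: eq_bigr => J _; rewrite opmZ -perm_op_opm [LHS]ffunE [X in X * _]ffunE mulrDl ![rscale _ _ _]ffunE.
apply: ext_ideal_sum => J _; apply: ExtIdealZ.
have hv r : vhomog gr (vpar (J r)) (col (J r) (1%:M : 'M[G]_(p + q))).
  by apply: vhomog_col; apply: even_mx1.
by rewrite (perm_op_tens ij hv); apply: ExtIdealGen.
Qed.
End Tens.

(** * Exterior and Young traces as combinations of permuted supertraces *)

Section Traces.
Variables (F : numFieldType) (G : unitAlgType F) (gr : bool -> {pred G}).
Hypothesis hG : supercommutative gr.
Variables (p q : nat) (A : 'M[G]_(p + q)).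
Hypothesis hA : even_mx gr A.

Section Word.
Variable N : nat.
Local Notation word := (tidx p q N).
Local Notation mat := 'M[F]_(#|word|).
Local Notation wrepF := (@wrep p q N F).

Definition intertwiner (E : mat) : Prop :=
  (forall x y, tpar x != tpar y -> mel E x y = 0) /\
  (forall t, opg (tfun A) (opm E t) = opm E (opg (tfun A) t)).

Lemma opm_sumM I (r : seq I) (P : pred I) (E : I -> mat) (t : tensor G p q N) :
  opm (\sum_(i <- r | P i) E i) t = \sum_(i <- r | P i) opm (E i) t.
Proof.
apply/ffunP => x; rewrite sum_ffunE ffunE.
under eq_bigr do rewrite mel_sum scaler_suml.
by rewrite exchange_big; apply: eq_bigr => i _; rewrite ffunE.
Qed.

Lemma melZ (c : F) (E : mat) x y : mel (c *: E) x y = c * mel E x y.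
Proof. by rewrite /mel mxE. Qed.

Lemma opm_scale (c : F) (E : mat) (t : tensor G p q N) :
  opm (c *: E) t = rscale (opm E t) c%:A.
Proof.
apply/ffunP => x; rewrite !ffunE mulr_suml; apply: eq_bigr => y _.
by rewrite melZ -scalerAr mulr1 scalerA.
Qed.

Lemma opm_sign (b : bool) (E : mat) (t : tensor G p q N) :
  opm ((-1) ^+ b * E) t = rscale (opm E t) ((-1) ^+ b).
Proof.
apply/ffunP => x; rewrite !ffunE mulr_suml; apply: eq_bigr => y _.
by rewrite mel_sign; case: b; [rewrite !expr1 mulN1r mulrN1 scaleNr | rewrite !expr0 mul1r mulr1].
Qed.

Lemma intertwiner_wrep s : intertwiner (wrepF s).
Proof.
split=> [x y ne|t]; last by rewrite -!perm_op_opm -!tens_opE (tens_op_perm hG).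
by rewrite wrepE; case: eqP => // e; rewrite e tpar_wperm eqxx in ne.
Qed.

Lemma intertwinerM E E' : intertwiner E -> intertwiner E' -> intertwiner (E * E').
Proof.
move=> [h1 h2] [h1' h2']; split=> [x y ne|t]; last by rewrite !opmM h2 h2'.
rewrite melM big1 // => z _; have [e|ne'] := eqVneq (tpar x) (tpar z).
  by rewrite h1' ?mulr0 // -e.
by rewrite h1 ?mul0r.
Qed.

Lemma intertwiner_sum I (r : seq I) (P : pred I) (E : I -> mat) :
  (forall i, P i -> intertwiner (E i)) -> intertwiner (\sum_(i <- r | P i) E i).
Proof.
move=> h; elim/big_rec: _ => [|i E' Pi [h1' h2']].
  split=> [x y _|t]; first by rewrite /mel mxE.
  have z u : opm (0 : mat) u = 0 :> tensor G p q N.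
    by apply/ffunP => x; rewrite !ffunE big1 // => y _; rewrite /mel mxE scale0r.
  rewrite !z; apply/ffunP => x; rewrite !ffunE big1 // => y _; by rewrite ffunE mulr0.
have [h1 h2] := h _ Pi; split=> [x y ne|t].
  by rewrite /mel mxE -![_ (enum_rank x) _]/(mel _ _ _) h1 // h1' // addr0.
have D u : opm (E i + E') u = opm (E i) u + opm E' u :> tensor G p q N.
  apply/ffunP => x; rewrite !ffunE -big_split; apply: eq_bigr => y _.
  by rewrite /mel mxE scalerDl.
rewrite !D -h2 -h2'; apply/ffunP => x; rewrite !ffunE -big_split.
by apply: eq_bigr => y _; rewrite ffunE mulrDr.
Qed.

Lemma intertwinerZ (c : F) E : intertwiner E -> intertwiner (c *: E).
Proof.
by move=> [h1 h2]; split=> [x y ne|t]; rewrite ?melZ ?h1 ?mulr0 // !opm_scale opgZ h2.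
Qed.

Lemma intertwiner_sign (b : bool) E : intertwiner E -> intertwiner ((-1) ^+ b * E).
Proof.
by move=> [h1 h2]; split=> [x y ne|t]; rewrite ?mel_sign ?h1 ?mulr0 // !opm_sign opgZ h2.
Qed.

Lemma intertwiner_rsym r (row : 'I_N -> 'I_r) : intertwiner (rsym row wrepF).
Proof. by apply: intertwiner_sum => s _; apply: intertwiner_wrep. Qed.

Lemma intertwiner_calt r (col : 'I_N -> 'I_r) : intertwiner (calt col wrepF).
Proof.
by apply: intertwiner_sum => s _; apply: intertwiner_sign; apply: intertwiner_wrep.
Qed.

Definition trs (s : 'S_N) : G := supertrace (@tpar p q N) (wrepF s) (tfun A).

Lemma supertrace_sum I (r : seq I) (P : pred I) (E : I -> mat) :
  supertrace (@tpar p q N) (\sum_(i <- r | P i) E i) (tfun A) =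
  \sum_(i <- r | P i) supertrace (@tpar p q N) (E i) (tfun A).
Proof.
rewrite /supertrace [RHS]exchange_big; apply: eq_bigr => x _ /=.
rewrite [RHS]exchange_big; apply: eq_bigr => y _ /=.
by rewrite mel_sum scaler_suml mulr_sumr.
Qed.

Lemma supertraceZ (c : F) (E : mat) :
  supertrace (@tpar p q N) (c *: E) (tfun A) = c *: supertrace (@tpar p q N) E (tfun A).
Proof.
rewrite /supertrace scaler_sumr; apply: eq_bigr => x _ /=.
rewrite scaler_sumr; apply: eq_bigr => y _ /=.
by rewrite melZ -scalerA scalerAr.
Qed.

Lemma supertrace_sign (b : bool) (E : mat) :
  supertrace (@tpar p q N) ((-1) ^+ b * E) (tfun A) =
  (-1) ^+ b * supertrace (@tpar p q N) E (tfun A).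
Proof.
rewrite /supertrace mulr_sumr; apply: eq_bigr => x _ /=.
rewrite mulr_sumr; apply: eq_bigr => y _ /=.
by rewrite mel_sign; case: b; [rewrite !expr1 !mulN1r scaleNr mulrN | rewrite !expr0 !mul1r].
Qed.

Let asum : mat := calt (fun _ : 'I_N => @ord0 0) wrepF.

Let asum_wrep s : asum * wrepF s = (-1) ^+ odd_perm s * asum.
Proof. by apply: calt_mulr; [apply: wrepP | apply/fstabP]. Qed.

Let asum_sqr : asum * asum = (N`!)%:R *: asum.
Proof.
rewrite {2}/asum /calt mulr_sumr.
rewrite (eq_bigr (fun _ => asum)) => [|s _]; last first.
  have -> : asum * ((-1) ^+ odd_perm s * wrepF s) = (-1) ^+ odd_perm s * (asum * wrepF s).
    by case: (odd_perm s); rewrite ?expr0 ?mul1r // expr1 !mulN1r mulrN.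
  by rewrite asum_wrep mulrA -expr2 sqrr_sign mul1r.
rewrite sumr_const scaler_nat; congr (_ *+ _); rewrite -card_Sn.
by apply: eq_card => s; rewrite /= [LHS](introT (fstabP _ _)).
Qed.

Let nfact : (N`!)%:R != 0 :> F. Proof. by rewrite pnatr_eq0 -lt0n fact_gt0. Qed.

(** Generators are fixed by a transposition, so the antisymmetrizer kills them. Conversely, summing
    [ext_ideal_perm] over all permutations puts [N!] times [t] minus its antisymmetrization in the
    ideal, and [N!] is invertible. *)
Lemma ext_ideal_ker (t : tensor G p q N) : ext_ideal gr t <-> opm asum t = 0.
Proof.
split=> [|h].
  elim=> [|s t' _ IH _ IH'|t' a _ IH|e v i j ij hv].
  - by apply/ffunP => x; rewrite !ffunE big1 // => y _; rewrite ffunE scaler0.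
  - by rewrite opmD IH IH' addr0.
  - by rewrite opmZ IH; apply/ffunP => x; rewrite !ffunE mul0r.
  rewrite -(perm_op_tens hG ij hv) perm_op_opm opmD -opmM asum_wrep.
  have -> : odd_perm (tperm i j) by rewrite odd_tperm -(inj_eq val_inj) /= ij; lia.
  by rewrite opm_sign; apply/ffunP => x; rewrite !ffunE mulrN1 subrr.
have hS : ext_ideal gr (\sum_(s : 'S_N) (t - rscale (perm_op s t) ((-1) ^+ odd_perm s))).
  by apply: ext_ideal_sum => s _; apply: ext_ideal_perm.
have := ExtIdealZ (((N`!)%:R)^-1)%:A hS.
congr ext_ideal; rewrite sumrB sumr_const.
rewrite [X in _ - X](_ : _ = opm asum t); last first.
  rewrite opm_sumM [RHS]big_mkcond; apply: eq_bigr => s _ /=.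
  by rewrite (introT (fstabP _ _)) // opm_sign perm_op_opm.
rewrite h subr0; apply/ffunP => x; rewrite !ffunE card_Sn -scalerAr mulr1 ffunMnE.
by rewrite -scaler_nat scalerA mulVf ?scale1r.
Qed.

Lemma strace_ext :
  strace gr (@tpar p q N) (@classical_sets.setT _) (ext_ideal (k := N) gr) (@tens_op G p q A N) =
  (N`!%:R)^-1 *: \sum_(s : 'S_N) (-1) ^+ odd_perm s * trs s.
Proof.
pose E : mat := (N`!%:R)^-1 *: asum.
have EE : E * E = E.
  by rewrite -[E * E]/(E *m E) /E -scalemxAl -scalemxAr [asum *m asum]asum_sqr !scalerA -mulrA mulVf // mulr1.
have [h1 h2] := intertwinerZ (N`!%:R)^-1 (intertwiner_calt (fun _ : 'I_N => @ord0 0)).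
rewrite (strace_quotient hG EE h1 (f := tfun A)) //; last first.
- move=> w; rewrite ext_ideal_ker opm_scale; split=> [->|/ffunP h].
    by apply/ffunP => x; rewrite !ffunE mul0r.
  apply/ffunP => x; have := h x; rewrite [in LHS]ffunE -scalerAr mulr1 => e.
  by rewrite -[LHS]scale1r -(mulfV nfact) -scalerA e !ffunE scaler0.
- by move=> u; rewrite tens_opE.
- by move=> x y; apply: tfun_par.
rewrite supertraceZ supertrace_sum [in LHS]big_mkcond; congr (_ *: _); apply: eq_bigr => s _ /=.
by rewrite (introT (fstabP _ _)) // supertrace_sign.
Qed.

(** Division by [kappa] makes the symmetrizer idempotent without changing its image. *)
Lemma strace_young r c (row : 'I_N -> 'I_r) (col : 'I_N -> 'I_c) (rc : rect_cells row col)
    (W I : classical_sets.set (tensor G p q N)) :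
  (forall w, W w <-> exists u : tensor G p q N, w = \sum_(a in fstab row) \sum_(b in fstab col)
    rscale (perm_op a (perm_op b u)) ((-1) ^+ odd_perm b)) ->
  (forall w, I w <-> w = 0) ->
  strace gr (@tpar p q N) W I (@tens_op G p q A N) =
  ((kappa rc)%:~R)^-1 *: \sum_(a in fstab row) \sum_(b in fstab col)
    (-1) ^+ odd_perm b * trs (b * a)%g.
Proof.
move=> hW hI; have k0 : (kappa rc)%:~R != 0 :> F by rewrite intr_eq0 kappa_neq0.
pose Y : mat := rsym row wrepF * calt col wrepF.
have YY : Y * Y = (kappa rc)%:~R *: Y.
  by rewrite scaler_int; apply: rsym_calt_sqr; [apply: wrepP | apply: mulmx2_eq0].
have YE : Y = \sum_(a in fstab row) \sum_(b in fstab col) (-1) ^+ odd_perm b * wrepF (b * a)%g.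
  rewrite /Y /rsym /calt mulr_suml; apply: eq_bigr => a _; rewrite mulr_sumr.
  apply: eq_bigr => b _; rewrite (wrepP _ _ _ _).2.
  by case: (odd_perm b); rewrite ?expr0 ?mul1r // expr1 !mulN1r mulrN.
have hY u : opm Y u = \sum_(a in fstab row) \sum_(b in fstab col)
    rscale (perm_op a (perm_op b u)) ((-1) ^+ odd_perm b) :> tensor G p q N.
  rewrite YE opm_sumM; apply: eq_bigr => a _; rewrite opm_sumM; apply: eq_bigr => b _.
  by rewrite opm_sign perm_opM perm_op_opm.
pose E : mat := ((kappa rc)%:~R)^-1 *: Y.
have EE : E * E = E.
  by rewrite -[E * E]/(E *m E) /E -scalemxAl -scalemxAr [Y *m Y]YY !scalerA -mulrA mulVf // mulr1.
have [h1 h2] := intertwinerZ ((kappa rc)%:~R)^-1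
  (intertwinerM (intertwiner_rsym row) (intertwiner_calt col)).
rewrite (strace_range hG EE h1 (f := tfun A)) //.
- rewrite supertraceZ YE supertrace_sum; congr (_ *: _); apply: eq_bigr => a _.
  by rewrite supertrace_sum; apply: eq_bigr => b _; rewrite supertrace_sign.
- by move=> x y; apply: tfun_par.
- by move=> u; rewrite tens_opE.
move=> w; rewrite hW; split=> -[u ->].
  exists (rscale u ((kappa rc)%:~R)%:A); rewrite -hY opm_scale opmZ.
  by apply/ffunP => x; rewrite !ffunE -!scalerAr !mulr1 scalerA mulVf // scale1r.
exists (rscale u ((kappa rc)%:~R)^-1%:A); rewrite -hY opm_scale opmZ.
by apply/ffunP => x; rewrite !ffunE.
Qed.
End Word.
End Traces.

(** * The even part *)

Section EvenPart.
Variables (F : numFieldType) (G : unitAlgType F) (gr : bool -> {pred G}).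

(** A type of its own lets the even elements carry a commutative unit ring structure; that structure
    depends on [hG], which is therefore a parameter. *)
Record even_part (hG : supercommutative gr) := EvenPart {
  eval :> G;
  evalP : eval \in gr false
}.
Variable hG : supercommutative gr.
Local Notation G0 := (even_part hG).

HB.instance Definition _ := [isSub for @eval hG].
HB.instance Definition _ := [Choice of G0 by <:].

Fact even_subring : subring_closed (gr false).
Proof.
split=> [|x y hx hy|x y hx hy]; first exact: (gr1 hG).
  by apply: (grD hG) => //; apply: (gr_opp hG).
exact: (grM hG hx hy).
Qed.
HB.instance Definition _ := GRing.SubChoice_isSubNzRing.Build G (gr false) G0 even_subring.

Fact even_mulC : commutative (@GRing.mul G0).
Proof.
move=> x y; apply: val_inj; rewrite !rmorphM /=.
by rewrite (gr_comm hG (evalP x) (evalP y)) mul1r.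
Qed.
HB.instance Definition _ := GRing.PzRing_hasCommutativeMul.Build G0 even_mulC.

(** [x] times the odd part of its inverse is the odd part of [1], hence zero, and [x] can be
    cancelled. *)
Lemma even_inv (x : G) : x \in gr false -> x^-1 \in gr false.
Proof.
move=> hx; case: (boolP (x \is a GRing.unit)) => [ux|/invr_out->] //.
have [y0 [y1 [h0 h1 e]]] := gr_sum hG x^-1.
suff y10 : y1 = 0 by rewrite e y10 addr0.
apply: (mulrI ux); rewrite mulr0.
have h1' : x * y0 \in gr false by apply: (grM hG hx h0).
apply: (gr_add_eq0 hG h1'); first exact: (grM hG hx h1).
by rewrite -mulrDr -e mulrV //; apply: (gr1 hG).
Qed.

Fact even_divring : divring_closed (gr false).
Proof.
have [h1 h2 h3] := even_subring.
by split=> // x y hx hy; apply: h3 => //; apply: even_inv.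
Qed.
HB.instance Definition _ := GRing.SubNzRing_isSubUnitRing.Build G (gr false) G0 even_divring.

Definition even_scalar (a : F) : G0 := EvenPart hG (grZ hG a (gr1 hG)).

Fact even_scalar_zmod : zmod_morphism even_scalar.
Proof. by move=> a b; apply: val_inj; rewrite rmorphB /= scalerBl. Qed.
Fact even_scalar_monoid : monoid_morphism even_scalar.
Proof.
split=> [|a b]; apply: val_inj; first by rewrite rmorph1 /= scale1r.
by rewrite rmorphM /= -scalerAl mul1r scalerA.
Qed.
HB.instance Definition _ := GRing.isZmodMorphism.Build F G0 even_scalar even_scalar_zmod.
HB.instance Definition _ := GRing.isMonoidMorphism.Build F G0 even_scalar even_scalar_monoid.

Definition dn (x : G) : G0 := insubd 0 x.

Lemma dnK x : x \in gr false -> val (dn x) = x.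
Proof. by move=> hx; rewrite /dn val_insubd hx. Qed.

Lemma unit_even (x : G0) : (val x \is a GRing.unit) = (x \is a GRing.unit).
Proof.
apply/idP/idP => [ux|]; last exact: (rmorph_unit (val : {rmorphism G0 -> G})).
have hv := even_inv (evalP x).
have e := dnK hv; apply/unitrP; exists (dn (eval x)^-1).
split; apply: val_inj; rewrite rmorphM rmorph1 /=.
  by rewrite -[X in X * _]/(val (dn (eval x)^-1)) e mulVr.
by rewrite -[X in _ * X]/(val (dn (eval x)^-1)) e mulrV.
Qed.
End EvenPart.

Section Nilpotent.
Variable K : comUnitRingType.
Implicit Types x y : K.

Definition nilp x := exists n, x ^+ n = 0.

Lemma nilpM x y : nilp x -> nilp (x * y).
Proof. by move=> [n h]; exists n; rewrite exprMn h mul0r. Qed.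

Lemma nilpD x y : nilp x -> nilp y -> nilp (x + y).
Proof.
move=> [n hn] [m hm]; exists (n + m)%N; rewrite exprDn big1 // => i _.
have [le|lt] := leqP i m; last by rewrite -(subnKC (ltnW lt)) exprD hm mul0r mulr0 mul0rn.
by rewrite -addnBA // exprD hn !mul0r mul0rn.
Qed.

Lemma nilp0 : nilp 0.
Proof. by exists 1%N. Qed.

Lemma nilp_sum I (r : seq I) (P : pred I) (f : I -> K) :
  (forall i, P i -> nilp (f i)) -> nilp (\sum_(i <- r | P i) f i).
Proof. by move=> h; elim/big_ind: _ => //; [exact: nilp0 | exact: nilpD]. Qed.

Lemma nilp_subM x y x' y' : nilp (x - x') -> nilp (y - y') -> nilp (x * y - x' * y').
Proof.
move=> hx hy; rewrite (_ : _ - _ = (x - x') * y + (y - y') * x'); last by ring.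
by apply: nilpD; apply: nilpM.
Qed.

Lemma nilp_sub_prod I (r : seq I) (P : pred I) (f g : I -> K) :
  (forall i, P i -> nilp (f i - g i)) ->
  nilp (\prod_(i <- r | P i) f i - \prod_(i <- r | P i) g i).
Proof.
move=> h; elim/big_rec2: _ => [|i x y Pi hxy]; first by rewrite subrr; apply: nilp0.
by apply: nilp_subM => //; apply: h.
Qed.

Lemma nilp_sub_det n (A B : 'M[K]_n) :
  (forall i j, nilp (A i j - B i j)) -> nilp (\det A - \det B).
Proof.
move=> h; rewrite /determinant -sumrB; apply: nilp_sum => s _.
rewrite -mulrBr mulrC; apply: nilpM; apply: nilp_sub_prod => i _; exact: h.
Qed.

(** A finite geometric series in the nilpotent [1 - y / x] inverts [y / x]. *)
Lemma unit_sub_nilp x y : nilp (x - y) -> x \is a GRing.unit -> y \is a GRing.unit.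
Proof.
move=> [n hn] ux; have := subrX1 ((x - y) / x) n.
rewrite exprMn hn mul0r sub0r => /esym; set S := \sum_(i < n) _.
have -> : (x - y) / x = 1 - y / x by rewrite mulrBl divrr.
rewrite (_ : 1 - y / x - 1 = - (y / x)); last by ring.
rewrite mulNr => /oppr_inj e; have : y / x * S \is a GRing.unit by rewrite e unitr1.
by rewrite !unitrM => /andP[/andP[]].
Qed.
End Nilpotent.

(** * Reduction to block triangular matrices *)

Section SuperTraces.
Variables (F : numClosedFieldType) (G : unitAlgType F) (gr : bool -> {pred G}).
Variable hG : supercommutative gr.
Local Notation G0 := (even_part hG).

Lemma odd_sqr0 x : x \in gr true -> x * x = 0.
Proof.
move=> hx; have := gr_comm hG hx hx; rewrite expr1 mulN1r => /eqP.
rewrite -addr_eq0 -mulr2n -scaler_nat => /eqP h.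
have n2 : (2%:R : F) != 0 by rewrite pnatr_eq0.
by rewrite -[LHS]scale1r -(mulVf n2) -scalerA h scaler0.
Qed.

(** Moving one copy of the odd factor [x r] to the other produces its square; the homogeneous [y] in
    between is what the induction needs. *)
Lemma prod_sqr0 n (e : 'I_n -> bool) (x : 'I_n -> G) r f y :
  (forall r, x r \in gr (e r)) -> e r = true -> y \in gr f ->
  \prod_r x r * y * \prod_r x r = 0.
Proof.
elim: n e x r f y => [|n IH] e x r f y hx er hy; first by case: r er.
rewrite !big_ord_recl; case: (unliftP ord0 r) er => [r' ->|->] er.
  have := IH (e \o lift ord0) (x \o lift ord0) r' _ _ _ er (grM hG hy (hx ord0)).
  by move=> /(_ (fun r => hx (lift ord0 r))) h; rewrite -!mulrA !(mulrA _ y) !(mulrA _ (x ord0)) in h *; rewrite h mulr0.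
set P := \prod_(i < n) _.
have hP : P \in gr (\big[addb/false]_(r < n) e (lift ord0 r)).
  by apply: (gr_prod hG) => i _; apply: hx.
have hx0 := hx ord0; rewrite er in hx0.
have hPy := grM hG hP hy.
have -> : x ord0 * P * y * (x ord0 * P) = x ord0 * (P * y * x ord0 * P) by rewrite !mulrA.
rewrite (gr_comm hG hPy hx0); case: (_ && _); rewrite ?expr0 ?mul1r ?expr1 ?mulN1r ?mulNr ?mulrN;
  by rewrite -!mulrA mulrA (odd_sqr0 hx0) mul0r ?oppr0.
Qed.

Variables (p q : nat).
Implicit Types A B : 'M[G]_(p + q).

Definition mxa A : 'M[G0]_p := \matrix_(i, j) dn hG (A (lshift q i) (lshift q j)).
Definition mxd A : 'M[G0]_q := \matrix_(i, j) dn hG (A (rshift p i) (rshift p j)).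

Section Word.
Variable N : nat.
Local Notation word := (tidx p q N).
Implicit Types (s : 'S_N) (J : word).

Lemma trsE A s : trs A s =
  \sum_(J : word) (-1) ^+ (tpar J + sinv s (wpar (wperm J s))) * tfun A (wperm J s) J.
Proof.
apply: eq_bigr => J _; rewrite (bigD1 (wperm J s)) //= big1 ?addr0 => [|K nK]; last first.
  by rewrite wrepE (negbTE nK) scale0r mulr0.
rewrite wrepE eqxx mulr1n exprD -mulrA; congr (_ * _).
by rewrite -signr_odd scaler_sign -mulr_sign signr_odd.
Qed.

Lemma trs_even A s : even_mx gr A -> trs A s \in gr false.
Proof.
move=> hA; rewrite trsE; apply: (gr_sum_in hG) => J _.
rewrite -signr_odd; apply: (gr_sign hG).
by have := tfun_par hG (wperm J s) J hA; rewrite tpar_wperm addbb.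
Qed.

Lemma val_bdiag A i j : even_mx gr A -> vpar i = vpar j ->
  val (bdiag (mxa A) (mxd A) i j) = A i j.
Proof.
move=> hA; case: (split_ordP i) => i' ->; case: (split_ordP j) => j' ->;
  rewrite ?vpar_lshift ?vpar_rshift // => _.
  rewrite block_mxEul mxE dnK //; have := hA (lshift q i') (lshift q j').
  by rewrite !vpar_lshift.
rewrite block_mxEdr mxE dnK //; have := hA (rshift p i') (rshift p j').
by rewrite !vpar_rshift.
Qed.

Lemma bdiag_off (K : comNzRingType) (a : 'M[K]_p) (d : 'M[K]_q) i j :
  vpar i != vpar j -> bdiag a d i j = 0.
Proof.
by case: (split_ordP i) => i' ->; case: (split_ordP j) => j' ->;
  rewrite ?vpar_lshift ?vpar_rshift // ?block_mxEur ?block_mxEdl mxE.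
Qed.

Let wt_term (K : comNzRingType) (B : 'M[K]_(p + q)) s J : K :=
  (-1) ^+ (tpar J + sinv s (wpar J)) * \prod_r B (J (s r)) (J r).

Lemma trs_term A s J : even_mx gr A -> (forall r, vpar (J (s r)) = vpar (J r)) ->
  (-1) ^+ (tpar J + sinv s (wpar (wperm J s))) * tfun A (wperm J s) J =
  val (wt_term (bdiag (mxa A) (mxd A)) s J).
Proof.
move=> hA hJ; rewrite rmorphM rmorphXn rmorphN1 (@eq_sinv _ s _ (wpar J)); last first.
  by move=> r; rewrite /wpar ffunE hJ.
congr (_ * _); rewrite tfunE big1 => [|r _]; last first.
  by rewrite big1 // => r' _; rewrite ffunE hJ addbb.
rewrite mul1r rmorph_prod; apply: eq_bigr => r _.
by rewrite /= ffunE -[LHS]val_bdiag.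
Qed.

(** Words whose parities are preserved by [s] contribute the same to both sides. The term of any
    other word contains an odd entry of [A], so its square is zero. *)
Lemma trs_nilp A s : even_mx gr A -> nilp (dn hG (trs A s) - wtr (bdiag (mxa A) (mxd A)) s).
Proof.
move=> hA; have hT J : (-1) ^+ (tpar J + sinv s (wpar (wperm J s))) * tfun A (wperm J s) J \in gr false.
  rewrite -signr_odd; apply: (gr_sign hG).
  by have := tfun_par hG (wperm J s) J hA; rewrite tpar_wperm addbb.
have -> : dn hG (trs A s) = \sum_(J : word) dn hG ((-1) ^+ (tpar J + sinv s (wpar (wperm J s))) * tfun A (wperm J s) J).
  apply: val_inj; rewrite dnK ?trs_even // trsE rmorph_sum; apply: eq_bigr => J _.
  by apply: esym; apply: dnK.
rewrite -sumrB; apply: nilp_sum => J _.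
have [/forallP h|/forallPn[r /negbTE nr]] := boolP [forall r, vpar (J (s r)) == vpar (J r)].
  have {}h r : vpar (J (s r)) = vpar (J r) by apply: (eqP (h r)).
  rewrite trs_term // [X in X - _](_ : _ = wt_term (bdiag (mxa A) (mxd A)) s J) ?subrr; first exact: nilp0.
  by apply: val_inj; rewrite dnK //; apply: evalP.
rewrite (bigD1 r) //= bdiag_off ?nr // mul0r mulr0 subr0; exists 2%N.
have eD := dnK hG (hT J); apply: val_inj; rewrite rmorph0 expr2.
have -> (z : G0) : val (z * z) = val z * val z by apply: rmorphM.
rewrite eD tfunE.
set u := (-1) ^+ _; set v := (-1) ^+ _; set P := \prod_(_ < _) _.
have PP : P * P = 0.
  have := @prod_sqr0 N (fun r => vpar (J (s r)) (+) vpar (J r)) (fun r => A (wperm J s r) (J r)) r false 1.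
  rewrite mulr1; apply; last exact: (gr1 hG).
    by move=> r'; rewrite ffunE; apply: hA.
  by move: nr; case: (vpar _); case: (vpar _).
have cv z : z * v = v * z by rewrite sign_commn.
have cu z : z * u = u * z by rewrite sign_commn.
move: PP cv cu; clearbody u v P => {}nr cv cu.
rewrite [LHS](_ : _ = u * v * (P * u * v) * P); last by rewrite !mulrA.
by rewrite (cu P) -(mulrA u P v) (cv P) -!mulrA nr !mulr0.
Qed.

(** Permuting a word keeps its number of odd letters, so if [s] changes parities, some entry in the
    term has an even row and an odd column: it lies in the block that vanishes. *)
Lemma trs_lower A s : even_mx gr A -> ursubmx A = 0 ->
  trs A s = val (wtr (bdiag (mxa A) (mxd A)) s).
Proof.
move=> hA A0; rewrite trsE rmorph_sum; apply: eq_bigr => J _.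
have [/forallP h|/forallPn[r nr]] := boolP [forall r, vpar (J (s r)) == vpar (J r)].
  by apply: trs_term => // r; exact: (eqP (h r)).
have -> : \prod_r bdiag (mxa A) (mxd A) (J (s r)) (J r) = 0 :> G0.
  by rewrite (bigD1 r) //= bdiag_off // mul0r.
rewrite mulr0 rmorph0.
have [r' hr'] : exists r', ~~ vpar (J (s r')) && vpar (J r').
  apply/existsP; apply: contraNT nr => /existsPn h.
  have sub : [set r | wpar J r] \subset s @^-1: [set r | wpar J r].
    by apply/subsetP => k; rewrite !inE /wpar => hk; have := h k; rewrite hk andbT negbK.
  have /eqP e : [set r | wpar J r] == s @^-1: [set r | wpar J r].
    by rewrite eqEcard sub card_preimset ?leqnn //; apply: perm_inj.
  by have /setP/(_ r) := e; rewrite !inE /wpar => ->.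
rewrite tfunE (prod_zero (r := r')) ?mulr0 //.
rewrite ffunE; move: hr'; case: (split_ordP (J (s r'))) => i ->; case: (split_ordP (J r')) => j ->;
  rewrite ?vpar_lshift ?vpar_rshift // => _.
by move/matrixP/(_ i j): A0; rewrite !mxE.
Qed.

(** Cyclicity of the supertrace: [h] moves to the front, with the sign that turns [tpar I] into
    [tpar L], then past [s], which it intertwines, and there it meets [g]. *)
Lemma trs_conj A g h s : even_mx gr A -> even_mx gr g -> even_mx gr h ->
  h *m g = 1%:M -> trs (g *m A *m h) s = trs A s.
Proof.
move=> hA hg hh hgE.
have hgA : even_mx gr (g *m A).
  move=> i j; rewrite mxE; apply: (gr_sum_in hG) => k _.
  by rewrite -[vpar i](addbK (vpar k)) -addbA (grM hG).
pose w := mel (@wrep p q N F s).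
have H1 I J : tfun (g *m A *m h) J I = \sum_K \sum_L tfun g J K * tfun A K L * tfun h L I :> G.
  rewrite (tfunM hG) // exchange_big; apply: eq_bigr => L _.
  by rewrite (tfunM hG) // mulr_suml.
rewrite /trs /supertrace.
transitivity (\sum_I \sum_J \sum_L \sum_K (-1) ^+ tpar L * ((w I J *: tfun h L I) * tfun g J K * tfun A K L)).
  apply: eq_bigr => I _; apply: eq_bigr => J _; rewrite -/(w I J).
  rewrite H1 exchange_big scaler_sumr mulr_sumr; apply: eq_bigr => L _.
  rewrite scaler_sumr mulr_sumr; apply: eq_bigr => K _.
  have [eIJ|neIJ] := eqVneq (tpar I) (tpar J); last first.
    have [h1 _] := intertwiner_wrep hG hA s.
    by rewrite /w h1 // !scale0r !mul0r !mulr0.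
  have h1 : tfun g J K * tfun A K L \in gr (tpar J (+) tpar L).
    by rewrite -[tpar J](addbK (tpar K)) -addbA (grM hG) // (tfun_par hG).
  rewrite (gr_comm hG h1 (tfun_par hG L I hh)) eIJ -!scalerAl -[tfun h L I * _ * _]mulrA.
  move: (tfun h L I * _) => Z; case: (tpar J); case: (tpar L);
    by rewrite /= ?expr0 ?expr1 ?mul1r ?mulN1r ?scalerN ?opprK.
transitivity (\sum_L \sum_J \sum_K (-1) ^+ tpar L * ((\sum_I w I J *: tfun h L I) * tfun g J K * tfun A K L)).
  rewrite exchange_big /=; under eq_bigr do rewrite exchange_big /=.
  rewrite exchange_big /=; apply: eq_bigr => L _; apply: eq_bigr => J _.
  rewrite exchange_big /=; apply: eq_bigr => K _.
  by rewrite -mulr_sumr !mulr_suml.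
apply: eq_bigr => L _.
have H2 J : \sum_I w I J *: tfun h L I = \sum_I w L I *: tfun h I J :> G.
  by apply: (fEm (fun t => (intertwiner_wrep hG hh s).2 t)).
under eq_bigr do (under eq_bigr do rewrite H2).
transitivity (\sum_K \sum_I (-1) ^+ tpar L * (w L I *: (\sum_J tfun h I J * tfun g J K) * tfun A K L)).
  rewrite exchange_big; apply: eq_bigr => K _; rewrite -!mulr_sumr; congr (_ * _).
  rewrite -!mulr_suml; congr (_ * _).
  under eq_bigr do rewrite mulr_suml; rewrite exchange_big; apply: eq_bigr => I _ /=.
  by rewrite scaler_sumr; apply: eq_bigr => J _; rewrite scalerAl.
rewrite exchange_big; apply: eq_bigr => I _ /=; rewrite -mulr_sumr; congr (_ * _).
have E K : w L I *: (\sum_J tfun h I J * tfun g J K) * tfun A K L =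
    (w L I *: tfun A I L) *+ (I == K).
  rewrite -(tfunM hG) // hgE tfun1; case: eqP => [->|_]; last by rewrite scaler0 mul0r.
  by rewrite -scalerAl mul1r.
rewrite (eq_bigr _ (fun K _ => E K)) (bigD1 I) //= eqxx big1 ?addr0 // => K nK.
by rewrite eq_sym (negbTE nK).
Qed.
End Word.
End SuperTraces.

(** * Determinants and odd rectangular matrices *)

Lemma det_row_sub (K : comNzRingType) n (P P' : 'M[K]_n) i (w : 'I_n -> K) :
  (forall k m, P' k m = P k m - w m *+ (k == i)) ->
  \det P' = \det P - \sum_m w m * \adj P m i.
Proof.
move=> h; rewrite (expand_det_row P' i) (expand_det_row P i) -sumrB.
apply: eq_bigr => k _; have -> : cofactor P' i k = cofactor P i k.
  rewrite /cofactor; congr (_ * \det _); apply/matrixP => r s.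
  by rewrite !mxE h eq_sym (negbTE (neq_lift _ _)) subr0.
by rewrite h eqxx mulr1n mulrBl [\adj P k i]mxE.
Qed.

Lemma det_col_sub (K : comNzRingType) n (P P' : 'M[K]_n) j (w : 'I_n -> K) :
  (forall k m, P' k m = P k m - w k *+ (m == j)) ->
  \det P' = \det P - \sum_k \adj P j k * w k.
Proof.
move=> h; rewrite -[\det P']det_tr -[\det P]det_tr (@det_row_sub _ _ P^T _ j w) => [|k m].
  by congr (_ - _); apply: eq_bigr => k _; rewrite -trmx_adj mxE mulrC.
by rewrite !mxE h.
Qed.

Section OddDet.
Variables (F : numClosedFieldType) (G : unitAlgType F) (gr : bool -> {pred G}).
Variable hG : supercommutative gr.
Local Notation G0 := (even_part hG).
Local Notation valm := (val : {rmorphism G0 -> G}).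

Definition mxin (e : bool) m n (X : 'M[G]_(m, n)) : Prop := forall i j, X i j \in gr e.
Definition mval m n (M : 'M[G0]_(m, n)) : 'M[G]_(m, n) := map_mx (val : G0 -> G) M.
Definition mdn m n (X : 'M[G]_(m, n)) : 'M[G0]_(m, n) := map_mx (dn hG) X.

Lemma mvalE m n (M : 'M[G0]_(m, n)) i j : mval M i j = val (M i j).
Proof. by rewrite mxE. Qed.

Lemma mdnK m n (X : 'M[G]_(m, n)) : mxin false X -> mval (mdn X) = X.
Proof. by move=> h; apply/matrixP => i j; rewrite !mxE dnK. Qed.

Lemma mvalK m n (M : 'M[G0]_(m, n)) : mdn (mval M) = M.
Proof. by apply/matrixP => i j; rewrite !mxE; apply: val_inj; rewrite dnK // evalP. Qed.

Lemma mval_even m n (M : 'M[G0]_(m, n)) : mxin false (mval M).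
Proof. by move=> i j; rewrite mxE; apply: evalP. Qed.

Lemma mvalM m n r (M : 'M[G0]_(m, n)) (M' : 'M[G0]_(n, r)) : mval (M *m M') = mval M *m mval M'.
Proof. exact: (map_mxM valm). Qed.

Lemma mval1 n : mval (1%:M : 'M_n) = 1%:M.
Proof. exact: (map_mx1 valm). Qed.

Lemma mvalB m n (M M' : 'M[G0]_(m, n)) : mval (M - M') = mval M - mval M'.
Proof. exact: (map_mxB valm). Qed.

Lemma det_mval n (M : 'M[G0]_n) : \det (mval M) = val (\det M).
Proof. exact: (det_map_mx valm). Qed.

Lemma mxinM e f m n r (X : 'M[G]_(m, n)) (Y : 'M[G]_(n, r)) :
  mxin e X -> mxin f Y -> mxin (e (+) f) (X *m Y).
Proof.
by move=> hX hY i j; rewrite mxE; apply: (gr_sum_in hG) => k _; apply: (grM hG).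
Qed.

Lemma mxinN e m n (X : 'M[G]_(m, n)) : mxin e X -> mxin e (- X).
Proof. by move=> hX i j; rewrite mxE; apply: (gr_opp hG). Qed.

Lemma mxin1 n : mxin false (1%:M : 'M_n).
Proof. by rewrite -mval1; apply: mval_even. Qed.

Lemma even_central (u : G0) (x : G) : val u * x = x * val u.
Proof.
have [x0 [x1 [h0 h1 ->]]] := gr_sum hG x; rewrite mulrDl mulrDr.
by rewrite (gr_comm hG (evalP u) h0) (gr_comm hG (evalP u) h1) !mul1r.
Qed.

Variables (p q : nat).

(* Adding an entry to [X] is a rank-one update in both factors; the two corrections cancel
   by [\det Q *: (Y *m \adj P) = \det P *: (\adj Q *m Y)]. *)
Lemma det_odd (X : 'M[G]_(p, q)) (Y : 'M[G]_(q, p)) : mxin true X -> mxin true Y ->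
  \det (1%:M - mdn (X *m Y)) * \det (1%:M - mdn (Y *m X)) = 1.
Proof.
move=> hX hY.
have [l hl] : exists l : seq ('I_p * 'I_q), forall i j, (i, j) \notin l -> X i j = 0.
  by exists (enum {: 'I_p * 'I_q}) => i j; rewrite mem_enum.
elim: l X hX hl => [|[i j] l IH] X hX hl.
  have -> : X = 0 by apply/matrixP => i j; rewrite mxE; apply: hl.
  have z n : mdn (0 : 'M_n) = 0.
    have -> : (0 : 'M[G]_n) = mval 0 by apply/matrixP => i j; rewrite !mxE rmorph0.
    exact: mvalK.
  by rewrite mul0mx mulmx0 !z !subr0 !det1 mulr1.
have [lij|nij] := boolP ((i, j) \in l).
  apply: IH => // i' j' h; apply: hl; rewrite inE negb_or h andbT.
  by apply: contraNneq h => ->.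
pose x := X i j; pose X' : 'M[G]_(p, q) := \matrix_(k, m) (X k m *+ ((k, m) != (i, j))).
have hX' : mxin true X' by move=> k m; rewrite mxE; case: (_ != _); [apply: hX | apply: (gr0 hG)].
have {IH} := IH X' hX' _; set P := 1%:M - mdn (X' *m Y); set Q := 1%:M - mdn (Y *m X').
have hx : x \in gr true by apply: hX.
have XE k m : X k m = X' k m + x *+ ((k == i) && (m == j)).
  rewrite mxE xpair_eqE; case: eqP => [->|_]; case: eqP => [->|_] //=; rewrite ?addr0 //.
  by rewrite add0r.
move=> IH; have {}IH : \det P * \det Q = 1.
  apply: IH => k m nl; rewrite mxE; case: eqP => //= e; apply: hl.
  by rewrite inE negb_or nl andbT; apply/eqP.
have eP : mval P = 1%:M - X' *m Y.
  by rewrite mvalB mval1 mdnK //; apply: (mxinM hX' hY).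
have eQ : mval Q = 1%:M - Y *m X'.
  by rewrite mvalB mval1 mdnK //; apply: (mxinM hY hX').
pose al := (Y *m mval (\adj P)) j i; pose be := (mval (\adj Q) *m Y) j i.
have hal : al \in gr true by apply: (mxinM hY (mval_even _)).
have vu : val (\det Q) * al = val (\det P) * be.
  have QY : mval Q *m Y = Y *m mval P by rewrite eP eQ mulmxBl mulmxBr mul1mx mulmx1 mulmxA.
  have : mval (\adj Q) *m (mval Q *m Y) *m mval (\adj P) = mval (\adj Q) *m (Y *m mval P) *m mval (\adj P).
    by rewrite QY.
  rewrite mulmxA -mvalM mul_adj_mx -!mulmxA -mvalM mul_mx_adj => /matrixP/(_ j i).
  have eS n (u : G0) : mval (u%:M : 'M_n) = (val u)%:M by exact: (map_scalar_mx valm).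
  rewrite !eS mul_scalar_mx mxE mulmxA [X in _ = X](_ : _ = val (\det P) * be); first by [].
  rewrite even_central /be -[LHS]/((mval (\adj Q) *m Y *m (val (\det P))%:M) j i).
  move: (mval (\adj Q) *m Y) => Z.
  rewrite mxE (bigD1 i) //= mxE eqxx mulr1n big1 ?addr0 // => k nk.
  by rewrite mxE (negbTE nk) mulr0n mulr0.
set P2 := 1%:M - mdn (X *m Y); set Q2 := 1%:M - mdn (Y *m X).
have eP2 k m : P2 k m = P k m - dn hG (x * Y j m) *+ (k == i).
  have hxY : x * Y j m \in gr false by apply: (grM hG hx (hY _ _)).
  have : mval P2 k m = mval P k m - (x * Y j m) *+ (k == i).
    rewrite eP mvalB mval1 mdnK; last by apply: (mxinM hX hY).
    rewrite !mxE -addrA; congr (_ + _); rewrite -opprD; congr (- _).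
    rewrite (eq_bigr (fun n => X' k n * Y n m + (x *+ ((k == i) && (n == j))) * Y n m)) => [|n _]; last first.
      by rewrite XE mulrDl.
    rewrite big_split /=; congr (_ + _); rewrite (bigD1 j) //= big1 => [|n nn].
      by rewrite eqxx andbT addr0 mulrnAl.
    by rewrite (negbTE nn) andbF mul0r.
  by move=> h; apply: val_inj; rewrite rmorphB rmorphMn /= (dnK hG hxY); move: h; rewrite !mxE.
have eQ2 k m : Q2 k m = Q k m - dn hG (Y k i * x) *+ (m == j).
  have hxY : Y k i * x \in gr false by apply: (grM hG (hY _ _) hx).
  have : mval Q2 k m = mval Q k m - (Y k i * x) *+ (m == j).
    rewrite eQ mvalB mval1 mdnK; last by apply: (mxinM hY hX).
    rewrite !mxE -addrA; congr (_ + _); rewrite -opprD; congr (- _).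
    rewrite (eq_bigr (fun n => Y k n * X' n m + Y k n * (x *+ ((n == i) && (m == j))))) => [|n _]; last first.
      by rewrite XE mulrDr.
    rewrite big_split /=; congr (_ + _); rewrite (bigD1 i) //= big1 => [|n nn].
      by rewrite eqxx addr0 mulrnAr.
    by rewrite (negbTE nn) mulr0.
  by move=> h; apply: val_inj; rewrite rmorphB rmorphMn /= (dnK hG hxY); move: h; rewrite !mxE.
have vsum (I : finType) (f : I -> G0) : val (\sum_k f k) = \sum_k val (f k).
  exact: (rmorph_sum valm).
have vmul (u v : G0) : val (u * v) = val u * val v.
  exact: (rmorphM valm).
have dP : val (\det P2) = val (\det P) - x * al.
  rewrite (det_row_sub eP2) [LHS](rmorphB valm); congr (_ - _).
  rewrite [LHS]vsum /al mxE mulr_sumr; apply: eq_bigr => k _.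
  by rewrite vmul (dnK hG (grM hG hx (hY _ _))) -mulrA mvalE.
have dQ : val (\det Q2) = val (\det Q) + x * be.
  rewrite (det_col_sub eQ2) [LHS](rmorphB valm); congr (_ + _).
  rewrite [X in - X]vsum /be mxE mulr_sumr -sumrN; apply: eq_bigr => k _.
  rewrite vmul (dnK hG (grM hG (hY _ _) hx)) mvalE even_central.
  by rewrite (gr_comm hG (hY k i) hx) expr1 mulN1r mulNr opprK -mulrA even_central.
apply: val_inj; rewrite vmul dP dQ [RHS](rmorph1 valm).
have hbe : be \in gr true by apply: (mxinM (mval_even _) hY).
have PQ : val (\det P) * val (\det Q) = 1 by rewrite -vmul IH; apply: (rmorph1 valm).
(* Both corrections contain the odd [x], so their product vanishes; the first-order terms cancel by
   [vu]. *)
have xx : x * al * (x * be) = 0.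
  rewrite mulrA -(mulrA x) (gr_comm hG hal hx) expr1 mulN1r mulrN mulrA.
  by rewrite (odd_sqr0 hG hx) !(mul0r, oppr0).
rewrite mulrBl !mulrDr xx addr0 PQ.
have -> : val (\det P) * (x * be) = x * (val (\det P) * be) by rewrite mulrA even_central mulrA.
by rewrite -vu -(mulrA x) (even_central (\det Q)) addrK.
Qed.
End OddDet.

(** * The Sylvester and Riccati equations *)

Lemma mxhorner_char_poly (K : comNzRingType) n (d : 'M[K]_n) :
  mxhorner n.+1 d (char_poly d) = 0.
Proof.
case: n d => [|n] d; first by apply/matrixP => -[].
rewrite -[RHS](Cayley_Hamilton d) /mxhorner.
have s := size_char_poly d; move: (char_poly d) s => P sP.
rewrite -[P in RHS]coefK poly_def raddf_sum /= sP; apply: eq_bigr => k _.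
rewrite linearZ /= rmorphXn /= horner_mx_X; congr (_ *: _).
by elim: (k : nat) => [|m IH] //=; rewrite exprS -IH.
Qed.

Section Filtration.
Variables (F : numClosedFieldType) (G : unitAlgType F) (gr : bool -> {pred G}).
Variable hG : supercommutative gr.
Local Notation G0 := (even_part hG).
Local Notation valm := (val : {rmorphism G0 -> G}).

(* Elements of parity [e] that are sums of products containing at least [k] factors
   taken from the list [ts] of odd elements. *)
Fixpoint fil (ts : seq G) (e : bool) (k : nat) (x : G) : Prop :=
  if ts is t :: ts' then
    exists u v, [/\ fil ts' e k u, fil ts' (~~ e) k.-1 v & x = u + v * t]
  else x \in gr e /\ ((0 < k)%N -> x = 0).

Section List.
Implicit Types (ts : seq G).
Let odds ts := forall t, t \in ts -> t \in gr true.

Let odds_cons t ts : odds (t :: ts) -> t \in gr true /\ odds ts.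
Proof. by move=> h; split=> [|u hu]; apply: h; rewrite inE ?eqxx ?hu ?orbT. Qed.

Lemma fil_gr ts e k x : odds ts -> fil ts e k x -> x \in gr e.
Proof.
elim: ts e k x => [|t ts IH] e k x; first by move=> _ [].
move=> /odds_cons[ht /IH{}IH] [u [v [hu hv ->]]]; apply: (grD hG); first exact: IH hu.
by have := grM hG (IH _ _ _ hv) ht; rewrite addbT negbK.
Qed.

Lemma fil_zero ts e k : fil ts e k 0.
Proof.
elim: ts e k => [|t ts IH] e k /=; first by split=> //; apply: (gr0 hG).
by exists 0, 0; rewrite mul0r addr0.
Qed.

Lemma fil0 ts e x : x \in gr e -> fil ts e 0 x.
Proof.
elim: ts e x => [|t ts IH] e x hx //=; exists x, 0.
by split; [apply: IH | apply: fil_zero | rewrite mul0r addr0].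
Qed.

Lemma filD ts e k x y : fil ts e k x -> fil ts e k y -> fil ts e k (x + y).
Proof.
elim: ts e k x y => [|t ts IH] e k x y /=.
  move=> [hx hx'] [hy hy']; split; first exact: (grD hG).
  by move=> k0; rewrite hx' // hy' // addr0.
move=> [u [v [hu hv ->]]] [u' [v' [hu' hv' ->]]]; exists (u + u'), (v + v').
by split; [apply: IH | apply: IH | rewrite mulrDl addrACA].
Qed.

Lemma filN ts e k x : fil ts e k x -> fil ts e k (- x).
Proof.
elim: ts e k x => [|t ts IH] e k x /=.
  move=> [hx hx']; split; first exact: (gr_opp hG).
  by move=> k0; rewrite hx' // oppr0.
move=> [u [v [hu hv ->]]]; exists (- u), (- v).
by split; [apply: IH | apply: IH | rewrite mulNr opprD].
Qed.

Lemma fil_pred ts e k x : fil ts e k x -> fil ts e k.-1 x.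
Proof.
elim: ts e k x => [|t ts IH] e k x /=.
  by move=> [hx hx']; split=> // k0; apply: hx'; lia.
move=> [u [v [hu hv ->]]]; exists u, v.
by split; [apply: IH | apply: IH | ].
Qed.

Lemma filM ts e f k l x y : odds ts ->
  fil ts e k x -> fil ts f l y -> fil ts (e (+) f) (k + l) (x * y).
Proof.
elim: ts e f k l x y => [|t ts IH] e f k l x y /=.
  move=> _ [hx hx'] [hy hy']; split; first exact: (grM hG).
  by case: k hx' => [|k] hx' k0; [rewrite hy' ?mulr0 | rewrite hx' ?mul0r].
move=> /odds_cons[ht hts] [u [v [hu hv ->]]] [u' [v' [hu' hv' ->]]].
have gu' := fil_gr hts hu'; have gv' := fil_gr hts hv'.
exists (u * u'), (u * v' + (-1) ^+ f * (v * u')); split; first exact: IH.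
  apply: filD.
    have := IH _ _ _ _ _ _ hts hu hv'; rewrite addbN.
    by case: l {hu' hv'} => [|l] //=; rewrite ?addn0 ?addnS //; apply: fil_pred.
  have := IH _ _ _ _ _ _ hts hv hu'; rewrite addNb => h.
  have {h} : fil ts (~~ (e (+) f)) (k + l).-1 (v * u').
    by case: k {hu hv} h => [|k] //= h; apply: fil_pred.
  by case: f {hu' hv' gu' gv'} => h; rewrite ?expr0 ?expr1 ?mul1r ?mulN1r //; apply: filN.
rewrite mulrDl !mulrDr mulrDl -!addrA; congr (_ + _).
have -> : v * t * (v' * t) = 0.
  have := gr_comm hG ht gv'; rewrite -mulrA (mulrA t) => ->.
  by rewrite -!mulrA (odd_sqr0 hG ht) !mulr0.
rewrite addr0 !mulrA; congr (_ + _); rewrite -mulrA (gr_comm hG ht gu') /=.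
by case: f {hu' hv' gu' gv'}; rewrite ?expr0 ?expr1 ?mul1r ?mulN1r ?mulNr ?mulrN mulrA.
Qed.

(** A product with more factors than the list has elements repeats an odd factor; this is what stops
    the iteration. *)
Lemma fil_last ts e k x : (size ts < k)%N -> fil ts e k x -> x = 0.
Proof.
elim: ts e k x => [|t ts IH] e k x /= lt; first by move=> [_ ->].
move=> [u [v [hu hv ->]]]; rewrite (IH _ _ _ _ hu) ?(IH _ _ _ _ hv) ?mul0r ?addr0 //; lia.
Qed.

Lemma fil_mem ts t : odds ts -> t \in ts -> fil ts true 1 t.
Proof.
elim: ts => // t' ts IH /odds_cons[ht' hts]; rewrite inE => /orP[/eqP->|/IH h] /=.
  exists 0, 1; split; [exact: fil_zero | | by rewrite add0r mul1r].
  by apply: fil0; apply: (gr1 hG).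
by exists t, 0; split; [apply: h | apply: fil_zero | rewrite mul0r addr0].
Qed.

Lemma fil_sum ts e k I (r : seq I) (P : pred I) (x : I -> G) :
  (forall i, P i -> fil ts e k (x i)) -> fil ts e k (\sum_(i <- r | P i) x i).
Proof. by move=> h; elim/big_ind: _ => //; [exact: fil_zero | exact: filD]. Qed.

Definition mxfil ts e k m n (X : 'M[G]_(m, n)) : Prop := forall i j, fil ts e k (X i j).

Lemma mxfilM ts e f k l m n r (X : 'M[G]_(m, n)) (Y : 'M[G]_(n, r)) : odds ts ->
  mxfil ts e k X -> mxfil ts f l Y -> mxfil ts (e (+) f) (k + l) (X *m Y).
Proof. by move=> h hX hY i j; rewrite mxE; apply: fil_sum => s _; apply: filM. Qed.

Lemma mxfilD ts e k m n (X Y : 'M[G]_(m, n)) :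
  mxfil ts e k X -> mxfil ts e k Y -> mxfil ts e k (X + Y).
Proof. by move=> hX hY i j; rewrite mxE; apply: filD. Qed.

Lemma mxfilN ts e k m n (X : 'M[G]_(m, n)) : mxfil ts e k X -> mxfil ts e k (- X).
Proof. by move=> hX i j; rewrite mxE; apply: filN. Qed.

Lemma mxfil0 ts e m n (X : 'M[G]_(m, n)) : mxin gr e X -> mxfil ts e 0 X.
Proof. by move=> hX i j; apply: fil0. Qed.
End List.

Section Riccati.
Variables (p q : nat) (a : 'M[G0]_p) (d : 'M[G0]_q).
Let h := mxhorner q.+1 a (char_poly d).
Hypothesis uh : h \in unitmx.
Local Notation A := (mval a).
Local Notation D := (mval d).

(** The sum of [A ^ i Y D ^ j] over [i + j = k - 1], which telescopes in [syl_sumE]. *)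
Fixpoint syl_sum k (Y : 'M[G]_(p, q)) : 'M[G]_(p, q) :=
  if k is k'.+1 then A *m syl_sum k' Y + Y *m mval (mxpow d k') else 0.

Lemma mxpowSr (K : comNzRingType) n (M : 'M[K]_n) k : mxpow M k.+1 = mxpow M k *m M.
Proof. by elim: k => [|k IH]; rewrite /= ?mulmx1 ?mul1mx // -mulmxA -IH. Qed.

Lemma syl_sumE k Y : A *m syl_sum k Y - syl_sum k Y *m D =
  mval (mxpow a k) *m Y - Y *m mval (mxpow d k).
Proof.
elim: k => [|k IH]; first by rewrite /= mulmx0 mul0mx !mval1 mul1mx mulmx1 !subrr.
rewrite [mxpow d k.+1]mxpowSr /= mulmxDl !mvalM -(mulmxA A (syl_sum k Y)) opprD.
by rewrite mulmxDr addrACA -mulmxBr IH mulmxBr !mulmxA addrA subrK.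
Qed.

Definition syl (Y : 'M[G]_(p, q)) : 'M[G]_(p, q) :=
  mval (invmx h) *m \sum_(k < q.+1) val (char_poly d)`_k *: syl_sum k Y.

Lemma mulmx_scale_central m n r (u : G0) (M : 'M[G]_(m, n)) (N : 'M[G]_(n, r)) :
  M *m (val u *: N) = val u *: (M *m N).
Proof.
apply/matrixP => i j; rewrite !mxE mulr_sumr; apply: eq_bigr => k _.
by rewrite mxE !mulrA even_central.
Qed.

Lemma mval_mxhorner n m (M : 'M[G0]_n) (w : {poly G0}) :
  mval (mxhorner m M w) = \sum_(k < m) val w`_k *: mval (mxpow M k).
Proof.
rewrite /mval [LHS](raddf_sum (map_mx valm)); apply: eq_bigr => k _.
exact: (map_mxZ valm).
Qed.

(** Weighting the telescoping identities by the coefficients of [char_poly d] gives [h] times [Y]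
    minus [Y] times [char_poly d] evaluated at [d], which is zero by Cayley-Hamilton. *)
Lemma sylE Y : A *m syl Y - syl Y *m D = Y.
Proof.
have ca : A *m mval (invmx h) = mval (invmx h) *m A.
  have ah : a *m h = h *m a.
    rewrite mulmx_sumr mulmx_suml; apply: eq_bigr => k _.
    by rewrite -scalemxAr -scalemxAl -mxpowSr.
  rewrite -!mvalM; congr mval.
  by rewrite -[LHS](mulKmx uh) (mulmxA h) -ah mulmxK.
rewrite /syl mulmxA ca -!mulmxA -mulmxBr mulmx_sumr mulmx_suml -sumrB.
rewrite (eq_bigr (fun k : 'I_q.+1 => val (char_poly d)`_k *: (mval (mxpow a k) *m Y) -
   val (char_poly d)`_k *: (Y *m mval (mxpow d k)))) => [|k _]; last first.
  by rewrite mulmx_scale_central -scalemxAl -!scalerBr syl_sumE.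
rewrite sumrB.
have -> : \sum_(k < q.+1) val (char_poly d)`_k *: (mval (mxpow a k) *m Y) = mval h *m Y.
  by rewrite mval_mxhorner mulmx_suml; apply: eq_bigr => k _; rewrite scalemxAl.
have -> : \sum_(k < q.+1) val (char_poly d)`_k *: (Y *m mval (mxpow d k)) = 0.
  transitivity (Y *m mval (mxhorner q.+1 d (char_poly d))).
    rewrite mval_mxhorner mulmx_sumr; apply: eq_bigr => k _.
    by rewrite mulmx_scale_central.
  rewrite mxhorner_char_poly; apply/matrixP => i j; rewrite !mxE big1 // => k _.
  by rewrite !mxE rmorph0 mulr0.
by rewrite subr0 mulmxA -mvalM mulVmx // mval1 mul1mx.
Qed.

Lemma syl_sumB k Y Z : syl_sum k (Y - Z) = syl_sum k Y - syl_sum k Z.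
Proof.
elim: k => [|k IH] /=; first by rewrite subrr.
by rewrite IH mulmxBr mulmxBl opprD addrACA.
Qed.

Lemma sylB Y Z : syl (Y - Z) = syl Y - syl Z.
Proof.
rewrite /syl -mulmxBr -sumrB; congr (_ *m _); apply: eq_bigr => k _.
by rewrite syl_sumB scalerBr.
Qed.

Variables (b : 'M[G]_(p, q)) (c : 'M[G]_(q, p)).
Hypotheses (hb : mxin gr true b) (hc : mxin gr true c).
Let ts : seq G := [seq b ij.1 ij.2 | ij : 'I_p * 'I_q] ++ [seq c ij.1 ij.2 | ij : 'I_q * 'I_p].

Let odd_ts t : t \in ts -> t \in gr true.
Proof. by rewrite mem_cat => /orP[] /mapP[ij _ ->]; [apply: hb | apply: hc]. Qed.

Let fb : mxfil ts true 1 b.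
Proof.
move=> i j; apply: (fil_mem odd_ts); rewrite mem_cat; apply/orP; left.
by apply/mapP; exists (i, j); rewrite ?mem_enum.
Qed.

Let fc : mxfil ts true 1 c.
Proof.
move=> i j; apply: (fil_mem odd_ts); rewrite mem_cat; apply/orP; right.
by apply/mapP; exists (i, j); rewrite ?mem_enum.
Qed.

Let fil_even_l k m n r (M : 'M[G0]_(m, n)) (Y : 'M[G]_(n, r)) :
  mxfil ts true k Y -> mxfil ts true k (mval M *m Y).
Proof. exact: (@mxfilM ts false true 0 k m n r (mval M) Y odd_ts (mxfil0 ts (mval_even M))). Qed.

Let fil_even_r k m n r (M : 'M[G0]_(n, r)) (Y : 'M[G]_(m, n)) :
  mxfil ts true k Y -> mxfil ts true k (Y *m mval M).
Proof.
move=> hY; have := mxfilM odd_ts hY (mxfil0 ts (mval_even M)).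
by rewrite addn0.
Qed.

Let fil_syl k Y : mxfil ts true k Y -> mxfil ts true k (syl Y).
Proof.
move=> hY; apply: fil_even_l => i j; rewrite summxE; apply: fil_sum => l _; rewrite mxE.
have hs : mxfil ts true k (syl_sum l Y).
  elim: (val l) => [|m IH] /=; first by move=> i' j'; rewrite mxE; apply: fil_zero.
  by apply: mxfilD; [apply: fil_even_l | apply: fil_even_r].
have hw : fil ts false 0 (val (char_poly d)`_l) by apply: fil0; apply: evalP.
exact: (filM odd_ts hw (hs i j)).
Qed.

Lemma riccati : exists2 X : 'M[G]_(p, q), mxin gr true X & A *m X + X *m c *m X = b + X *m D.
Proof.
(* Fixed-point iteration through the Sylvester solution: successive differences gain an odd factor
   at each step, so the sequence is stationary after [size ts] steps. *)
pose X := fix X n := if n is n'.+1 then syl (b - X n' *m c *m X n') else 0.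
have fX n : mxfil ts true 1 (X n).
  elim: n => [|n IH] /=; first by move=> i j; rewrite mxE; apply: fil_zero.
  apply: fil_syl; apply: mxfilD => //; apply: mxfilN => i j.
  exact: (fil_pred (fil_pred (mxfilM odd_ts (mxfilM odd_ts IH fc) IH i j))).
have dX n : mxfil ts true n.+1 (X n.+1 - X n).
  elim: n => [|n IH].
    by rewrite /= subr0 mul0mx mul0mx subr0; apply: fil_syl.
  rewrite [X n.+2]/= [X in _ - X]/= -sylB; apply: fil_syl.
  set U := X n.+1; set V := X n.
  have -> : b - U *m c *m U - (b - V *m c *m V) = - ((U - V) *m c *m U + V *m c *m (U - V)).
    by rewrite !mulmxBl mulmxBr [in RHS]addrA subrK !opprB addrC addrA subrK.
  apply: mxfilN; apply: mxfilD => i j.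
    have := fil_pred (mxfilM odd_ts (mxfilM odd_ts IH fc) (fX n.+1) i j).
    by rewrite !addn1.
  have := fil_pred (mxfilM odd_ts (mxfilM odd_ts (fX n) fc) IH i j).
  by rewrite !add1n.
exists (X (size ts)); first by move=> i j; apply: fil_gr odd_ts (fX _ i j).
set n := size ts; have e : X n.+1 = X n.
  apply/eqP; rewrite -subr_eq0; apply/eqP/matrixP => i j; rewrite [RHS]mxE.
  exact: fil_last (ltnSn _) (dX n i j).
have := sylE (b - X n *m c *m X n); rewrite -[syl _]/(X n.+1) e => /eqP.
by rewrite subr_eq addrAC eq_sym subr_eq => /eqP/esym.
Qed.
End Riccati.
End Filtration.

(** * The Berezinian *)

Section RectCells.
Variables r s : nat.
Local Notation N := (sumn (rect r s)).

Fact rect_row_subproof (i : 'I_N) : (reshape_index (rect r s) i < r)%N.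
Proof. by have := reshape_indexP (ltn_ord i); rewrite size_nseq. Qed.

Fact rect_col_subproof (i : 'I_N) : (reshape_offset (rect r s) i < s)%N.
Proof.
have := reshape_offsetP (ltn_ord i); rewrite nth_nseq.
by rewrite rect_row_subproof.
Qed.

Definition rect_row (i : 'I_N) : 'I_r := Ordinal (rect_row_subproof i).
Definition rect_col (i : 'I_N) : 'I_s := Ordinal (rect_col_subproof i).

Lemma rect_row_col : rect_cells rect_row rect_col.
Proof.
split=> [k l [e1] [e2]|i j].
  by apply: val_inj; rewrite /= -(reshape_indexK (rect r s) k) e1 e2 reshape_indexK.
have lj : (j < nth 0 (rect r s) i)%N by rewrite nth_nseq !ltn_ord.
exists (Ordinal (flatten_indexP lj)).
by rewrite -!(inj_eq val_inj) /= flatten_indexKl // flatten_indexKr // !eqxx.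
Qed.
End RectCells.

Section Assembly.
Variables (F : numClosedFieldType) (G : unitAlgType F) (gr : bool -> {pred G}).
Variable hG : supercommutative gr.
Local Notation G0 := (even_part hG).
Local Notation valm := (val : {rmorphism G0 -> G}).
Local Notation io := (even_scalar hG : {rmorphism F -> G0}).
Variables (p q : nat).
Implicit Types A : 'M[G]_(p + q).

Lemma even_scaleE (c : F) (x : G0) : c *: val x = val (io c * x).
Proof. by rewrite [RHS](rmorphM valm) /= -scalerAl mul1r. Qed.

Lemma tr_extE A n : even_mx gr A ->
  tr_ext gr A (Posz n) = (n`!%:R)^-1 *: \sum_(s : 'S_n) (-1) ^+ odd_perm s * trs A s.
Proof. by move=> hA; apply: strace_ext. Qed.

Lemma tr_youngE A r s : even_mx gr A -> tr_young gr A (rect r s) =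
  ((kappa (rect_row_col r s))%:~R)^-1 *: \sum_(a in fstab (@rect_row r s))
    \sum_(b in fstab (@rect_col r s)) (-1) ^+ odd_perm b * trs A (b * a)%g.
Proof.
move=> hA; rewrite /tr_young; apply: (strace_young hG hA) => [w|w]; last by [].
have er : row_stab (rect r s) = fstab (@rect_row r s).
  by apply/setP => a; rewrite !inE; apply: eq_forallb => i.
have ec : col_stab (rect r s) = fstab (@rect_col r s).
  by apply/setP => a; rewrite !inE; apply: eq_forallb => i.
split=> [[u _ <-]|[u ->]]; exists u; rewrite /young_symmetrizer ?er ?ec //.
Qed.

Lemma tr_ext_lower A k : even_mx gr A -> ursubmx A = 0 ->
  tr_ext gr A k = val (ck io (mxa hG A) (mxd hG A) k).
Proof.
move=> hA A0; case: k => n; last by rewrite [RHS](rmorph0 valm).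
rewrite tr_extE // -even_scaleE; congr (_ *: _).
rewrite [RHS](rmorph_sum valm); apply: eq_bigr => s _.
by rewrite [RHS](rmorphM valm) rmorphXn rmorphN1 (trs_lower hG).
Qed.

Lemma tr_young_lower A r s : even_mx gr A -> ursubmx A = 0 ->
  tr_young gr A (rect r s) = val (io ((kappa (rect_row_col r s))%:~R)^-1 *
    fw (@rect_row r s) (@rect_col r s) (mxa hG A) (mxd hG A)).
Proof.
move=> hA A0; rewrite tr_youngE // -even_scaleE; congr (_ *: _).
rewrite [RHS](rmorph_sum valm); apply: eq_bigr => u _.
rewrite [RHS](rmorph_sum valm); apply: eq_bigr => v _.
by rewrite [RHS](rmorphM valm) rmorphXn rmorphN1 (trs_lower hG).
Qed.

Section Conj.
Variables A g h : 'M[G]_(p + q).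
Hypotheses (hA : even_mx gr A) (hg : even_mx gr g) (hh : even_mx gr h) (hgE : h *m g = 1%:M).

Lemma even_mxM (B C : 'M[G]_(p + q)) : even_mx gr B -> even_mx gr C -> even_mx gr (B *m C).
Proof.
move=> hB hC i j; rewrite mxE; apply: (gr_sum_in hG) => k _.
by rewrite -[vpar i](addbK (vpar k)) -addbA (grM hG).
Qed.

Let hgAh : even_mx gr (g *m A *m h). Proof. by do 2?apply: even_mxM. Qed.

Lemma tr_ext_conj k : tr_ext gr (g *m A *m h) k = tr_ext gr A k.
Proof.
case: k => n //; rewrite !tr_extE //; congr (_ *: _); apply: eq_bigr => s _.
by rewrite (trs_conj hG).
Qed.

Lemma tr_young_conj r s : tr_young gr (g *m A *m h) (rect r s) = tr_young gr A (rect r s).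
Proof.
rewrite !tr_youngE //; congr (_ *: _); apply: eq_bigr => u _; apply: eq_bigr => v _.
by rewrite (trs_conj hG).
Qed.
End Conj.

Lemma hankel_val (c : int -> G) (c0 : int -> G0) a m : (forall k, c k = val (c0 k)) ->
  hankel c a m = val (hk c0 a m).
Proof.
move=> h; rewrite /hankel /hk -[RHS](det_map_mx valm).
by congr (\det _); apply/matrixP => i j; rewrite !mxE h.
Qed.

Lemma tr_ext_even A k : even_mx gr A -> tr_ext gr A k \in gr false.
Proof.
move=> hA; case: k => n /=; last exact: (gr0 hG).
rewrite -[X in X \in _]/(tr_ext gr A n) tr_extE //; apply: (grZ hG).
apply: (gr_sum_in hG) => s _; apply: (gr_sign hG); exact: (trs_even hG).
Qed.

(** Valid before any conjugation: it carries the unit hypothesis from [A] over to the diagonal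
    blocks, where [law_res] factors the determinant. *)
Lemma hankel_nilp A a m : even_mx gr A ->
  nilp (dn hG (hankel (tr_ext gr A) a m) - hk (ck io (mxa hG A) (mxd hG A)) a m).
Proof.
move=> hA; pose c0 k := dn hG (tr_ext gr A k).
have c0E k : tr_ext gr A k = val (c0 k) by rewrite dnK // tr_ext_even.
have -> : dn hG (hankel (tr_ext gr A) a m) = hk c0 a m.
  by apply: val_inj; rewrite (hankel_val _ _ c0E) dnK //; apply: evalP.
apply: nilp_sub_det => i j; rewrite !mxE; case: (a + i%:Z + j%:Z) => n; last first.
  rewrite /c0 /= subr0 (_ : dn hG 0 = 0); first exact: nilp0.
  by apply: val_inj; rewrite dnK ?(gr0 hG) // [RHS](rmorph0 valm).
pose t (s : 'S_n) := dn hG (trs A s).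
have -> : c0 n = io (n`!%:R)^-1 * \sum_(s : 'S_n) (-1) ^+ odd_perm s * t s.
  apply: val_inj; rewrite -c0E tr_extE // -even_scaleE; congr (_ *: _).
  rewrite [RHS](rmorph_sum valm); apply: eq_bigr => s _.
  rewrite [RHS](rmorphM valm) rmorphXn rmorphN1 /=; congr (_ * _).
  by apply: esym; apply: dnK; apply: (trs_even hG).
rewrite /= -mulrBr -sumrB mulrC; apply: nilpM; apply: nilp_sum => s _.
by rewrite -mulrBr mulrC; apply: nilpM; apply: trs_nilp.
Qed.

Lemma inv_mx_mval n (M : 'M[G0]_n) : M \in unitmx -> inv_mx (mval M) = mval (invmx M).
Proof.
move=> uM; have h1 : mval M *m mval (invmx M) = 1%:M by rewrite -mvalM mulmxV // mval1.
have h2 : mval (invmx M) *m mval M = 1%:M by rewrite -mvalM mulVmx // mval1.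
apply: classical_sets.xget_unique => // B [e1 e2].
by rewrite -[B]mulmx1 -h1 mulmxA e2 mul1mx.
Qed.

Section Blocks.
Variable A : 'M[G]_(p + q).
Hypothesis hA : even_mx gr A.

Lemma ul_mval : ulsubmx A = mval (mxa hG A).
Proof.
apply/matrixP => i j; rewrite !mxE dnK //; have := hA (lshift q i) (lshift q j).
by rewrite !vpar_lshift.
Qed.

Lemma dr_mval : drsubmx A = mval (mxd hG A).
Proof.
apply/matrixP => i j; rewrite !mxE dnK //; have := hA (rshift p i) (rshift p j).
by rewrite !vpar_rshift.
Qed.

Lemma ur_odd : mxin gr true (ursubmx A).
Proof.
by move=> i j; rewrite !mxE; have := hA (lshift q i) (rshift p j); rewrite vpar_lshift vpar_rshift.
Qed.

Lemma dl_odd : mxin gr true (dlsubmx A).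
Proof.
by move=> i j; rewrite !mxE; have := hA (rshift p i) (lshift q j); rewrite vpar_lshift vpar_rshift.
Qed.
End Blocks.

Lemma even_unipotent (X : 'M[G]_(p, q)) : mxin gr true X -> even_mx gr (block_mx 1%:M X 0 1%:M).
Proof.
move=> hX i j; case: (split_ordP i) => i' ->; case: (split_ordP j) => j' ->;
  rewrite ?vpar_lshift ?vpar_rshift ?block_mxEul ?block_mxEur ?block_mxEdl ?block_mxEdr //=.
- exact: (mxin1 hG).
- by rewrite mxE; apply: (gr0 hG).
exact: (mxin1 hG).
Qed.

(* Once [X] solves the Riccati equation, conjugation by the unipotent matrix with upper
   right block [X] makes [A] block triangular. *)
Section Triangular.
Variable A : 'M[G]_(p + q).
Hypothesis hA : even_mx gr A.
Local Notation a := (mxa hG A).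
Local Notation d := (mxd hG A).
Local Notation b := (ursubmx A).
Local Notation c := (dlsubmx A).
Variable X : 'M[G]_(p, q).
Hypotheses (hX : mxin gr true X) (eX : mval a *m X + X *m c *m X = b + X *m mval d).
Hypothesis ud : d \in unitmx.

Let g := block_mx 1%:M X 0 1%:M : 'M[G]_(p + q).
Let h := block_mx 1%:M (- X) 0 1%:M : 'M[G]_(p + q).
Let A' := g *m A *m h.

Lemma triangular_form : A' = block_mx (mval a + X *m c) 0 c (mval d - c *m X).
Proof.
have eA : A = block_mx (mval a) b c (mval d) by rewrite -ul_mval // -dr_mval // submxK.
rewrite /A' {1}eA /g /h !mulmx_block.
rewrite !mul1mx !mul0mx !mulmx1 !mulmx0 !add0r !addr0 !mulmxN; congr block_mx.
  by rewrite mulmxDl eX addrC subrr.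
by rewrite addrC.
Qed.

Let a' := mxa hG A'.
Let d' := mxd hG A'.

Let hA' : even_mx gr A'.
Proof.
by do 2?apply: even_mxM => //; apply: even_unipotent => //; apply: (mxinN hG).
Qed.

(** With [eta] for [d^-1 c], the Riccati equation reads [b = a' X - X d]. Hence the Schur complement
    of [d] is [a' (1 - X eta)], while [d' = d (1 - eta X)], and the two correction determinants are
    mutually inverse by [det_odd]. *)
Lemma Ber_triangular : Ber A = val (\det a' / \det d').
Proof.
have ea : mval a' = mval a + X *m c by rewrite -(ul_mval hA') triangular_form block_mxKul.
have ed : mval d' = mval d - c *m X by rewrite -(dr_mval hA') triangular_form block_mxKdr.
pose eta := mval (invmx d) *m c.
have heta : mxin gr true eta by apply: (mxinM hG (mval_even _) (dl_odd hA)).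
have dK : mval d *m mval (invmx d) = 1%:M by rewrite -mvalM mulmxV // mval1.
have eb : b = mval a' *m X - X *m mval d.
  by rewrite ea mulmxDl eX addrK.
have Xe : mxin gr false (X *m eta) by apply: (mxinM hG hX heta).
have eXm : mxin gr false (eta *m X) by apply: (mxinM hG heta hX).
have e1 : mval a - b *m mval (invmx d) *m c = mval (a' *m (1%:M - mdn hG (X *m eta))).
  rewrite mvalM mvalB mval1 mdnK // mulmxBr mulmx1 -mulmxA -/eta eb mulmxBl.
  rewrite -(mulmxA X (mval d)) /eta (mulmxA (mval d)) dK mul1mx mulmxA.
  by rewrite !mulmxA opprB addrA -ea.
have e2 : d' = d *m (1%:M - mdn hG (eta *m X)).
  rewrite -[LHS](mvalK d') -[RHS](mvalK (hG := hG)); congr mdn.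
  rewrite ed mvalM mvalB mval1 mdnK // mulmxBr mulmx1 /eta -mulmxA (mulmxA (mval d)) dK.
  by rewrite mul1mx.
have uv := det_odd hG hX heta.
have ddu : \det d \is a GRing.unit by rewrite -unitmxE.
rewrite /Ber dr_mval // ul_mval // inv_mx_mval // e1 !det_mval.
rewrite -[(val (\det d))^-1](rmorphV valm ddu).
rewrite -[LHS](rmorphM valm); congr val.
rewrite det_mulmx -!mulrA; congr (_ * _); rewrite e2 det_mulmx.
move: uv; set u := \det (1%:M - _); set v := \det (1%:M - _) => uv.
have uvu : v \is a GRing.unit by apply/unitrPr; exists u; rewrite mulrC.
have vV : v^-1 = u by rewrite -[LHS]mul1r -uv mulrK.
by rewrite invrM // vV.
Qed.

Hypothesis uH : hankel (tr_ext gr A) (p%:Z - q%:Z + 2) q \is a GRing.unit.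

Lemma tr_ext_triangular k : tr_ext gr A k = val (ck io a' d' k).
Proof.
have ur0 : ursubmx A' = 0 by rewrite triangular_form block_mxKur.
rewrite -tr_ext_lower // /A' tr_ext_conj //.
- exact: even_unipotent.
- by apply: even_unipotent; apply: (mxinN hG).
by rewrite /g /h mulmx_block !mul0mx !mulmx0 !mul1mx !mulmx1 !addr0 add0r subrr -scalar_mx_block.
Qed.

Lemma tr_young_triangular r s : tr_young gr A (rect r s) =
  val (io ((kappa (rect_row_col r s))%:~R)^-1 * fw (@rect_row r s) (@rect_col r s) a' d').
Proof.
have ur0 : ursubmx A' = 0 by rewrite triangular_form block_mxKur.
rewrite -tr_young_lower // /A' tr_young_conj //.
- exact: even_unipotent.
- by apply: even_unipotent; apply: (mxinN hG).
by rewrite /g /h mulmx_block !mul0mx !mulmx0 !mul1mx !mulmx1 !addr0 add0r subrr -scalar_mx_block.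
Qed.

Let uH' : hk (ck io a' d') (p%:Z - q%:Z + 2) q \is a GRing.unit.
Proof. by rewrite -unit_even -(hankel_val _ _ tr_ext_triangular). Qed.

Let udd : \det d' \is a GRing.unit.
Proof. by move: uH'; rewrite law_res !unitrM => /andP[/andP[]]. Qed.

Lemma Ber_hankel : Ber A =
  hankel (tr_ext gr A) (p%:Z - q%:Z) q.+1 / hankel (tr_ext gr A) (p%:Z - q%:Z + 2) q.
Proof.
rewrite Ber_triangular !(hankel_val _ _ tr_ext_triangular).
rewrite -[(val (hk _ _ _))^-1](rmorphV valm uH').
rewrite -[RHS](rmorphM valm); congr val.
apply: (mulIr uH'); rewrite divrK // -mulrAC -hk_ratio.
by rewrite mulrAC divrr // mul1r.
Qed.

Let th : G0 := io ((kappa (rect_row_col p.+1 q))%:~R)^-1 * fw (@rect_row p.+1 q) (@rect_col p.+1 q) a' d'.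
Let tw : G0 := io ((kappa (rect_row_col p q.+1))%:~R)^-1 * fw (@rect_row p q.+1) (@rect_col p q.+1) a' d'.

Let kappaV N r s (row : 'I_N -> 'I_r) (col : 'I_N -> 'I_s) (rc : rect_cells row col) :
  io ((kappa rc)%:~R)^-1 * (kappa rc)%:~R = 1 :> G0.
Proof.
by rewrite -[X in _ * X](rmorph_int io) -rmorphM mulVf ?rmorph1 // intr_eq0 kappa_neq0.
Qed.

(** By [law_high] this trace is the Hankel denominator up to sign, once [kappa] has cancelled. *)
Let uth : th \is a GRing.unit.
Proof.
have k1 := kappaV (rect_row_col p.+1 q); have := uH'.
rewrite /th (law_high (rect_row_col p.+1 q) io).
move: (hk _ _ _) (io ((kappa (rect_row_col p.+1 q))%:~R)^-1) ((kappa (rect_row_col p.+1 q))%:~R : G0) k1 => H i k k1 uHH.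
set u := (-1) ^+ _; set v := (-1) ^+ _; set w := (-1) ^+ _.
rewrite (_ : _ * _ = i * k * (u * v * w * H)); last by ring.
by rewrite k1 mul1r !unitrM uHH !unitrX ?unitrN1.
Qed.

Lemma Ber_young : unit_in (gr false) (tr_young gr A (rect p.+1 q)) /\
  (Ber A = tr_young gr A (rect p q.+1) / tr_young gr A (rect p.+1 q) \/
   Ber A = - (tr_young gr A (rect p q.+1) / tr_young gr A (rect p.+1 q))).
Proof.
rewrite !tr_young_triangular -/th -/tw; split.
  by split; [apply: evalP | rewrite unit_even | exact: (even_inv hG (evalP th))].
have e : exists b : bool, \det d' * tw = (-1) ^+ b * (\det a' * th).
  (* The sign is the one of [law_wide]; its factors [kappa] cancel against the normalizations of the
     two traces. *)
  exists (odd (sumn (rect p.+1 q) + p * q)); rewrite signr_odd.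
  have := law_wide (rect_row_col p.+1 q) (rect_row_col p q.+1) io a' d'.
  have k1 := kappaV (rect_row_col p.+1 q); have k2 := kappaV (rect_row_col p q.+1).
  move: k1 k2; rewrite /tw /th.
  move: (io ((kappa (rect_row_col p.+1 q))%:~R)^-1) (io ((kappa (rect_row_col p q.+1))%:~R)^-1) => i1 i2.
  move: ((kappa (rect_row_col p.+1 q))%:~R : G0) ((kappa (rect_row_col p q.+1))%:~R : G0) => k1 k2.
  move: (fw _ _ _ _) (fw _ _ _ _) (\det a') (\det d') ((-1) ^+ _) => f1 f2 x y s e1 e2 E.
  transitivity (i1 * i2 * (k1 * (y * f2))).
    by rewrite -[LHS]mul1r -e1; ring.
  rewrite E (_ : _ * _ = i2 * k2 * (s * (x * (i1 * f1)))); last by ring.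
  by rewrite e2 mul1r.
have [s es] := e; rewrite Ber_triangular.
rewrite -[(val th)^-1](rmorphV valm uth).
rewrite -[val tw * _](rmorphM valm).
have eB : \det a' / \det d' = (-1) ^+ s * (tw / th).
  apply: (mulIr uth); apply: (mulIr udd).
  rewrite [LHS]mulrAC divrK // -(mulrA _ _ th) divrK // -mulrA [tw * _]mulrC es.
  by rewrite signrMK.
rewrite eB; case: s {es eB}; [right|left]; rewrite ?mul1r //.
by rewrite expr1 mulN1r [LHS](rmorphN valm).
Qed.
End Triangular.

(** Modulo nilpotents the Hankel determinant contains [det d] and the resultant as factors: the
    first serves the Berezinian, the second the Riccati equation. *)
Lemma triangularizable A : even_mx gr A ->
  hankel (tr_ext gr A) (p%:Z - q%:Z + 2) q \is a GRing.unit ->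
  mxd hG A \in unitmx /\ exists2 X : 'M[G]_(p, q), mxin gr true X &
    mval (mxa hG A) *m X + X *m dlsubmx A *m X = ursubmx A + X *m mval (mxd hG A).
Proof.
move=> hA uH; have even_uH : hankel (tr_ext gr A) (p%:Z - q%:Z + 2) q \in gr false.
  pose c0 k := dn hG (tr_ext gr A k).
  have c0E k : tr_ext gr A k = val (c0 k) by rewrite dnK // tr_ext_even.
  by rewrite (hankel_val _ _ c0E); apply: evalP.
have : dn hG (hankel (tr_ext gr A) (p%:Z - q%:Z + 2) q) \is a GRing.unit.
  by rewrite -unit_even dnK.
move=> /(unit_sub_nilp (hankel_nilp (p%:Z - q%:Z + 2) q hA)).
rewrite law_res !unitrM => /andP[/andP[_ ud] uh]; split; first by rewrite unitmxE.
by apply: riccati; [rewrite unitmxE | apply: ur_odd | apply: dl_odd].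
Qed.
End Assembly.

Theorem theorem2 (R : realType) (G : unitAlgType R[i]) (gr : bool -> {pred G})
    (hG : supercommutative gr) (p q : nat) (A : 'M[G]_(p + q))
    (A_even : even_mx gr A) (A_inv : invertible_mx A) :
  let c := tr_ext gr A in
  unit_in (gr false) (hankel c (p%:Z - q%:Z + 2%:Z) q) ->
  Ber A = hankel c (p%:Z - q%:Z) q.+1 / hankel c (p%:Z - q%:Z + 2%:Z) q
  /\ unit_in (gr false) (tr_young gr A (rect p.+1 q))
  /\ (Ber A = tr_young gr A (rect p q.+1) / tr_young gr A (rect p.+1 q)
      \/ Ber A = - (tr_young gr A (rect p q.+1) / tr_young gr A (rect p.+1 q))).
Proof.
move=> c [_ uH _].
have [ud [X hX eX]] := triangularizable (F := R[i]) hG A_even uH.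
split; first exact: (Ber_hankel (F := R[i]) A_even hX eX ud uH).
exact: (Ber_young (F := R[i]) A_even hX eX ud uH).
Qed.
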